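(* Let $A,B\in\mathbb{R}_{\max}^{m\times n}$ have no rows identically equal to $-\infty$ and no common column identically equal to $-\infty$, and suppose that every entry of $A$ and $B$ is either $-\infty$ or an integer with absolute value bounded by $M$. Denote $\kappa:=\min(2m,n)$. 1. In general, the identification of $\mathrm{spec}(A,B)$ requires no more than $M\cdot O(\kappa^3)$ calls to the mean-payoff game oracle, whose worst-case complexity (per call) is $\mathrm{MPG}(2m,n,2\kappa(M+2M\kappa))$. In particular, $\mathrm{spec}(A,B)$ can be identified in pseudo-polynomial time. 2. If $A$ and $B$ have no columns identically equal to $-\infty$, then the number of calls to the oracle needed to identify $\mathrm{spec}(A,B)$ does not exceed $\big(\max_i(B^{\sharp}A0)_i+\max_i(A^{\sharp}B0)_i\big)\cdot O(\kappa^2)$, and the complexity of the oracle (per call) does not exceed $\mathrm{MPG}(2m,n,6M\kappa)$ operations. Here $0$ denotes the $n$-vector of all zeros.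
   Context: $\mathbb{R}_{\max}=\mathbb{R}\cup\{-\infty\}$. For $A=(a_{ij})\in\mathbb{R}_{\max}^{m\times n}$ and $x\in\mathbb{R}_{\max}^n$, $(Ax)_i=\max_j(a_{ij}+x_j)$. For $y\in\mathbb{R}_{\max}^m$, $(A^{\sharp}y)_j=\min_{1\le i\le m}(-a_{ij}+y_i)$ with $(-\infty)+(+\infty)=+\infty$. $A^{\sharp}B$ denotes the composition $x\mapsto A^{\sharp}(Bx)$. $\mathrm{spec}(A,B)$ is the set of $\lambda\in\mathbb{R}$ for which $Ax=\lambda+Bx$ for some $x\in\mathbb{R}_{\max}^n$ with at least one component not equal to $-\infty$. For an order-preserving, additively homogeneous map $f$ of $\mathbb{R}_{\max}^n$ to itself, continuous for the metric $\max_i|e^{x_i}-e^{y_i}|$, $r(f)=\max\{\lambda\in\mathbb{R}_{\max}\mid\exists x\in\mathbb{R}_{\max}^n,\ x\not\equiv-\infty,\ \lambda+x=f(x)\}$. Mean-payoff game oracle: a procedure which, given matrices $A',B'\in\mathbb{R}_{\max}^{m'\times n'}$ whose entries are $-\infty$ or integers of absolute value at most $M'$, computes $r((A')^{\sharp}B')$. Equivalently, it computes the greatest value, over starting nodes of player Min, of the zero-sum deterministic mean-payoff game with $m'$ nodes of Max and $n'$ nodes of Min, in which from node $j$ of Min she moves to a node $i$ of Max with $a'_{ij}\neq-\infty$, paying him $-a'_{ij}$, and from $i$ Max moves to a node $k$ of Min with $b'_{ik}\ne-\infty$, receiving $b'_{ik}$, the payoff being the average payment per turn (a pair of consecutive moves).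 $\mathrm{MPG}(m',n',M')$ denotes the worst-case execution time of the oracle on such inputs; it is known (Zwick–Paterson) that there is an oracle for which $\mathrm{MPG}(m',n',M')$ is pseudo-polynomial. $O(\cdot)$ constants are absolute.
   Formalization: Part 1's call bound is stated for M ≥ 1. In part 2, the call bound is stated when max(B^#A0)+max(A^#B0) is positive; if this sum is zero at most one call is made, and if it is negative (where the printed bound is impossible) no call is made. *)

(* Defs.v *)
(* MathComp world, with the extended reals of MathComp-Analysis. *)
From HB Require Import structures.
From mathcomp Require Import all_boot all_order all_algebra.
From mathcomp Require Import classical_sets constructive_ereal reals.

Set Implicit Arguments.
Unset Strict Implicit.
Unset Printing Implicit Defensive.

Import Order.TTheory GRing.Theory Num.Theory.

Local Open Scope classical_set_scope.
Local Open Scope ring_scope.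

Section MaxPlus.
Context {R : realType}.
Implicit Types m n : nat.

(* R_max is \bar R without +oo. Vectors take values in \bar R because A^# y
   may have +oo entries; the restriction to R_max is [Rmax_vec]. *)
Definition Rmax_vec n (x : 'I_n -> \bar R) : Prop := forall j, x j <> +oo%E.

Definition nontrivial n (x : 'I_n -> \bar R) : Prop := exists j, x j <> -oo%E.

Definition mpmul m n (A : 'M[\bar R]_(m, n)) (x : 'I_n -> \bar R)
    : 'I_m -> \bar R :=
  fun i => \big[maxe/-oo%E]_(j < n) (A i j + x j)%E.

(* The dual addition %dE has (-oo) + (+oo) = +oo. *)
Definition mpres m n (A : 'M[\bar R]_(m, n)) (y : 'I_m -> \bar R)
    : 'I_n -> \bar R :=
  fun j => \big[mine/+oo%E]_(i < m) ((- A i j)%E + y i)%dE.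

Definition spec m n (A B : 'M[\bar R]_(m, n)) : set R :=
  [set l | exists x : 'I_n -> \bar R,
     [/\ Rmax_vec x, nontrivial x &
         forall i, mpmul A x i = (l%:E + mpmul B x i)%E]].

(* [is_r f l] : l = r(f) is the greatest eigenvalue of f in R_max. *)
Definition eigenvalues n (f : ('I_n -> \bar R) -> 'I_n -> \bar R)
    : set (\bar R) :=
  [set l | l <> +oo%E /\ exists x : 'I_n -> \bar R,
     [/\ Rmax_vec x, nontrivial x & forall j, (l + x j)%E = f x j]].

Definition is_r n (f : ('I_n -> \bar R) -> 'I_n -> \bar R) (l : \bar R) : Prop :=
  eigenvalues f l /\ forall l', eigenvalues f l' -> (l' <= l)%E.

(* max_j (B^# A 0)_j *)
Definition max_res m n (A B : 'M[\bar R]_(m, n)) : \bar R :=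
  \big[maxe/-oo%E]_(j < n) mpres B (mpmul A (fun=> 0%E)) j.

End MaxPlus.

(* Matrices whose entries are integers or -oo are the concrete data of
   algorithms; -oo is encoded by None. *)
Definition intmx (m n : nat) : Type := 'M[option int]_(m, n).

Definition Rmx (R : realType) m n (A : intmx m n) : 'M[\bar R]_(m, n) :=
  \matrix_(i, j) (if A i j is Some z then (z%:~R)%:E else -oo%E).

Definition entries_bounded m n (M : nat) (A : intmx m n) : bool :=
  [forall i, forall j, if A i j is Some z then (`|z| <= M)%N else true].

Definition no_infty_row m n (A : intmx m n) : bool :=
  [forall i, exists j, A i j != None].

Definition no_infty_col m n (A : intmx m n) : bool :=
  [forall j, exists i, A i j != None].

Definition no_common_infty_col m n (A B : intmx m n) : bool :=
  [forall j, exists i, (A i j != None) || (B i j != None)].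

Record query : Type := Query {
  q_rows : nat;
  q_cols : nat;
  q_A : intmx q_rows q_cols;
  q_B : intmx q_rows q_cols }.

(* Every node of the game has a move. This is what makes A^# B a self-map of
   R_max^n, and makes r (A^# B), the value of the game, finite and rational. *)
Definition playable (q : query) : bool :=
  [&& (0 < q_cols q)%N, no_infty_col (q_A q) & no_infty_row (q_B q)].

(* q is an instance of the mean-payoff problem of size (m, n, M). *)
Definition mpg_instance (m n M : nat) (q : query) : bool :=
  [&& q_rows q == m, q_cols q == n, playable q,
      entries_bounded M (q_A q) & entries_bounded M (q_B q)].

Record oracle : Type := Oracle {
  answer : query -> rat;
  time : query -> nat }.

Definition mpg_oracle (R : realType) (o : oracle) : Prop :=
  forall q, playable q ->
    is_r (fun x => mpres (Rmx R (q_A q)) (mpmul (Rmx R (q_B q)) x))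
         (ratr (answer o q))%:E.

Definition time_bounded (o : oracle) (MPG : nat -> nat -> nat -> nat) : Prop :=
  forall m n M q, mpg_instance m n M q -> (time o q <= MPG m n M)%N.

(* Algorithms are programs of a random access machine over the integers, with
   an oracle instruction. Memory consists of countably many arrays with two
   integer indices. Each elementary instruction or test costs one unit. The
   only arithmetic operations are + and -, so that an instruction of a fixed
   program lengthens the largest integer in memory by O(1) bits: unit cost is
   then polynomially related to time on a Turing machine. (It would not be with
   multiplication.) *)
Definition store : Type := nat -> int -> int -> int.

Definition upd (s : store) (a : nat) (i j v : int) : store :=
  fun a' i' j' => if [&& a' == a, i' == i & j' == j] then v else s a' i' j'.

Inductive aexp : Type :=
| Cst of int
| Get of nat & aexp & aexp
| Add of aexp & aexp
| Sub of aexp & aexp.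

Fixpoint aeval (s : store) (e : aexp) : int :=
  match e with
  | Cst z => z
  | Get a e1 e2 => s a (aeval s e1) (aeval s e2)
  | Add e1 e2 => aeval s e1 + aeval s e2
  | Sub e1 e2 => aeval s e1 - aeval s e2
  end.

(* [Set_ a e1 e2 e] is a[e1][e2] := e and the test of [If] and [While] is
   e1 <= e2. [Call f v f' v' em en a] queries the oracle on the em x en
   matrices stored in the arrays (f, v) and (f', v') as in [read_mx], and
   stores the numerator and denominator of the answer in a[0][0], a[0][1]. *)
Inductive cmd : Type :=
| Skip
| Set_ of nat & aexp & aexp & aexp
| Seq of cmd & cmd
| If of aexp & aexp & cmd & cmd
| While of aexp & aexp & cmd
| Call of nat & nat & nat & nat & aexp & aexp & nat.

(* The array f flags the entries that are not -oo, v holds their values. *)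
Definition read_mx (s : store) (f v m n : nat) : intmx m n :=
  \matrix_(i, j) (if s f (i : nat)%:Z (j : nat)%:Z == 0 then None
                  else Some (s v (i : nat)%:Z (j : nat)%:Z)).

Definition read_query (s : store) (f v f' v' : nat) (em en : aexp) : query :=
  let m := `|aeval s em|%N in let n := `|aeval s en|%N in
  Query (read_mx s f v m n) (read_mx s f' v' m n).

(* [exec o c s s' t qs] : started in s, the program c halts in s' after t
   units of time, not counting the time spent by the oracle, having submitted
   the queries qs in this order. *)
Inductive exec (o : oracle) : cmd -> store -> store -> nat -> seq query -> Prop :=
| ExecSkip s : exec o Skip s s 1 [::]
| ExecSet s a e1 e2 e :
    exec o (Set_ a e1 e2 e) s
      (upd s a (aeval s e1) (aeval s e2) (aeval s e)) 1 [::]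
| ExecSeq c1 c2 s s1 s2 t1 t2 qs1 qs2 :
    exec o c1 s s1 t1 qs1 -> exec o c2 s1 s2 t2 qs2 ->
    exec o (Seq c1 c2) s s2 (t1 + t2) (qs1 ++ qs2)
| ExecIf e1 e2 c1 c2 s s' t qs :
    exec o (if aeval s e1 <= aeval s e2 then c1 else c2) s s' t qs ->
    exec o (If e1 e2 c1 c2) s s' t.+1 qs
| ExecWhileEnd e1 e2 c s :
    ~~ (aeval s e1 <= aeval s e2) -> exec o (While e1 e2 c) s s 1 [::]
| ExecWhileStep e1 e2 c s s1 s2 t1 t2 qs1 qs2 :
    aeval s e1 <= aeval s e2 ->
    exec o c s s1 t1 qs1 -> exec o (While e1 e2 c) s1 s2 t2 qs2 ->
    exec o (While e1 e2 c) s s2 (t1 + t2).+1 (qs1 ++ qs2)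
| ExecCall s f v f' v' em en a :
    let q := read_query s f v f' v' em en in
    exec o (Call f v f' v' em en a) s
      (upd (upd s a 0 0 (numq (answer o q))) a 0 1 (denq (answer o q))) 1 [:: q].

(* A run, when it exists, is unique. *)
Lemma exec_det o c s s1 s2 t1 t2 qs1 qs2 :
  exec o c s s1 t1 qs1 -> exec o c s s2 t2 qs2 ->
  [/\ s1 = s2, t1 = t2 & qs1 = qs2].
Proof.
move=> E; elim: E s2 t2 qs2 => {c s s1 t1 qs1}.
- by move=> s s2 t2 qs2 E; inversion E.
- by move=> s a e1 e2 e s2 t2 qs2 E; inversion E.
- move=> c1 c2 s s1 s2 t1 t2 qs1 qs2 _ IH1 _ IH2 s3 t3 qs3 E.
  inversion E as [| |? ? ? ? ? ? ? ? ? E1 E2| | | |]; subst.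
  by case: (IH1 _ _ _ E1) => ? ? ?; subst; case: (IH2 _ _ _ E2) => -> -> ->.
- move=> e1 e2 c1 c2 s s' t qs _ IH s2 t2 qs2 E.
  inversion E as [| | |? ? ? ? ? ? ? ? E1| | |]; subst.
  by case: (IH _ _ _ E1) => -> -> ->.
- move=> e1 e2 c s /negP N s2 t2 qs2 E.
  by inversion E as [| | | | |? ? ? ? ? ? ? ? ? ? L|].
- move=> e1 e2 c s s1 s2 t1 t2 qs1 qs2 L _ IH1 _ IH2 s3 t3 qs3 E.
  inversion E as [| | | |? ? ? ? N|? ? ? ? ? ? ? ? ? ? _ E1 E2|]; subst.
    by rewrite L in N.
  by case: (IH1 _ _ _ E1) => ? ? ?; subst; case: (IH2 _ _ _ E2) => -> -> ->.
- by move=> s f v f' v' em en a q s2 t2 qs2 E; inversion E.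
Qed.

Definition cell m n (A : intmx m n) (i j : int) : option int :=
  match i, j with
  | Posz i, Posz j =>
      match (insub i : option 'I_m), (insub j : option 'I_n) with
      | Some i, Some j => A i j
      | _, _ => None
      end
  | _, _ => None
  end.

(* Initial store on input (A, B): the dimensions are in cells [0][0] and [0][1]
   of array 0, A is in arrays (1, 2) and B in arrays (3, 4), encoded as in
   [read_mx]; all other cells are zero. *)
Definition init m n (A B : intmx m n) : store :=
  fun a i j =>
    match a with
    | 0%N => if i == 0 then
               if j == 0 then m%:Z else if j == 1 then n%:Z else 0
             else 0
    | 1%N => if cell A i j is Some _ then 1 else 0
    | 2%N => if cell A i j is Some z then z else 0
    | 3%N => if cell B i j is Some _ then 1 else 0
    | 4%N => if cell B i j is Some z then z else 0
    | _ => 0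
    end.

(* The result is a finite list of closed intervals with rational or infinite
   endpoints. Its length is in cell [0][0] of array 5. Row k of array 6 holds
   the k-th interval as (f, p, q, f', p', q'), with lower endpoint p / q, or
   -oo if f = 0, and upper endpoint p' / q', or +oo if f' = 0. *)
Definition out_interval (R : realType) (s : store) (k : int) : set R :=
  [set l | (s 6%N k 0 != 0 -> (s 6%N k 1)%:~R / (s 6%N k 2)%:~R <= l) /\
           (s 6%N k 3 != 0 -> l <= (s 6%N k 4)%:~R / (s 6%N k 5)%:~R)].

Definition output (R : realType) (s : store) : set R :=
  [set l | exists k : nat, (k%:Z < s 5%N 0 0) /\ out_interval s k%:Z l].

Arguments output : clear implicits.

(* Main.v *)
(* A scalar l lies in the spectrum iff some x in R_max^n with x <> -oo satisfies
   C x <= D x, where the rows of C and D express A x <= l + B x and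
   l + B x <= A x. Fixing the support of x and, for each row, the column that
   attains the maximum on the right leaves a system of difference constraints,
   which is solvable iff no cycle of length at most kappa has a negative weight
   w + k * l. Hence membership in the spectrum can only change at a fraction -w/k
   with |k| <= kappa and |w| <= 2 * M * kappa, and it suffices to test the Farey
   fractions of order kappa in a bounded interval together with the mediants of
   consecutive ones. After multiplication by the denominator, each test is an
   integral mean-payoff game.

   That the sign of the value r(C^# D) decides the test is proved without
   minimax: the largest mu with mu + x <= C^# D x solvable is attained, with
   mu in (1/n!) Z, by the same cycle argument. Iterating C^# D - mu from a solution
   in the lattice (1/n!) Z gives a nondecreasing sequence. Its bounded coordinates
   are eventually constant, and the unbounded ones, if any, would yield a
   subeigenvector for some larger mu; so the limit is an eigenvector.

   Without an oracle, the test is a value iteration: an integral solution can be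
   truncated to spread at most 2 * W * n, W bounding the entries, because a larger
   gap between consecutive values cannot be bridged by one move. *)
Require Import Defs.
From mathcomp Require Import all_boot all_order all_algebra.
From mathcomp Require Import classical_sets constructive_ereal reals.
From mathcomp Require Import boolp zify ring lra.

Set Implicit Arguments.
Unset Strict Implicit.
Unset Printing Implicit Defensive.

Import Order.TTheory GRing.Theory Num.Theory.
Local Open Scope ring_scope.

(** * Solvability of C x <= D x and the spectrum *)

Section Potential.
Variables (V E : finType) (P : pred E) (src tgt : E -> V).

(** The order kappa = min(2m, n) arises because the difference constraints form a graph on the n
    columns and another on the 2m rows; the cycle argument is run on the smaller one. Membership is
    constant on an open cell between Farey neighbours and passes from it to its end points, but not
    back. So points and cells need separate tests, and each positive answer contributes a closed
    interval. Neighbours of order kappa are at least 1 / kappa^2 apart, so an interval of length X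
    contains at most X kappa^2 + 1 points, each with at most two tests. In general X is at most 4 M
    kappa, with one further test for each of the two outer rays; in part 2 it is the sum of the two
    residual maxima. A mediant has denominator q <= 2 kappa, and its query has entries at most q M +
    |p|, with |p| <= 2 M kappa q in general and |p| <= 2 M q in part 2. The machine has neither
    multiplication nor division: products and the next Farey fraction are formed by repeated
    addition, and an integer carried along with each fraction tells its side of the upper end. [M]
    is not an input, so the program computes its own bound [M1]. *)

Fixpoint walk (v : V) (s : seq E) : bool :=
  if s is e :: s' then [&& P e, src e == v & walk (tgt e) s'] else true.

Definition wend (v : V) (s : seq E) : V := last v (map tgt s).

Lemma wend_cat v s1 s2 : wend v (s1 ++ s2) = wend (wend v s1) s2.
Proof. by rewrite /wend map_cat last_cat. Qed.

Lemma walk_cat v s1 s2 : walk v (s1 ++ s2) = walk v s1 && walk (wend v s1) s2.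
Proof. by elim: s1 v => //= e s1 IH v; rewrite IH !andbA. Qed.

Lemma wend_take v s i : (i <= size s)%N ->
  wend v (take i s) = nth v (v :: map tgt s) i.
Proof.
rewrite /wend; elim: s v i => [|e s IH] v [|i] //= le_i.
rewrite IH //; case: i le_i => //= i le_i; apply: set_nth_default.
by rewrite size_map.
Qed.

Section Weights.
Variables (R : realFieldType) (w : E -> R).

Definition weight (s : seq E) : R := \sum_(e <- s) w e.

Lemma weight_cat s1 s2 : weight (s1 ++ s2) = weight s1 + weight s2.
Proof. by rewrite /weight big_cat. Qed.

Lemma walk_telescope (x : V -> R) v s :
  (forall e, P e -> x (src e) <= x (tgt e) + w e) ->
  walk v s -> x v <= x (wend v s) + weight s.
Proof.
move=> hx; elim: s v => [|e s IH] v /=; first by rewrite /weight big_nil addr0.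
case/and3P=> Pe /eqP <- /IH; rewrite /wend /weight /= big_cons.
by have := hx e Pe; lra.
Qed.

Hypothesis cyc : forall v s, walk v s -> wend v s = v -> (size s <= #|V|)%N ->
  0 <= weight s.

(** In a walk of length at least [#|V|] two of the first [#|V| + 1] vertices coincide. Cutting out
    the closed part between them, which has length at most [#|V|] and hence nonnegative weight, does
    not increase the weight. *)
Lemma walk_shorten v s : walk v s ->
  exists s', [/\ walk v s', (size s' < #|V|)%N & weight s' <= weight s].
Proof.
have V_gt0 : (0 < #|V|)%N by apply/card_gt0P; exists v.
elim: {s}(size s) {-2}s (leqnn (size s)) => [|N IH] s le_s ws.
  by exists s; split=> //; lia.
case: (ltnP (size s) #|V|) => [lt_s|ge_s]; first by exists s.
pose s0 := take #|V| s.
have : ~~ uniq (v :: map tgt s0).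
  apply/negP => /card_uniqP; rewrite /= size_map size_takel // => h.
  by have := max_card (mem (v :: map tgt s0)); rewrite h ltnn.
case/(uniqPn v) => i [j [lt_ij]]; rewrite /= size_map size_takel // ltnS => le_j.
rewrite -!wend_take ?size_takel //; last lia.
rewrite /s0 !take_takel ?(ltnW (leq_trans lt_ij le_j)) //.
move=> eq_ij.
have es : s = take i s ++ take (j - i) (drop i s) ++ drop j s.
  rewrite -{1}(cat_take_drop i s); congr (_ ++ _).
  by rewrite -{1}(cat_take_drop (j - i) (drop i s)) drop_drop subnK // ltnW.
have ej : take j s = take i s ++ take (j - i) (drop i s).
  by rewrite -takeD; congr (take _ s); lia.
set s1 := take i s in es ej eq_ij; set s2 := take _ _ in es ej; set s3 := drop j s in es.
have sz1 : size s1 = i by rewrite size_takel //; lia.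
have sz2 : size s2 = (j - i)%N by rewrite size_takel // size_drop; lia.
have szs : size s = (i + ((j - i) + size s3))%N by rewrite {1}es !size_cat sz1 sz2.
move: (ws); rewrite {1}es !walk_cat => /and3P[w1 w2 w3].
have e2 : wend (wend v s1) s2 = wend v s1 by rewrite -wend_cat -ej -eq_ij.
have c2 : 0 <= weight s2 by apply: (cyc w2 e2); rewrite sz2; lia.
case: (IH (s1 ++ s3)).
- by rewrite size_cat sz1; lia.
- by rewrite walk_cat w1 -e2.
move=> s' [ws' szs' le_w]; exists s'; split=> //; apply: le_trans le_w _.
by rewrite [in leRHS]es !weight_cat; lra.
Qed.

(** [x v] is the least weight of a walk from [v]. By [walk_shorten] the minimum may be taken over
    walks shorter than [#|V|], which form a finite type; prefixing an edge to a minimal walk gives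
    the constraint. *)
Lemma potential : exists x : V -> R, forall e, P e -> x (src e) <= x (tgt e) + w e.
Proof.
have H v : exists r : R, (exists2 s, walk v s & r = weight s) /\
    forall s, walk v s -> r <= weight s.
  have V_gt0 : (0 < #|V|)%N by apply/card_gt0P; exists v.
  pose T : finType := {k : 'I_#|V| & k.-tuple E}.
  pose t0 : T := existT (fun k : 'I_#|V| => k.-tuple E) (Ordinal V_gt0) [tuple].
  pose F (t : T) := weight (tval (tagged t)).
  case: (@arg_minP _ _ _ t0 (fun t : T => walk v (tval (tagged t))) F) => // t wt mt.
  exists (F t); split; first by exists (tval (tagged t)).
  move=> s /walk_shorten[s' [ws' sz le_w]]; apply: le_trans le_w.
  exact: (mt (existT (fun k : 'I_#|V| => k.-tuple E) (Ordinal sz) (in_tuple s'))).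
case: (fin_all_exists H) => x hx; exists x => e Pe.
case: (hx (tgt e)) => [[s ws ->] _]; case: (hx (src e)) => _ /(_ (e :: s)).
by rewrite /= Pe eqxx ws /weight big_cons => /(_ isT); rewrite addrC.
Qed.
End Weights.
End Potential.

(* The fractions [p / k] with bounded numerator and denominator are the only
   points where the sign of an affine cycle weight can change. *)
Definition no_fraction (R : realFieldType) (v W : nat) (l0 l1 : R) : Prop :=
  forall (p : int) (k : nat), (0 < k <= v)%N -> (`|p| <= W * v)%N ->
    ~~ (l0 <= p%:~R / k%:R < l1) /\ ~~ (l1 < p%:~R / k%:R <= l0).

(** If the inequality failed at [l1], the root [- a / b] would lie between the two points. It may
    equal [l1], where a weak inequality survives, but not [l0]: this is why [no_fraction] is half
    open, and why the spectrum comes out as closed intervals. *)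
Lemma no_fraction_sign (R : realFieldType) (v W : nat) (l0 l1 : R) (a b : int) :
  no_fraction v W l0 l1 -> (`|a| <= W * v)%N -> (`|b| <= v)%N ->
  0 <= a%:~R + b%:~R * l0 -> 0 <= a%:~R + b%:~R * l1.
Proof.
move=> nf ha hb h0; rewrite leNgt; apply/negP => h1.
have [b_lt0|b_gt0|b0] := ltgtP b 0; last by move: h0 h1; rewrite b0; lra.
- have kb : (b%:~R : R) = - `|b|%:R.
    by rewrite natr_absz ltr0_norm // mulrNz opprK.
  have k0 : (0 : R) < `|b|%:R by rewrite ltr0n absz_gt0 ltr0_neq0.
  case: (nf a `|b|%N); rewrite ?absz_gt0 ?ltr0_neq0 // => /negP[].
  by rewrite ler_pdivlMr // ltr_pdivrMr //; move: h0 h1; rewrite kb; lra.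
- have kb : (b%:~R : R) = `|b|%:R by rewrite natr_absz gtr0_norm.
  have k0 : (0 : R) < `|b|%:R by rewrite ltr0n absz_gt0 gt_eqF.
  case: (nf (- a) `|b|%N); rewrite ?abszN ?absz_gt0 ?gt_eqF // => _ /negP[].
  rewrite ltr_pdivlMr // ler_pdivrMr // mulrNz.
  by move: h0 h1; rewrite kb; lra.
Qed.

Lemma absz_sum_le (E : Type) (s : seq E) (f : E -> int) (W : nat) :
  (forall e, (`|f e| <= W)%N) -> (`|(\sum_(e <- s) f e)%R| <= W * size s)%N.
Proof.
move=> hf; elim: s => [|e s IH]; first by rewrite big_nil.
rewrite big_cons /= mulnS; move: (bigop _ _ _) IH (hf e) => z.
move: (W * size s)%N (f e) => p y; lia.
Qed.

(** * Systems C x <= D x with affine entries *)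

Section Feasibility.
Variables (R : realFieldType) (I J : finType).
Implicit Types (C D : I -> J -> option (int * int)).

Definition affine (c : int * int) (l : R) : R := c.1%:~R + c.2%:~R * l.

(* [S] is the support of a vector [x] of R_max^J such that C x <= D x, where
   the entries of C and D are -oo or affine functions of the parameter [l]. *)
Definition is_subsol C D (l : R) (S : {set J}) (x : J -> R) : Prop :=
  forall i j c, j \in S -> C i j = Some c ->
    exists k d, [/\ k \in S, D i k = Some d &
                    affine c l + x j <= affine d l + x k].

Definition feasible C D (l : R) : Prop :=
  exists (S : {set J}) (x : J -> R), (exists j, j \in S) /\ is_subsol C D l S x.

(** The column maximising the right-hand side of row [i] over [S] serves all [j] at once. *)
Lemma subsol_strategy C D l (S : {set J}) x : (exists j, j \in S) -> is_subsol C D l S x ->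
  exists (sg : I -> J) (d : I -> int * int),
    forall i j c, j \in S -> C i j = Some c ->
      [/\ sg i \in S, D i (sg i) = Some (d i) &
          affine c l + x j <= affine (d i) l + x (sg i)].
Proof.
move=> [j0 _] hS.
suff H i : exists kd : J * (int * int), forall j c, j \in S -> C i j = Some c ->
      [/\ kd.1 \in S, D i kd.1 = Some kd.2 &
          affine c l + x j <= affine kd.2 l + x kd.1].
  case: (fin_all_exists H) => f hf.
  by exists (fun i => (f i).1), (fun i => (f i).2).
pose P k := (k \in S) && (D i k != None).
pose F k := if D i k is Some d then affine d l + x k else 0.
case: (boolP [exists k, P k]) => [/existsP[k0 Pk0]|/existsPn nP]; last first.
  (* Row [i] has no entry on the right within [S], hence by [hS] none on the left either, and the
     choice is arbitrary. *)
  exists (j0, (0, 0)) => j c jS /(hS _ _ _ jS)[k [d [kS Dk _]]].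
  by have := nP k; rewrite /P kS Dk.
case: (arg_maxP F Pk0) => k; rewrite /P; case Dk: (D i k) => [d|]; rewrite ?andbF //.
rewrite andbT => kS kmax; exists (k, d) => j c jS Cj; split=> //=.
case: (hS _ _ _ jS Cj) => k' [d' [k'S Dk' le]]; apply: le_trans le _.
by have := kmax k'; rewrite /P /F k'S Dk' Dk => /(_ isT).
Qed.

Section Strategy.
Variables (C D : I -> J -> option (int * int)) (S : {set J}).
Variables (sg : I -> J) (d : I -> int * int).
Variables (W : nat) (l0 l1 : R).

Hypothesis sgP : forall i j c, j \in S -> C i j = Some c ->
  sg i \in S /\ D i (sg i) = Some (d i).
Hypothesis bnd : forall i i' j k c e, C i j = Some c -> D i' k = Some e ->
  (`|(e.1 - c.1)%R| <= W)%N /\ (`|(e.2 - c.2)%R| <= 1)%N.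

Definition entry (o : option (int * int)) := odflt (0, 0) o.

(** The solution at [l0] makes the weight of every short cycle nonnegative there, by telescoping.
    Such a weight is affine in the parameter with coefficients bounded by [W * #|V|] and [#|V|], so
    it stays nonnegative at [l1], where a potential then exists. *)
Lemma potential_move (V E : finType) (P : pred E) (src tgt : E -> V)
    (al be : E -> int) (x0 : V -> R) :
  (forall e, (`|al e| <= W)%N /\ (`|be e| <= 1)%N) ->
  no_fraction #|V| W l0 l1 ->
  (forall e, P e -> x0 (src e) <= x0 (tgt e) + affine (al e, be e) l0) ->
  exists x1 : V -> R,
    forall e, P e -> x1 (src e) <= x1 (tgt e) + affine (al e, be e) l1.
Proof.
move=> hab nf h0; apply: potential => v s ws cs sz.
have sumE l : weight (fun e => affine (al e, be e) l) s =
    (\sum_(e <- s) al e)%:~R + (\sum_(e <- s) be e)%:~R * l.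
  by rewrite /weight !rmorph_sum /= mulr_suml -big_split.
have hA := @absz_sum_le _ s al W (fun e => (hab e).1).
have hB := @absz_sum_le _ s be 1 (fun e => (hab e).2).
rewrite sumE; apply: (no_fraction_sign nf).
- by apply: leq_trans hA _; rewrite leq_mul2l sz orbT.
- by apply: leq_trans hB _; rewrite mul1n.
rewrite -sumE; have := walk_telescope h0 ws; rewrite cs; lra.
Qed.

(** Off the edges in use the weight is set to 0, because [potential_move] asks for bounded weights
    on the whole type. *)
Definition clip (P : bool) (c : int * int) : int * int := if P then c else (0, 0).

(** Graph on the columns: an entry of [C] at [i], [j] is an edge from [j] to [sg i]. *)
Lemma strategy_move_cols (x0 : J -> R) : no_fraction #|J| W l0 l1 ->
  (forall i j c, j \in S -> C i j = Some c ->
     affine c l0 + x0 j <= affine (d i) l0 + x0 (sg i)) ->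
  exists x1 : J -> R, forall i j c, j \in S -> C i j = Some c ->
     affine c l1 + x1 j <= affine (d i) l1 + x1 (sg i).
Proof.
move=> nf h0.
pose P (e : I * J) := (e.2 \in S) && (C e.1 e.2 != None).
pose w (e : I * J) := clip (P e)
  ((d e.1).1 - (entry (C e.1 e.2)).1, (d e.1).2 - (entry (C e.1 e.2)).2).
have [|e Pe|x1 h1] := @potential_move J _ P snd (fun e => sg e.1)
    (fun e => (w e).1) (fun e => (w e).2) x0 _ nf.
- move=> e; rewrite /w /clip; case: ifP => //= /andP[eS].
  case Ce: (C e.1 e.2) => [c|] //= _.
  by have [_ De] := sgP eS Ce; exact: bnd Ce De.
- rewrite /w Pe /=; case/andP: Pe => eS; case Ce: (C e.1 e.2) => [c|] //= _.
  by have := h0 _ _ _ eS Ce; rewrite /affine /= !rmorphB /=; lra.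
exists x1 => i j c jS Cj; have := h1 (i, j); rewrite /w /P /= jS Cj /= => /(_ isT).
by rewrite /affine /= !rmorphB /=; lra.
Qed.

Hypothesis C_col : forall j, exists i, C i j != None.

(* The same on the graph of rows: [y] plays the role of D x. *)
Lemma strategy_move_rows (x0 : J -> R) : no_fraction #|I| W l0 l1 ->
  (forall i j c, j \in S -> C i j = Some c ->
     affine c l0 + x0 j <= affine (d i) l0 + x0 (sg i)) ->
  exists x1 : J -> R, forall i j c, j \in S -> C i j = Some c ->
     affine c l1 + x1 j <= affine (d i) l1 + x1 (sg i).
Proof.
move=> nf h0.
pose active i := [exists j, (j \in S) && (C i j != None)].
pose P (e : I * I) := active e.1 && (C e.2 (sg e.1) != None).
pose w (e : I * I) := clip (P e)
  ((d e.1).1 - (entry (C e.2 (sg e.1))).1, (d e.1).2 - (entry (C e.2 (sg e.1))).2).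
have actP i : active i -> sg i \in S /\ D i (sg i) = Some (d i).
  by case/existsP => j /andP[jS]; case Cj: (C i j) => // _; exact: sgP jS Cj.
have [|e Pe|y h1] := @potential_move I _ P fst snd
    (fun e => (w e).1) (fun e => (w e).2) (fun i => affine (d i) l0 + x0 (sg i)) _ nf.
- move=> e; rewrite /w /clip; case: ifP => //= /andP[/actP[_ De]].
  by case Ce: (C _ _) => [c|] //= _; exact: bnd Ce De.
- rewrite /w Pe /=; case/andP: Pe => /actP[eS _]; case Ce: (C _ _) => [c|] //= _.
  by have := h0 _ _ _ eS Ce; rewrite /affine /= !rmorphB /=; lra.
(* A vector [x1] is recovered from [y] by residuation, [x1 j = min_i (y i - C i j)]; the minimum is
   finite because column [j] of [C] has an entry. *)
have H j : exists r : R,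
    (forall i c, C i j = Some c -> affine c l1 + r <= y i) /\
    exists i c, C i j = Some c /\ r = y i - affine c l1.
  case: (C_col j) => i0 Ci0.
  case: (@arg_minP _ _ _ i0 (fun i => C i j != None)
    (fun i => y i - affine (entry (C i j)) l1)) => // i; case Ci: (C i j) => [c|] // _ hm.
  exists (y i - affine c l1); split; last by exists i, c.
  by move=> i' c' Ci'; have := hm i'; rewrite Ci' /= => /(_ isT); lra.
case: (fin_all_exists H) => x1 hx1; exists x1 => i j c jS Cj.
case: (hx1 j) => /(_ _ _ Cj) le1 _; apply: le_trans le1 _.
have act : active i by apply/existsP; exists j; rewrite jS Cj.
case: (hx1 (sg i)) => _ [i2 [c2 [Ci2 ->]]].
have := h1 (i, i2); rewrite /w /P /= act Ci2 /= => /(_ isT).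
by rewrite /affine /= !rmorphB /=; lra.
Qed.
End Strategy.

(** The support and the maximising columns are frozen, and only the values of [x] move. Either graph
    may be used, so the smaller number of vertices counts. *)
Lemma feasible_move C D (W : nat) (l0 l1 : R) :
  (forall j, exists i, C i j != None) ->
  (forall i i' j k c e, C i j = Some c -> D i' k = Some e ->
     (`|(e.1 - c.1)%R| <= W)%N /\ (`|(e.2 - c.2)%R| <= 1)%N) ->
  no_fraction (minn #|I| #|J|) W l0 l1 ->
  feasible C D l0 -> feasible C D l1.
Proof.
move=> Ccol bnd nf [S [x0 [S0 hS]]].
have [sg [d hsg]] := subsol_strategy S0 hS.
have sgP i j c : j \in S -> C i j = Some c -> sg i \in S /\ D i (sg i) = Some (d i).
  by move=> jS Cj; case: (hsg _ _ _ jS Cj).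
have h0 i j c : j \in S -> C i j = Some c ->
    affine c l0 + x0 j <= affine (d i) l0 + x0 (sg i).
  by move=> jS Cj; case: (hsg _ _ _ jS Cj).
have [x1 hx1] : exists x1 : J -> R, forall i j c, j \in S -> C i j = Some c ->
     affine c l1 + x1 j <= affine (d i) l1 + x1 (sg i).
  move: nf; rewrite /minn; case: ifP => _ nf.
    exact (strategy_move_rows sgP bnd Ccol nf h0).
  exact (strategy_move_cols sgP bnd nf h0).
exists S, x1; split=> // i j c jS Cj; case: (sgP _ _ _ jS Cj) => kS Dk.
by exists (sg i), (d i); split=> //; exact: hx1.
Qed.
End Feasibility.

(** * Max-plus products and residuals, compared with real thresholds *)

Section MaxPlusOrder.
Variables (R : realType) (m n : nat).
Implicit Types (A B : intmx m n) (x : 'I_n -> \bar R).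

Lemma RmxE A i j :
  Rmx R A i j = if A i j is Some z then (z%:~R)%:E else -oo%E.
Proof. by rewrite /Rmx mxE. Qed.

Lemma le_mpmul B x i (v : R) :
  (v%:E <= mpmul (Rmx R B) x i)%E <->
  exists k d, B i k = Some d /\ (v%:E <= d%:~R%:E + x k)%E.
Proof.
split.
  case/bigmax_geP => [|[k _]]; first by rewrite leeNy_eq.
  by rewrite RmxE; case Bk: (B i k) => [d|] h; [exists k, d | rewrite addNye in h].
case=> k [d [Bk h]]; apply/bigmax_geP; right; exists k => //.
by rewrite RmxE Bk.
Qed.

Lemma mpmul_neqy B x i : Rmax_vec x -> mpmul (Rmx R B) x i <> +oo%E.
Proof.
move=> hx; apply/eqP; rewrite -ltey; apply/bigmax_ltP; split=> // k _.
rewrite RmxE; case: (B i k) => [d|]; last by rewrite addNye.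
by rewrite ltey; case: (x k) (hx k).
Qed.

Lemma mpmul_attained B x i : mpmul (Rmx R B) x i = -oo%E \/
  exists k d, B i k = Some d /\ mpmul (Rmx R B) x i = (d%:~R%:E + x k)%E.
Proof.
rewrite /mpmul; elim/big_ind: _ => [|u v hu hv|k _]; first by left.
  by rewrite /maxe; case: ifP.
by rewrite RmxE; case Bk: (B i k) => [d|]; [right; exists k, d | left; rewrite addNye].
Qed.

(** Residuation, row by row. Comparing with a real [v] keeps the two conventions for adding
    infinities out of the order arguments. *)
Lemma le_mpres A B x j (v : R) : Rmax_vec x ->
  (v%:E <= mpres (Rmx R A) (mpmul (Rmx R B) x) j)%E <->
  forall i c, A i j = Some c ->
    exists k d, B i k = Some d /\ ((v + c%:~R)%:E <= d%:~R%:E + x k)%E.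
Proof.
move=> hx; have ny i := @mpmul_neqy B x i hx.
have E i c : A i j = Some c ->
    (v%:E <= ((- Rmx R A i j)%E + mpmul (Rmx R B) x i)%dE)%E =
    ((v + c%:~R)%:E <= mpmul (Rmx R B) x i)%E.
  move=> Ac; rewrite RmxE Ac; case: (mpmul _ _ i) (ny i) => [r| |] //= _.
  by rewrite ?leeNy_eq ?lee_fin // addrC lerBrDr.
split.
  by move=> /bigmin_geP[_ h] i c Ac; apply/le_mpmul; rewrite -(E _ _ Ac); apply: h.
move=> h; apply/bigmin_geP; split=> [|i _]; first by rewrite leey.
case Ac: (A i j) => [c|]; last by rewrite RmxE Ac; case: (mpmul _ _ _) => *; rewrite leey.
by rewrite (E _ _ Ac); apply/le_mpmul; exact: h.
Qed.

Lemma mpres_attained A B x j : Rmax_vec x -> (exists i, A i j != None) ->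
  mpres (Rmx R A) (mpmul (Rmx R B) x) j = -oo%E \/
  exists i k c d, [/\ A i j = Some c, B i k = Some d &
    mpres (Rmx R A) (mpmul (Rmx R B) x) j = (d%:~R%:E - c%:~R%:E + x k)%E].
Proof.
move=> hx [i0 Ai0]; set u := mpres _ _ _.
(* Some entry of column [j] of [A] is finite, so the minimum is not [+oo]. *)
have [|u_ny] : u = +oo%E \/ u != +oo%E by case: eqP; [left|right].
  move=> uy; case: (mpmul_neqy (i:=i0) (B := B) hx).
  have : (+oo <= u)%E by rewrite uy.
  case/bigmin_geP => _ /(_ i0 isT); rewrite RmxE.
  by case: (A i0 j) Ai0 => // c _; case: (mpmul _ _ _).
have : u = +oo%E \/ exists i, u = ((- Rmx R A i j)%E + mpmul (Rmx R B) x i)%dE.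
  rewrite {u_ny}/u /mpres; elim/big_ind: _ => [|v w hv hw|i _]; first by left.
    by rewrite /mine; case: ifP.
  by right; exists i.
case=> [uy|[i ui]]; first by rewrite uy in u_ny.
rewrite ui RmxE in u_ny *; case Ac: (A i j) u_ny => [c|]; last by case: (mpmul _ _ _).
move=> _; case: (mpmul_attained B x i) => [->|[k [d [Bk ->]]]]; first by left.
right; exists i, k, c, d; split=> //.
by case: (x k) => [r| |] //=; congr (_%:E); lra.
Qed.

Lemma mpres_Rmax A B x : Rmax_vec x -> (forall j, exists i, A i j != None) ->
  Rmax_vec (mpres (Rmx R A) (mpmul (Rmx R B) x)).
Proof.
move=> hx Acol j; case: (mpres_attained B hx (Acol j)) => [->//|].
by case=> i [k [c [d [_ _ ->]]]]; case: (x k) (hx k).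
Qed.

Definition supp x : {set 'I_n} := [set j | x j != -oo%E]%SET.

Lemma Rmax_fineK x j : Rmax_vec x -> j \in supp x -> (fine (x j))%:E = x j.
Proof. by move=> hx; rewrite inE; case: (x j) (hx j). Qed.

Definition with_slope (b : int) A : 'I_m -> 'I_n -> option (int * int) :=
  fun i j => omap (fun z => (z, b)) (A i j).

(** By residuation [mu + x <= A^# (B x)] means [mu + A x <= B x], where [mu] enters with slope 1 on
    the left. *)
Definition subeigenvalue A B (mu : R) : Prop :=
  feasible (with_slope 1 A) (with_slope 0 B) mu.

Lemma subeigenvalueP A B mu (x : 'I_n -> R) (S : {set 'I_n}) :
  is_subsol (with_slope 1 A) (with_slope 0 B) mu S x <->
  forall i j c, j \in S -> A i j = Some c -> exists k d,
    [/\ k \in S, B i k = Some d & c%:~R + mu + x j <= d%:~R + x k].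
Proof.
split=> h i j c jS.
  move=> Ac; have [|k [d [kS]]] := h i j (c, 1) jS; first by rewrite /with_slope Ac.
  rewrite /with_slope; case Bk: (B i k) => [d'|] //= [<-]; rewrite /affine /= => le.
  by exists k, d'; split=> //; lra.
rewrite /with_slope; case Ac: (A i j) => [c'|] //= [<-].
have [k [d [kS Bk le]]] := h i j c' jS Ac; exists k, (d, 0).
by rewrite Bk /affine /=; split=> //; lra.
Qed.

Lemma eigenvalue_feasible A B (l : R) :
  eigenvalues (fun x => mpres (Rmx R A) (mpmul (Rmx R B) x)) l%:E ->
  subeigenvalue A B l.
Proof.
case=> _ [x [hx [j0 /eqP xj0] ex]]; exists (supp x), (fine \o x).
split; first by exists j0; rewrite inE.
apply/subeigenvalueP => i j c jS Ac.
have : ((l + fine (x j))%:E <= mpres (Rmx R A) (mpmul (Rmx R B) x) j)%E.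
  by rewrite -ex EFinD (Rmax_fineK hx jS).
case/(le_mpres _ _ _ _ hx)/(_ i c Ac) => k [d [Bk le]].
have kS : k \in supp x by rewrite inE; apply: contraTneq le => ->.
exists k, d; split=> //; move: le; rewrite -(Rmax_fineK hx kS) lee_fin /=; lra.
Qed.
End MaxPlusOrder.

(** * The greatest subeigenvalue and a subeigenvector on a lattice *)

Lemma ex_max_Prop (P : nat -> Prop) (b : nat) : P 0%N ->
  (forall i, P i -> (i <= b)%N) ->
  exists i, P i /\ forall i', P i' -> (i' <= i)%N.
Proof.
move=> P0 hb.
have ex : exists i, `[< P i >] by exists 0%N; apply/asboolP.
have ub i : `[< P i >] -> (i <= b)%N by move/asboolP/hb.
case: (ex_maxnP ex ub) => i /asboolP Pi hi; exists i; split=> // i' Pi'.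
by apply: hi; apply/asboolP.
Qed.

Lemma natr_le_bound (R : archiRealDomainType) (x : R) :
  exists b : nat, forall i : nat, i%:R <= x -> (i <= b)%N.
Proof.
exists `|Num.floor x|%N => i; have -> : (i%:R : R) = (i%:Z)%:~R by [].
by rewrite -floor_ge_int; lia.
Qed.

Section Perron.
Variables (R : realType) (m n : nat) (A B : intmx m n).
Hypothesis A_col : forall j, exists i, A i j != None.

Lemma entry_gap_bound : exists W : nat, forall i i' j k c d,
  A i j = Some c -> B i' k = Some d -> (`|(d - c)%R| <= W)%N.
Proof.
pose mag (M : intmx m n) := (\sum_i \sum_j `|odflt 0%R (M i j)|)%N.
have magP (M : intmx m n) i j c : M i j = Some c -> (`|c| <= mag M)%N.
  by move=> Mc; rewrite /mag (bigD1 i) //= (bigD1 j) //= Mc /= -addnA leq_addr.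
exists (mag A + mag B)%N => i i' j k c d /magP hc /magP hd.
by move: (mag A) (mag B) hc hd => a b; lia.
Qed.

(** At a largest coordinate [j] of [x], any row with an entry of [A] in column [j] gives
    [mu <= d - c]. *)
Lemma subeigenvalue_bounded (W : nat) (mu : R) :
  (forall i i' j k c d,
     A i j = Some c -> B i' k = Some d -> (`|(d - c)%R| <= W)%N) ->
  subeigenvalue A B mu -> mu <= W%:R.
Proof.
move=> hW [S [x [[j0 j0S] /subeigenvalueP hS]]].
case: (@arg_maxP _ _ _ j0 (fun j => j \in S) x j0S) => j jS jmax.
case: (A_col j) => i; case Ac: (A i j) => [c|] // _.
have [k [d [kS Bd le]]] := hS _ _ _ jS Ac.
have : (d - c)%:~R <= W%:R :> R.
  have -> : (W%:R : R) = (W%:Z)%:~R by [].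
  by rewrite ler_int; have := hW _ _ _ _ _ _ Ac Bd; lia.
by have := jmax k kS; rewrite rmorphB /=; lra.
Qed.

Lemma with_slope_gap (W : nat) :
  (forall i i' j k c d,
     A i j = Some c -> B i' k = Some d -> (`|(d - c)%R| <= W)%N) ->
  forall i i' j k c e, with_slope 1 A i j = Some c -> with_slope 0 B i' k = Some e ->
     (`|(e.1 - c.1)%R| <= W)%N /\ (`|(e.2 - c.2)%R| <= 1)%N.
Proof.
move=> hW i i' j k c e; rewrite /with_slope.
case Ac: (A i j) => [c'|] //= [<-]; case Bd: (B i' k) => [d'|] //= [<-] /=.
by split=> //; exact: hW Ac Bd.
Qed.

Local Notation N := (n`!%N).

Lemma N_gt0 : (0 : R) < N%:R.
Proof. by rewrite ltr0n fact_gt0. Qed.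

(** Every fraction with denominator at most [n] is a multiple of [1 / n!]. So none lies at or above
    [mu] and below the next multiple [K / n!], and [feasible_move] applies. *)
Lemma subeigenvalue_round (mu : R) : subeigenvalue A B mu ->
  exists K : int, mu <= K%:~R / N%:R /\ subeigenvalue A B (K%:~R / N%:R : R).
Proof.
have N0 := N_gt0; have [W hW] := entry_gap_bound.
exists (Num.ceil (mu * N%:R)); have ge : mu <= (Num.ceil (mu * N%:R))%:~R / N%:R.
  by rewrite ler_pdivlMr // ceil_ge.
split=> //; move: H; apply: (feasible_move (W := W)).
- by move=> j; case: (A_col j) => i Ai; exists i; move: Ai; rewrite /with_slope; case: (A i j).
- exact: with_slope_gap.
rewrite !card_ord => p k /andP[k0 kv] _; split; last first.
  by apply/negP => /andP[h1 h2]; have := lt_le_trans h1 h2; rewrite ltNge ge.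
apply/negP => /andP[h1]; rewrite ltNge => /negP[].
have kN : (k %| N)%N by apply: dvdn_fact; rewrite k0 (leq_trans kv) // geq_minr.
have kE : (p%:~R / k%:R : R) = (p * (N %/ k)%N%:Z)%:~R / N%:R.
  rewrite -{2}(divnK kN) natrM rmorphM /= -pmulrn; field.
  by rewrite !pnatr_eq0 -!lt0n k0 divn_gt0 // dvdn_leq // fact_gt0.
rewrite kE in h1 *; rewrite ler_pM2r ?invr_gt0 // ler_int ceil_le_int.
by rewrite -ler_pdivlMr.
Qed.

Lemma max_subeigenvalue : subeigenvalue A B (0 : R) ->
  exists K : nat, subeigenvalue A B (K%:R / N%:R : R) /\
    forall mu : R, subeigenvalue A B mu -> mu <= K%:R / N%:R.
Proof.
move=> h0; have N0 := N_gt0; have [W hW] := entry_gap_bound.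
case: (natr_le_bound (W%:R * N%:R : R)) => b hb.
case: (@ex_max_Prop (fun K => subeigenvalue A B (K%:R / N%:R : R)) b).
- by rewrite mul0r.
- by move=> i /(subeigenvalue_bounded hW); rewrite ler_pdivrMr // => /hb.
move=> K [hK Kmax]; exists K; split=> // mu /subeigenvalue_round[K' [le_mu hK']].
apply: le_trans le_mu _; rewrite ler_pM2r ?invr_gt0 //.
have [K'0|/ltW K'0] := leP 0 K'; last by apply: (@le_trans _ _ 0); rewrite ?lerz0.
case: K' K'0 hK' => // K' _ hK'; rewrite -pmulrn ler_nat; exact: Kmax.
Qed.

(** Multiplied by [n!], all constants of the system are integers, so rounding the solution down
    preserves every inequality. *)
Lemma lattice_subsol (K : nat) : subeigenvalue A B (K%:R / N%:R : R) ->
  exists (S : {set 'I_n}) (z : 'I_n -> int), (exists j, j \in S) /\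
    is_subsol (with_slope 1 A) (with_slope 0 B) (K%:R / N%:R : R) S
      (fun j => (z j)%:~R / N%:R).
Proof.
have N0 := N_gt0.
move=> [S [x [S0 /subeigenvalueP hS]]]; exists S, (fun j => Num.floor (x j * N%:R)).
split=> //; apply/subeigenvalueP => i j c jS Ac.
have [k [d [kS Bd le]]] := hS _ _ _ jS Ac; exists k, d; split=> //.
have : Num.floor (x j * N%:R) + (c - d) * N%:Z + K%:Z <= Num.floor (x k * N%:R).
  have lej := floor_le (x j * N%:R).
  rewrite floor_ge_int !rmorphD rmorphM rmorphB /= -!pmulrn.
  have KE : (K%:R : R) = K%:R / N%:R * N%:R by rewrite mulfVK ?gt_eqF.
  rewrite KE; move: le; rewrite -(ler_pM2r N0); move: lej.
  by move: (Num.floor _)%:~R (K%:R / N%:R) => f t; lra.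
rewrite -(ler_int R) !rmorphD rmorphM rmorphB /= -!pmulrn.
by move=> h; rewrite -(ler_pM2r N0) !mulrDl !divfK ?gt_eqF //; move: h; lra.
Qed.
End Perron.

(** Once above [-oo] the sequence climbs by multiples of [1 / N]; if it is bounded, it climbs only
    finitely often. *)
Lemma lattice_seq_dichotomy (R : realType) (N : R) (u : nat -> \bar R) : 0 < N ->
  (forall k l, (k <= l)%N -> (u k <= u l)%E) ->
  (forall k, u k = -oo%E \/ exists z : int, u k = (z%:~R / N)%:E) ->
  (exists k0, forall k, (k0 <= k)%N -> u k = u k0) \/
  (forall b : R, exists k0, forall k, (k0 <= k)%N -> (b%:E <= u k)%E).
Proof.
move=> N0 mono lat.
case: (pselect (forall b : R, exists k0, (b%:E <= u k0)%E)) => [h|/existsNP[b /forallNP hb]].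
  right=> b; case: (h b) => k0 hk0; exists k0 => k /mono; exact: le_trans.
left; case: (pselect (exists k, u k <> -oo%E)) => [[k0]|/forallNP h]; last first.
  by exists 0%N => k _; have := h k; have := h 0%N; move=> /contrapT -> /contrapT ->.
case: (lat k0) => // -[z0 uz0] _.
pose P i := exists2 k, (k0 <= k)%N & u k = ((z0 + i%:Z)%:~R / N)%:E.
case: (natr_le_bound (b * N - z0%:~R)) => c hc.
have [||i [[k1 le01 uk1] imax]] := @ex_max_Prop P c.
- by exists k0; rewrite ?addr0.
- move=> i [k _ uk]; apply: hc; move/negP: (hb k); rewrite uk -ltNge lte_fin.
  by rewrite ltr_pdivrMr // rmorphD /= -pmulrn => ?; lra.
exists k1 => k le1; have := mono _ _ le1; rewrite uk1.
case: (lat k) => [->|[z uz]]; first by rewrite leeNy_eq.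
rewrite uz lee_fin ler_pM2r ?invr_gt0 // ler_int => lez.
have : P `|z - z0|%N by exists k; [exact: leq_trans le1|rewrite uz; congr ((_%:~R / _)%:E); lia].
by move/imax => ?; congr ((_%:~R / _)%:E); lia.
Qed.

Lemma lee_reals (R : realType) (u v : \bar R) : u <> +oo%E ->
  (forall r : R, (r%:E <= u)%E -> (r%:E <= v)%E) -> (u <= v)%E.
Proof. by case: u => [r| |] // _ h; [exact: h|rewrite leNye]. Qed.

(** * An eigenvector as the limit of the shifted iteration *)

Section PerronIteration.
Variables (R : realType) (m n : nat) (A B : intmx m n).
Hypothesis A_col : forall j, exists i, A i j != None.
Variables (mu N : R) (K : nat).
Hypothesis N_gt0 : 0 < N.
Hypothesis muE : mu = K%:R / N.
Hypothesis N_int : exists N' : nat, N = N'%:R.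
Hypothesis mu_max : forall mu', subeigenvalue A B mu' -> mu' <= mu.
Variables (S : {set 'I_n}) (z : 'I_n -> int).
Hypothesis S_neq0 : exists j, j \in S.
Hypothesis zP : is_subsol (with_slope 1 A) (with_slope 0 B) mu S
  (fun j => (z j)%:~R / N).

Let f (x : 'I_n -> \bar R) := mpres (Rmx R A) (mpmul (Rmx R B) x).
Let g (x : 'I_n -> \bar R) j := (f x j - mu%:E)%E.

Lemma shift_Rmax x : Rmax_vec x -> Rmax_vec (g x).
Proof.
by move=> hx j; have := mpres_Rmax (B := B) hx A_col (j := j); rewrite /g /f; case: (mpres _ _ j).
Qed.

Lemma le_shift x j (v : R) : Rmax_vec x ->
  (v%:E <= g x j)%E <-> forall i c, A i j = Some c ->
    exists k d, B i k = Some d /\ ((v + mu + c%:~R)%:E <= d%:~R%:E + x k)%E.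
Proof. by move=> hx; rewrite /g leeBrDr // -EFinD; exact: le_mpres. Qed.

Lemma shift_mono x y : Rmax_vec x -> Rmax_vec y ->
  (forall j, (x j <= y j)%E) -> forall j, (g x j <= g y j)%E.
Proof.
move=> hx hy le_xy j; apply: lee_reals => [|v]; first exact: shift_Rmax.
move/(le_shift _ _ hx) => h; apply/(le_shift _ _ hy) => i c /h[k [d [Bd le]]].
by exists k, d; split=> //; apply: le_trans le _; rewrite leeD2l.
Qed.

Let x0 j : \bar R := if j \in S then ((z j)%:~R / N)%:E else -oo%E.
Let X k := iter k g x0.

Lemma iter_Rmax k : Rmax_vec (X k).
Proof.
elim: k => [|k IH]; last exact: shift_Rmax.
by move=> j; rewrite /X /= /x0; case: ifP.
Qed.

Arguments iter_Rmax : clear implicits.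

Lemma iter_mono k l : (k <= l)%N -> forall j, (X k j <= X l j)%E.
Proof.
move: k l; apply: (@homo_leq _ X (fun x y => forall j, (x j <= y j)%E)) =>
  [x j|y x w h1 h2 j|k]; first exact: lexx.
  exact: le_trans (h1 j) (h2 j).
elim: k => [|k IH]; last exact (shift_mono (iter_Rmax k) (iter_Rmax k.+1) IH).
have hx0 := iter_Rmax 0.
move=> j; apply: lee_reals => [|v]; first exact: hx0.
rewrite /X /= => le_v; apply/(le_shift _ _ hx0) => i c Ac.
move: le_v; rewrite /x0; case: ifP => // jS; rewrite lee_fin => le_v.
move/subeigenvalueP: zP => /(_ i j c jS Ac)[k [d [kS Bd le]]].
by exists k, d; split=> //; rewrite /X /= /x0 kS lee_fin; lra.
Qed.

(** A value of [g] other than [-oo] is attained, hence of the form [d - c + x l - mu]; all four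
    terms are multiples of [1 / N], as [N] is an integer. *)
Lemma iter_lattice k j : X k j = -oo%E \/ exists w : int, X k j = (w%:~R / N)%:E.
Proof.
elim: k j => [|k IH] j.
  by rewrite /X /= /x0; case: ifP; [right; exists (z j)|left].
rewrite /X iterS -/(X k) /g /f.
case: (mpres_attained B (iter_Rmax k) (A_col j)) => [->|]; first by left.
case=> i [l [c [d [_ _ ->]]]]; case: (IH l) => [->|[w ->]]; first by left.
case: N_int => N' NE; right; exists ((d - c) * N'%:Z + w - K%:Z).
congr (_%:E); rewrite muE.
rewrite !rmorphB !rmorphD rmorphM rmorphB /= -!pmulrn -NE.
by field; rewrite gt_eqF.
Qed.

Lemma iter_dichotomy j :
  (exists k0, forall k, (k0 <= k)%N -> X k j = X k0 j) \/
  (forall b : R, exists k0, forall k, (k0 <= k)%N -> (b%:E <= X k j)%E).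
Proof.
apply: (@lattice_seq_dichotomy _ N (fun k => X k j)) => // [k l le|k].
  exact: iter_mono.
exact: iter_lattice.
Qed.

Let diverges j := forall b : R,
  exists k0, forall k, (k0 <= k)%N -> (b%:E <= X k j)%E.

Lemma diverges_uniform (b : R) : exists k0, forall j, diverges j ->
  forall k, (k0 <= k)%N -> (b%:E <= X k j)%E.
Proof.
have H j : exists k0, diverges j -> forall k, (k0 <= k)%N -> (b%:E <= X k j)%E.
  case: (pselect (diverges j)) => [h|h]; last by exists 0%N.
  by case: (h b) => k0 hk0; exists k0.
case: (fin_all_exists H) => k0 hk0; exists (\sum_j k0 j)%N => j /hk0 h k le.
by apply: h; apply: leq_trans le; rewrite (bigD1 j) //= leq_addr.
Qed.

Lemma converges_bounded : exists b : R, forall j, ~ diverges j ->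
  forall k, (X k j <= b%:E)%E.
Proof.
have H j : exists b : R, ~ diverges j -> forall k, (X k j <= b%:E)%E.
  case: (iter_dichotomy j) => [[k0 hk0]|h]; last by exists 0.
  exists (fine (X k0 j)) => _ k.
  apply: (@le_trans _ _ (X (maxn k k0) j)); first by apply: iter_mono; rewrite leq_maxl.
  rewrite hk0 ?leq_maxr //; have := iter_Rmax k0 j.
  by case: (X k0 j) => [r| |] // _; rewrite leNye.
case: (fin_all_exists H) => b hb; exists (\sum_j `|b j|) => j /hb h k.
apply: le_trans (h k) _; rewrite lee_fin (bigD1 j) //=.
apply: le_trans (ler_norm _) _; rewrite lerDl; exact: sumr_ge0.
Qed.

(* The divergent coordinates outgrow all others, so they form a game on their
   own; after enough steps all of them have grown by 1, which contradicts the
   maximality of [mu]. *)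
Lemma no_divergence j : ~ diverges j.
Proof.
move=> dj; have [W hW] := entry_gap_bound A B.
have [b hb] := converges_bounded.
(* Above this level a divergent coordinate cannot be supported by a bounded one: as [mu >= 0], that
   would need [d - c > W]. *)
have [k0 hk0] := diverges_uniform (W%:R + b + 1).
pose y k j := fine (X (k0 + k)%N j).
have yE k i : diverges i -> X (k0 + k)%N i = (y k i)%:E.
  move=> di; rewrite /y; have := hk0 i di (k0 + k)%N (leq_addr _ _).
  by have := iter_Rmax (k0 + k)%N i; case: (X _ i).
have step k i c j' : diverges j' -> A i j' = Some c -> exists l d,
    [/\ diverges l, B i l = Some d & y k.+1 j' + mu + c%:~R <= d%:~R + y k l].
  move=> dj' Ac; have : ((y k.+1 j')%:E <= g (X (k0 + k)%N) j')%E.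
    by rewrite -yE // addnS.
  case/(le_shift _ _ (iter_Rmax _))/(_ i c Ac) => l [d [Bd le]].
  suff dl : diverges l by exists l, d; split=> //; rewrite yE in le.
  apply: contrapT => /hb /(_ (k0 + k)%N) Xb.
  have : ((y k.+1 j' + mu + c%:~R)%:E <= d%:~R%:E + b%:E)%E.
    by apply: le_trans le _; rewrite leeD2l.
  rewrite lee_fin; have := hk0 _ dj' (k0 + k.+1)%N (leq_addr _ _).
  rewrite yE // lee_fin; have mu0 : 0 <= mu by rewrite muE divr_ge0 // ltW.
  have : (d - c)%:~R <= W%:R :> R.
    have -> : (W%:R : R) = (W%:Z)%:~R by [].
    by rewrite ler_int; have := hW _ _ _ _ _ _ Ac Bd; lia.
  by rewrite rmorphB /=; lra.
have [k1 hk1] := diverges_uniform (\sum_j `|y 0%N j| + 1).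
have grow i : diverges i -> y 0%N i + 1 <= y k1 i.
  move=> di; have := hk1 i di (k0 + k1)%N (leq_addl _ _); rewrite yE // lee_fin.
  rewrite (bigD1 i) //=; have := ler_norm (y 0%N i).
  have : 0 <= \sum_(j | j != i) `|y 0%N j| by apply: sumr_ge0.
  lra.
have k1_gt0 : (0 < k1)%N by case: k1 {hk1} grow => // /(_ j dj); lra.
(* The maximum of the iterates over [k1] steps, tilted by [1 / k1] per step. As every divergent
   coordinate has grown by 1 after [k1] steps, this is a subeigenvector for [mu + 1 / k1]. *)
pose F i (t : 'I_k1) := y t i - t%:R / k1%:R.
have k1R : (0 : R) < k1%:R by rewrite ltr0n.
have H i : exists t : 'I_k1, forall t', F i t' <= F i t.
  case: (@arg_maxP _ _ _ (Ordinal k1_gt0) xpredT (F i) isT) => t _ ht.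
  by exists t => t'; exact: ht.
case: (fin_all_exists H) => T hT.
suff /mu_max : subeigenvalue A B (mu + k1%:R^-1).
  by rewrite gerDl leNgt invr_gt0 k1R.
exists [set i | `[< diverges i >]]%SET, (fun i => F i (T i)).
split; first by exists j; rewrite inE; apply/asboolP.
apply/subeigenvalueP => i j' c; rewrite inE => /asboolP dj' Ac.
suff [t [t' [le1 le2]]] : exists t (t' : 'I_k1),
    t = t'.+1 /\ F j' (T j') + k1%:R^-1 <= y t j' - t'%:R / k1%:R.
  have [l [d [dl Bd le]]] := step t' i c j' dj' Ac.
  exists l, d; split=> //; first by rewrite inE; apply/asboolP.
  by have : y t' l - t'%:R / k1%:R <= F l (T l) := hT l t'; rewrite le1 in le2; lra.
(* A maximum at time 0 has no predecessor. The growth by 1 allows time 0 to be replaced by time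
   [k1], whose predecessor [k1 - 1] is in range. *)
case: (T j') => [[|t] lt_t].
  have lt1 : (k1.-1 < k1)%N by rewrite prednK.
  exists k1, (Ordinal lt1); rewrite /= prednK //; split=> //.
  have -> : (k1.-1%:R : R) = k1%:R - 1 by rewrite -subn1 natrB.
  rewrite /F /= mul0r mulrBl divff ?gt_eqF // mul1r; have := grow j' dj'; lra.
have lt_t' : (t < k1)%N by exact: ltnW.
exists t.+1, (Ordinal lt_t'); split=> //=; rewrite /F /= -[t.+1]addn1 natrD mulrDl mul1r.
lra.
Qed.

Lemma perron_iteration : eigenvalues f mu%:E.
Proof.
split=> //.
have H j : exists k0, forall k, (k0 <= k)%N -> X k j = X k0 j.
  by case: (iter_dichotomy j) => // /(@no_divergence j).
case: (fin_all_exists H) => k0 hk0; pose k := (\sum_j k0 j)%N.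
have le_k j : (k0 j <= k)%N by rewrite /k (bigD1 j) //= leq_addr.
exists (X k); split; first exact: iter_Rmax.
  case: S_neq0 => j jS; exists j => Xj; have := iter_mono (leq0n k) j.
  by rewrite Xj /X /= /x0 jS leeNy_eq.
move=> j; have : X k.+1 j = X k j by rewrite !hk0 // (leq_trans (le_k j)).
rewrite {1}/X iterS -/(X k) {1}/g => <-.
by rewrite addeC subeK.
Qed.
End PerronIteration.

Lemma perron (R : realType) (m n : nat) (A B : intmx m n) :
  (forall j, exists i, A i j != None) -> subeigenvalue A B (0 : R) ->
  exists l : R, 0 <= l /\
    eigenvalues (fun x => mpres (Rmx R A) (mpmul (Rmx R B) x)) l%:E.
Proof.
move=> Acol /(max_subeigenvalue Acol)[K [hK Kmax]].
have [S [z [S0 zP]]] := lattice_subsol hK.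
exists (K%:R / n`!%:R); split; first by rewrite divr_ge0.
apply: (perron_iteration Acol _ erefl _ Kmax S0 zP); first exact: N_gt0.
by exists n`!.
Qed.

(** If the answer is nonnegative, its eigenvector satisfies the inequalities for 0. Conversely
    [perron] supplies an eigenvalue at least 0, and the answer is the greatest one. The numerator
    carries the sign. *)
Lemma oracle_sign (R : realType) (o : oracle) (q : query) : mpg_oracle R o ->
  playable q ->
  (0 <= numq (answer o q)) <-> subeigenvalue (q_A q) (q_B q) (0 : R).
Proof.
move=> /(_ q) hq pq; have [he hmax] := hq pq; rewrite numq_ge0.
case/and3P: pq => _ /forallP Acol _.
split=> [h|/perron[j|l [l0 hl]]].
- have := eigenvalue_feasible he => -[S [x [S0 /subeigenvalueP hS]]].
  exists S, x; split=> //; apply/subeigenvalueP => i j c jS Ac.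
  have [k [d [kS Bd le]]] := hS _ _ _ jS Ac; exists k, d; split=> //.
  have : (0 : R) <= ratr (answer o q) by rewrite ler0q.
  lra.
- by apply/existsP; exact: Acol.
- by have := hmax _ hl; rewrite lee_fin -(ler0q R); exact: le_trans.
Qed.

(** Both brackets in [k = b (c k - p d) + d (p b - a k)] are integers at least 1; this is the
    classical fact on denominators between Farey neighbours. *)
Lemma farey_mediant_le (a b c d p k : int) : 0 < b -> 0 < d ->
  c * b - a * d = 1 -> a * k < p * b -> p * d < c * k -> b + d <= k.
Proof.
move=> b0 d0 det g1 g2.
have -> : k = b * (c * k - p * d) + d * (p * b - a * k).
  by rewrite -[LHS]mulr1 -det; ring.
apply: lerD; rewrite -[leLHS]mulr1 ler_pM2l //.
  by move: g2; clear; move: (p * d) (c * k) => u v; lia.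
by move: g1; clear; move: (a * k) (p * b) => u v; lia.
Qed.

(** * Where membership in the spectrum is constant *)

Section Spectrum.
Variables (R : realType) (m n : nat) (A B : intmx m n).

Local Notation Sp := (spec (Rmx R A) (Rmx R B)).

(* The two halves of the rows express A x <= l + B x and l + B x <= A x. *)
Definition lhs_row (i : 'I_m + 'I_m) : 'I_n -> option (int * int) :=
  match i with inl i => with_slope 0 A i | inr i => with_slope 1 B i end.
Definition rhs_row (i : 'I_m + 'I_m) : 'I_n -> option (int * int) :=
  match i with inl i => with_slope 1 B i | inr i => with_slope 0 A i end.

Lemma spec_subsolP (l : R) (S : {set 'I_n}) (x : 'I_n -> R) :
  is_subsol lhs_row rhs_row l S x <->
  (forall i j a, j \in S -> A i j = Some a -> exists k b,
     [/\ k \in S, B i k = Some b & a%:~R + x j <= b%:~R + l + x k]) /\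
  (forall i j b, j \in S -> B i j = Some b -> exists k a,
     [/\ k \in S, A i k = Some a & b%:~R + l + x j <= a%:~R + x k]).
Proof.
split=> [h|[hA hB]].
  split=> i j c jS Ac.
    have [|k [d [kS]]] := h (inl i) j (c, 0) jS; first by rewrite /= /with_slope Ac.
    rewrite /= /with_slope; case Bk: (B i k) => [d'|] //= [<-].
    by rewrite /affine /= => le; exists k, d'; split=> //; lra.
  have [|k [d [kS]]] := h (inr i) j (c, 1) jS; first by rewrite /= /with_slope Ac.
  rewrite /= /with_slope; case Bk: (A i k) => [d'|] //= [<-].
  by rewrite /affine /= => le; exists k, d'; split=> //; lra.
move=> [] i j c jS; rewrite /= /with_slope.
  case Ac: (A i j) => [c'|] //= [<-].
  have [k [d [kS Bk le]]] := hA i j c' jS Ac; exists k, (d, 1).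
  by rewrite Bk /affine /=; split=> //; lra.
case Ac: (B i j) => [c'|] //= [<-].
have [k [d [kS Bk le]]] := hB i j c' jS Ac; exists k, (d, 0).
by rewrite Bk /affine /=; split=> //; lra.
Qed.

Lemma spec_feasible (l : R) : Sp l <-> feasible lhs_row rhs_row l.
Proof.
split.
  case=> x [hx [j0 /eqP xj0] ex]; exists (supp x), (fine \o x).
  split; first by exists j0; rewrite inE.
  have fK := Rmax_fineK hx.
  have inS (u v : R) k : (u%:E <= v%:E + x k)%E -> k \in supp x.
    by move=> le; rewrite inE; apply: contraTneq le => ->.
  apply/spec_subsolP; split=> i j c jS Ac.
    have : ((c%:~R + fine (x j) - l)%:E <= mpmul (Rmx R B) x i)%E.
      rewrite EFinB leeBlDr // addeC -ex; apply/le_mpmul; exists j, c.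
      by rewrite -(fK _ jS); split.
    case/le_mpmul => k [d [Bk le]]; have kS := inS _ _ _ le.
    exists k, d; split=> //; move: le; rewrite -(fK _ kS) lee_fin /=; lra.
  have : ((c%:~R + l + fine (x j))%:E <= mpmul (Rmx R A) x i)%E.
    rewrite ex -leeBlDl // -EFinB; apply/le_mpmul; exists j, c.
    by rewrite -(fK _ jS) -EFinD lee_fin; split=> //; lra.
  case/le_mpmul => k [d [Bk le]]; have kS := inS _ _ _ le.
  exists k, d; split=> //; move: le; rewrite -(fK _ kS) lee_fin /=; lra.
case=> S [x [[j0 j0S] /spec_subsolP[hA hB]]].
pose X j : \bar R := if j \in S then (x j)%:E else -oo%E.
have hX : Rmax_vec X by move=> j; rewrite /X; case: ifP.
have inS (u v : R) k : (u%:E <= v%:E + X k)%E -> k \in S /\ u <= v + x k.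
  by rewrite /X; case: ifP.
exists X; split=> // [|i]; first by exists j0; rewrite /X j0S.
apply/eqP; rewrite eq_le; apply/andP; split.
  apply: lee_reals => [|r]; first exact: mpmul_neqy.
  case/le_mpmul => k [d [Ak /inS[kS le]]].
  have [k' [d' [k'S Bk' le']]] := hA _ _ _ kS Ak.
  rewrite -leeBlDl // -EFinB; apply/le_mpmul; exists k', d'; split=> //.
  by rewrite /X k'S lee_fin; lra.
apply: lee_reals => [|r].
  by case: (mpmul _ _ _) (mpmul_neqy (i := i) (B := B) hX).
rewrite -leeBlDl // -EFinB; case/le_mpmul => k [d [Ak /inS[kS le]]].
have [k' [d' [k'S Bk' le']]] := hB _ _ _ kS Ak.
apply/le_mpmul; exists k', d'; split=> //.
by rewrite /X k'S lee_fin; lra.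
Qed.

Hypothesis no_col : no_common_infty_col A B.
Variable M : nat.
Hypotheses (bA : entries_bounded M A) (bB : entries_bounded M B).

Lemma bounded_entry (C : intmx m n) i j c :
  entries_bounded M C -> C i j = Some c -> (`|c| <= M)%N.
Proof. by move=> /forallP/(_ i)/forallP/(_ j) + Cc; rewrite Cc. Qed.

Local Notation kappa := (minn (2 * m) n).

(** The factor [2 * M] bounds the difference of two entries, and [2 * m] counts the rows of the two
    inequalities together. *)
Lemma spec_move (l0 l1 : R) :
  no_fraction kappa (2 * M) l0 l1 -> Sp l0 -> Sp l1.
Proof.
move=> nf /spec_feasible h; apply/spec_feasible; move: h.
apply: (feasible_move (W := 2 * M)%N).
- move=> j; case/existsP: (forallP no_col j) => i /orP[] Ci.
    by exists (inl i); move: Ci; rewrite /= /with_slope; case: (A i j).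
  by exists (inr i); move: Ci; rewrite /= /with_slope; case: (B i j).
- move=> [] i [] i' j k c e; rewrite /= /with_slope.
  + case Ac: (A i j) => [a|] //= [<-]; case Bc: (B i' k) => [b|] //= [<-] /=.
    by have := bounded_entry bA Ac; have := bounded_entry bB Bc; lia.
  + case Ac: (A i j) => [a|] //= [<-]; case Bc: (A i' k) => [b|] //= [<-] /=.
    by have := bounded_entry bA Ac; have := bounded_entry bA Bc; lia.
  + case Ac: (B i j) => [a|] //= [<-]; case Bc: (B i' k) => [b|] //= [<-] /=.
    by have := bounded_entry bB Ac; have := bounded_entry bB Bc; lia.
  + case Ac: (B i j) => [a|] //= [<-]; case Bc: (A i' k) => [b|] //= [<-] /=.
    by have := bounded_entry bB Ac; have := bounded_entry bA Bc; lia.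
- by rewrite card_sum !card_ord addnn -mul2n.
Qed.

(** A fraction inside the open cell has denominator at least [b + d > kappa], so none of the
    critical ones lies there. The source [l0] is interior, whereas [l1] may be an end point. *)
Lemma spec_farey_cell (a b c d : int) (l0 l1 : R) :
  0 < b -> 0 < d -> c * b - a * d = 1 -> (kappa%:Z < b + d) ->
  Sp l0 -> a%:~R < l0 * b%:~R -> l0 * d%:~R < c%:~R ->
  a%:~R <= l1 * b%:~R -> l1 * d%:~R <= c%:~R -> Sp l1.
Proof.
move=> b0 d0 det bd h0 h1 h2 h3 h4; apply: spec_move h0 => p k /andP[k0 kk] _.
have b0R : (0 : R) < b%:~R by rewrite ltr0z.
have d0R : (0 : R) < d%:~R by rewrite ltr0z.
have k0R : (0 : R) < k%:R by rewrite ltr0n.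
suff nf : ~ (a%:~R < p%:~R / k%:R * b%:~R :> R /\ p%:~R / k%:R * d%:~R < c%:~R :> R).
  split; apply/negP => /andP[g1 g2]; apply: nf; split.
  - by apply: lt_le_trans h1 _; rewrite ler_pM2r.
  - by apply: lt_le_trans h4; rewrite ltr_pM2r.
  - by apply: le_lt_trans h3 _; rewrite ltr_pM2r.
  - by apply: le_lt_trans h2; rewrite ler_pM2r.
rewrite ![_ / _ * _]mulrAC ltr_pdivlMr // ltr_pdivrMr //.
have -> : (k%:R : R) = (k%:Z)%:~R by [].
rewrite -!rmorphM !ltr_int /= => -[g1 g2].
by move: kk bd (farey_mediant_le b0 d0 det g1 g2); clear; move: (minn _ _) => K; lia.
Qed.

(** The critical fractions [p / k] are at most [2 * M * kappa] in modulus, because [k >= 1]. *)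
Lemma spec_ray_ge (l0 l1 : R) : (2 * M * kappa)%:R < l0 -> (2 * M * kappa)%:R <= l1 ->
  Sp l0 -> Sp l1.
Proof.
move=> h0 h1; apply: spec_move => p k /andP[k0 _] hp.
have le : p%:~R / k%:R <= (2 * M * kappa)%:R :> R.
  rewrite ler_pdivrMr ?ltr0n // -natrM.
  have -> : ((2 * M * kappa * k)%:R : R) = ((2 * M * kappa * k)%:Z)%:~R by [].
  rewrite ler_int; have : (2 * M * kappa * 1 <= 2 * M * kappa * k)%N by rewrite leq_mul2l k0 orbT.
  by move: (2 * M * kappa)%N hp => w; lia.
by split; apply/negP => /andP[]; lra.
Qed.

Lemma spec_ray_le (l0 l1 : R) : l0 < - (2 * M * kappa)%:R -> l1 <= - (2 * M * kappa)%:R ->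
  Sp l0 -> Sp l1.
Proof.
move=> h0 h1; apply: spec_move => p k /andP[k0 _] hp.
have le : - (2 * M * kappa)%:R <= p%:~R / k%:R :> R.
  rewrite ler_pdivlMr ?ltr0n // mulNr -natrM.
  have -> : ((2 * M * kappa * k)%:R : R) = ((2 * M * kappa * k)%:Z)%:~R by [].
  rewrite -rmorphN ler_int.
  have : (2 * M * kappa * 1 <= 2 * M * kappa * k)%N by rewrite leq_mul2l k0 orbT.
  by move: (2 * M * kappa)%N hp => w; lia.
by split; apply/negP => /andP[]; lra.
Qed.

(** At a largest coordinate [j] of [x], each entry [b] of column [j] of [B] has in its row an entry
    [a] of [A] with [l <= a - b], whence [l <= (B^# A 0)_j]. *)
Lemma spec_le_max_res (l : R) : Sp l -> (l%:E <= max_res (Rmx R A) (Rmx R B))%E.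
Proof.
case/spec_feasible => S [x [[j0 j0S] /spec_subsolP[_ hB]]].
case: (@arg_maxP _ _ _ j0 (fun j => j \in S) x j0S) => j jS jmax.
apply/bigmax_geP; right; exists j => //.
have h0 : @Rmax_vec R n (fun=> 0%E) by [].
apply/(le_mpres _ _ _ _ h0) => i c Bc.
have [k [d [kS Ad le]]] := hB _ _ _ jS Bc; exists k, d; split=> //.
by rewrite adde0 lee_fin; have : x k <= x j := jmax k kS; lra.
Qed.
End Spectrum.

Lemma spec_swap (R : realType) (m n : nat) (A B : intmx m n) (l : R) :
  spec (Rmx R A) (Rmx R B) l -> spec (Rmx R B) (Rmx R A) (- l).
Proof.
case/spec_feasible => S [x [S0 /spec_subsolP[hA hB]]].
apply/spec_feasible; exists S, x; split=> //; apply/spec_subsolP; split=> i j c jS Cc.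
  have [k [d [kS Ad le]]] := hB _ _ _ jS Cc; exists k, d; split=> //; lra.
have [k [d [kS Ad le]]] := hA _ _ _ jS Cc; exists k, d; split=> //; lra.
Qed.

Lemma split_lshift (m n : nat) (i : 'I_m) : split (lshift n i) = inl i.
Proof. exact: (unsplitK (inl i)). Qed.

Lemma split_rshift (m n : nat) (i : 'I_n) : split (rshift m i) = inr i.
Proof. exact: (unsplitK (inr i)). Qed.

(** * The integral game of a rational test point *)

Section QueryAt.
Variables (m n : nat) (A B : intmx m n) (p q : int).

Let scaleA i j := omap (fun a => q * a) (A i j).
Let scaleB i j := omap (fun b => p + q * b) (B i j).

Definition query_at : query :=
  Query (\matrix_(i < m + m, j < n)
           match split i with inl i => scaleA i j | inr i => scaleB i j end)
        (\matrix_(i < m + m, j < n)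
           match split i with inl i => scaleB i j | inr i => scaleA i j end).

Lemma query_atP (R : realType) : 0 < q ->
  subeigenvalue (q_A query_at) (q_B query_at) (0 : R) <->
  spec (Rmx R A) (Rmx R B) (p%:~R / q%:~R).
Proof.
move=> q0; have q0R : (0 : R) < q%:~R by rewrite ltr0z.
have qK : p%:~R / q%:~R * q%:~R = p%:~R :> R by rewrite divfK ?gt_eqF.
apply: iff_trans (iff_sym (spec_feasible _ _ _)).
split=> -[S [x [S0 h]]]; [exists S, (fun j => x j / q%:~R)|exists S, (fun j => x j * q%:~R)];
  split=> //.
  move/subeigenvalueP: h => h; apply/spec_subsolP; split=> i j c jS Cc.
    have := h (lshift m i) j (q * c) jS; rewrite !mxE split_lshift /scaleA Cc /=.
    case=> // k [d [kS]]; rewrite mxE split_lshift /scaleB; case Bd: (B i k) => [b|] //= [<-].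
    move=> le; exists k, b; split=> //; rewrite -(ler_pM2r q0R) !mulrDl !divfK ?gt_eqF //.
    by move: le; rewrite rmorphD !rmorphM /=; lra.
  have := h (rshift m i) j (p + q * c) jS; rewrite !mxE split_rshift /scaleB Cc /=.
  case=> // k [d [kS]]; rewrite mxE split_rshift /scaleA; case Bd: (A i k) => [b|] //= [<-].
  move=> le; exists k, b; split=> //; rewrite -(ler_pM2r q0R) !mulrDl !divfK ?gt_eqF //.
  by move: le; rewrite rmorphD !rmorphM /=; lra.
move/spec_subsolP: h => [hA hB]; apply/subeigenvalueP => i j c jS.
case: (split_ordP i) => {}i ->; rewrite mxE ?split_lshift ?split_rshift.
  rewrite /scaleA; case Ac: (A i j) => [a|] //= [<-].
  have [k [b [kS Bb]]] := hA _ _ _ jS Ac.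
  rewrite -(ler_pM2r q0R) !mulrDl qK => le; exists k, (p + q * b).
  rewrite mxE split_lshift /scaleB Bb; split=> //; rewrite rmorphD !rmorphM /=; lra.
rewrite /scaleB; case Ac: (B i j) => [a|] //= [<-].
have [k [b [kS Bb]]] := hB _ _ _ jS Ac.
rewrite -(ler_pM2r q0R) !mulrDl qK => le; exists k, (q * b).
by rewrite mxE split_rshift /scaleA Bb; split=> //; rewrite rmorphD !rmorphM /=; lra.
Qed.

(** A column without entries in the stacked left matrix would be a common [-oo] column of [A] and
    [B], and the rows of the right matrix come from those of [B] and [A]; so every node has a
    move. *)
Lemma query_at_instance (M bound : nat) : (0 < n)%N ->
  no_infty_row A -> no_infty_row B -> no_common_infty_col A B ->
  entries_bounded M A -> entries_bounded M B ->
  (`|q| * M + `|p| <= bound)%N -> mpg_instance (2 * m) n bound query_at.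
Proof.
move=> n0 rA rB col bA bB hb; have hq a : (`|a| <= M)%N -> (`|(q * a)%R| <= `|q| * M)%N.
  by move=> ?; rewrite abszM leq_mul2l; apply/orP; right.
have bsA i j : (if scaleA i j is Some z then (`|z| <= bound)%N else true) = true.
  rewrite /scaleA; case Ac: (A i j) => [a|] //=.
  by have := hq _ (bounded_entry bA Ac); lia.
have bsB i j : (if scaleB i j is Some z then (`|z| <= bound)%N else true) = true.
  rewrite /scaleB; case Ac: (B i j) => [a|] //=.
  by have := hq _ (bounded_entry bB Ac); lia.
apply/and5P; split; rewrite //= ?addnn ?mul2n //.
- apply/and3P; split=> //.
  + apply/forallP => j; case/existsP: (forallP col j) => i /orP[] Ci; apply/existsP.
      by exists (lshift m i); rewrite mxE split_lshift /scaleA; case: (A i j) Ci.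
    by exists (rshift m i); rewrite mxE split_rshift /scaleB; case: (B i j) Ci.
  + apply/forallP => i; case: (split_ordP i) => {}i ->; apply/existsP.
      case/existsP: (forallP rB i) => j Bj; exists j.
      by rewrite mxE split_lshift /scaleB; case: (B i j) Bj.
    case/existsP: (forallP rA i) => j Bj; exists j.
    by rewrite mxE split_rshift /scaleA; case: (A i j) Bj.
- apply/forallP => i; apply/forallP => j; rewrite mxE.
  by case: (split i) => i'; rewrite ?bsA ?bsB.
- apply/forallP => i; apply/forallP => j; rewrite mxE.
  by case: (split i) => i'; rewrite ?bsA ?bsB.
Qed.
End QueryAt.

(** * Programs *)

(* Arrays used by the programs, beyond those fixed by [init] and [output]: 7-10
   the matrices of the current query (flags and values of C, then of D), 11 the
   answer, 12 kappa, 13 and 33 the end points of the search interval, 14-19 the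
   two current Farey neighbours, 20 and 21 the point under test, 22-25 loop
   counters and an accumulator, 26 a bound on the entries of the input, 30-32 the
   next Farey fraction, 34-38 the value iteration, 39-41 the bounds of part 2.
   Scalars are kept in cell [0][0]. *)
Fixpoint arrays (e : aexp) : seq nat :=
  match e with
  | Cst _ => [::]
  | Get a e1 e2 => a :: arrays e1 ++ arrays e2
  | Add e1 e2 | Defs.Sub e1 e2 => arrays e1 ++ arrays e2
  end.

Definition avoids (l : seq nat) (e : aexp) : bool :=
  all (fun a => a \notin l) (arrays e).

Definition same_but (l : seq nat) (s s' : store) : Prop :=
  forall a, a \notin l -> s' a = s a.

Lemma same_but_trans l s1 s2 s3 :
  same_but l s1 s2 -> same_but l s2 s3 -> same_but l s1 s3.
Proof. by move=> h1 h2 a ha; rewrite h2 // h1. Qed.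

Lemma same_but_sub l l' s s' : {subset l <= l'} -> same_but l s s' -> same_but l' s s'.
Proof. by move=> sub h a ha; apply: h; apply: contra ha; exact: sub. Qed.

Lemma upd_other s a i j v a' : a' != a -> upd s a i j v a' = s a'.
Proof. by move=> /negbTE h; rewrite /upd h. Qed.

Lemma upd_same s a i j v : upd s a i j v a i j = v.
Proof. by rewrite /upd !eqxx. Qed.

Lemma same_but_upd l s s' a i j v : a \in l -> same_but l s s' ->
  same_but l s (upd s' a i j v).
Proof.
move=> al h b bl; rewrite upd_other ?h //; apply: contraNneq bl => -> //.
Qed.

Lemma aeval_same l e s s' : avoids l e -> same_but l s s' -> aeval s' e = aeval s e.
Proof.
move=> + h; elim: e => [z|a e1 IH1 e2 IH2|e1 IH1 e2 IH2|e1 IH1 e2 IH2] //=;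
  rewrite /avoids /= ?all_cat.
- by case/and3P => al a1 a2; rewrite h // IH1 // IH2.
- by case/andP => a1 a2; rewrite IH1 // IH2.
- by case/andP => a1 a2; rewrite IH1 // IH2.
Qed.

Definition V (k : nat) : aexp := Get k (Cst 0) (Cst 0).
Definition Assign (k : nat) (e : aexp) : cmd := Set_ k (Cst 0) (Cst 0) e.
Definition For (v : nat) (e : aexp) (c : cmd) : cmd :=
  Seq (Assign v (Cst 0))
      (While (Add (V v) (Cst 1)) e (Seq c (Assign v (Add (V v) (Cst 1))))).

(** * Program logics with time and queries *)

Section Logic.
Variable o : oracle.

(** A Hoare triple without queries and with a time budget. By contrast [traced] carries the past
    queries and the clock along, so that loop invariants can count them. *)
Definition runs (c : cmd) (s : store) (T : nat) (Q : store -> Prop) : Prop :=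
  exists s' t, [/\ exec o c s s' t [::], (t <= T)%N & Q s'].

Definition traced (c : cmd) (s : store) (h : seq query) (t : nat)
    (Q : store -> seq query -> nat -> Prop) : Prop :=
  exists s' t' qs, exec o c s s' t' qs /\ Q s' (h ++ qs) (t + t')%N.

Lemma runs_conseq c s T T' (Q Q' : store -> Prop) :
  runs c s T Q -> (T <= T')%N -> (forall s', Q s' -> Q' s') -> runs c s T' Q'.
Proof.
move=> [s' [t [E le hQ]]] leT h; exists s', t; split=> //; last exact: h.
exact: leq_trans leT.
Qed.

Lemma runs_skip s T (Q : store -> Prop) : (0 < T)%N -> Q s -> runs Skip s T Q.
Proof. by move=> T0 hQ; exists s, 1%N; split=> //; constructor. Qed.

Lemma runs_set s a e1 e2 e T (Q : store -> Prop) : (0 < T)%N ->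
  Q (upd s a (aeval s e1) (aeval s e2) (aeval s e)) -> runs (Set_ a e1 e2 e) s T Q.
Proof. by move=> T0 hQ; exists (upd s a (aeval s e1) (aeval s e2) (aeval s e)), 1%N; split=> //; constructor. Qed.

Lemma runs_seq c1 c2 s T1 T Q : (T1 <= T)%N ->
  runs c1 s T1 (fun s1 => runs c2 s1 (T - T1) Q) -> runs (Seq c1 c2) s T Q.
Proof.
move=> le [s1 [t1 [E1 le1 [s2 [t2 [E2 le2 hQ]]]]]].
exists s2, (t1 + t2)%N; split=> //; first exact: (ExecSeq E1 E2).
lia.
Qed.

Lemma runs_seq_set s a e1 e2 e c T Q : (0 < T)%N ->
  runs c (upd s a (aeval s e1) (aeval s e2) (aeval s e)) T.-1 Q ->
  runs (Seq (Set_ a e1 e2 e) c) s T Q.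
Proof.
by move=> T0 h; apply: (@runs_seq _ _ _ 1) => //; apply: runs_set; rewrite // subn1.
Qed.

Lemma runs_seq_upd s a e1 e2 e i j v c T Q : (0 < T)%N ->
  aeval s e1 = i -> aeval s e2 = j -> aeval s e = v ->
  runs c (upd s a i j v) T.-1 Q -> runs (Seq (Set_ a e1 e2 e) c) s T Q.
Proof. by move=> T0 <- <- <-; exact: runs_seq_set. Qed.

Lemma runs_upd s a e1 e2 e i j v T (Q : store -> Prop) : (0 < T)%N ->
  aeval s e1 = i -> aeval s e2 = j -> aeval s e = v ->
  Q (upd s a i j v) -> runs (Set_ a e1 e2 e) s T Q.
Proof. by move=> T0 <- <- <-; exact: runs_set. Qed.

Lemma runs_if s e1 e2 c1 c2 T Q : (0 < T)%N ->
  (aeval s e1 <= aeval s e2 -> runs c1 s T.-1 Q) ->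
  (aeval s e2 < aeval s e1 -> runs c2 s T.-1 Q) -> runs (If e1 e2 c1 c2) s T Q.
Proof.
move=> T0 h1 h2.
have [s' [t [E le hQ]]] :
    runs (if aeval s e1 <= aeval s e2 then c1 else c2) s T.-1 Q.
  by case: leP => h; [exact: h1|exact: h2].
by exists s', t.+1; split=> //; [constructor|lia].
Qed.

(** [k] is a decreasing variant. A turn costs the body and one test, and the final test accounts for
    the strict inequality on [T]. *)
Lemma runs_while (I : nat -> store -> Prop) e1 e2 c k s T Tb (Q : store -> Prop) :
  (forall k s, I k s -> aeval s e1 <= aeval s e2 ->
     runs c s Tb (fun s' => exists2 k', (k' < k)%N & I k' s')) ->
  I k s -> (k * Tb.+1 < T)%N ->
  (forall k s, I k s -> aeval s e2 < aeval s e1 -> Q s) ->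
  runs (While e1 e2 c) s T Q.
Proof.
move=> hb hI hT hQ; elim/ltn_ind: k s hI T hT => k IH s hI T hT.
have [le|gt] := leP (aeval s e1) (aeval s e2); last first.
  by exists s, 1%N; split; [apply: ExecWhileEnd; rewrite -ltNge|lia|exact: hQ hI gt].
have [s1 [t1 [E1 le1 [k' lt hI']]]] := hb _ _ hI le.
have le2 : (k'.+1 * Tb.+1 <= k * Tb.+1)%N by rewrite leq_mul2r lt orbT.
have [|s2 [t2 [E2 lt2 hQ2]]] := IH _ lt s1 hI' (T - Tb.+1)%N.
  by move: le2 hT; rewrite mulSn; move: (k' * Tb.+1)%N (k * Tb.+1)%N => u v; lia.
exists s2, (t1 + t2).+1; split=> //.
  exact: (ExecWhileStep le E1 E2).
by move: le2 hT; rewrite mulSn; move: (k' * Tb.+1)%N (k * Tb.+1)%N => u v; lia.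
Qed.

(** The invariant has to be insensitive to the counter, which the loop itself writes; the value of
    the counter is tracked separately. *)
Lemma runs_for (I : nat -> store -> Prop) v e c s T N Tb (Q : store -> Prop) :
  (forall k s x, I k s -> I k (upd s v 0 0 x)) ->
  (forall k s, I k s -> (k <= N)%N -> aeval s e = N%:Z) ->
  (forall k s, (k < N)%N -> I k s -> s v 0 0 = k%:Z ->
     runs c s Tb (fun s' => s' v 0 0 = k%:Z /\ I k.+1 s')) ->
  I 0%N s -> (N * Tb.+2 + 1 < T)%N -> (forall s, I N s -> Q s) ->
  runs (For v e c) s T Q.
Proof.
move=> stab he hb hI hT hQ; apply: runs_seq_set; first lia.
apply: (@runs_while (fun r s => exists k, [/\ (r + k = N)%N, I k s & s v 0 0 = k%:Z])
  _ _ _ N _ _ Tb.+1); last 1 first.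
- move=> r s' [k [rk hIk sv]] /=; rewrite sv (he k) //; last lia.
  by move=> lt; apply: hQ; have <- : k = N by lia.
- move=> r s' [k [rk hIk sv]] /=; rewrite sv (he k) //; last lia.
  move=> le; apply: (@runs_seq _ _ _ Tb); first lia.
  have := hb k s'; case=> // [|s1 [t1 [E1 le1 [sv1 hI1]]]]; first lia.
  exists s1, t1; split=> //; apply: runs_set; first lia.
  exists r.-1; first lia.
  exists k.+1; split; [lia|exact: stab|rewrite upd_same /= sv1; lia].
- exists 0%N; split; [lia|exact: stab|by rewrite upd_same].
- by move: hT; move: (N * Tb.+2)%N => u; lia.
Qed.

(** Loops over a matrix in which each turn settles its own cell and leaves settled cells alone: the
    invariant is that the cells passed in lexicographic order are settled. *)
Lemma runs_for2 (m n : nat) (P : 'I_m -> 'I_n -> store -> Prop) (F : store -> Prop)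
    vi vj ei ej c s T Tb (Q : store -> Prop) : vi != vj ->
  (forall s x, F s -> F (upd s vi 0 0 x) /\ F (upd s vj 0 0 x)) ->
  (forall i j s x, P i j s -> P i j (upd s vi 0 0 x) /\ P i j (upd s vj 0 0 x)) ->
  (forall s, F s -> aeval s ei = m%:Z /\ aeval s ej = n%:Z) ->
  (forall (i : 'I_m) (j : 'I_n) s, F s ->
     s vi 0 0 = (i : nat)%:Z -> s vj 0 0 = (j : nat)%:Z ->
     runs c s Tb (fun s' => [/\ s' vi 0 0 = (i : nat)%:Z, s' vj 0 0 = (j : nat)%:Z,
       F s', P i j s' &
       forall i' j', (i', j') != (i, j) -> P i' j' s -> P i' j' s'])) ->
  F s -> (m * (n * Tb.+2 + 2).+2 + 1 < T)%N ->
  (forall s, F s -> (forall i j, P i j s) -> Q s) ->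
  runs (For vi ei (For vj ej c)) s T Q.
Proof.
move=> vij sF sP he hb hF hT hQ.
apply: (@runs_for (fun k s => F s /\ forall (i : 'I_m) j, (i < k)%N -> P i j s)
  _ _ _ _ _ m (n * Tb.+2 + 2)) => //.
- by move=> k s' x [h1 h2]; split=> [|i j lt]; [case: (sF s' x h1)|case: (sP i j s' x (h2 i j lt))].
- by move=> k s' [/he[]].
- move=> k s0 lt_k [hF0 hP0] svi.
  apply: (@runs_for (fun l s => [/\ s vi 0 0 = k%:Z, F s &
     forall (i : 'I_m) (j : 'I_n), (i < k)%N || (i == k :> nat) && (j < l)%N -> P i j s])
    _ _ _ _ _ n Tb) => //.
  + move=> l s1 x [h1 h2 h3]; split.
    * by rewrite upd_other.
    * by case: (sF s1 x h2).
    * by move=> i j lt; case: (sP i j s1 x (h3 i j lt)).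
  + by move=> l s1 [_ /he[_ ->]].
  + move=> l s1 lt_l [h1 h2 h3] svj.
    apply: (runs_conseq (hb (Ordinal lt_k) (Ordinal lt_l) s1 h2 h1 svj)) => // s2.
    move=> [g1 g2 g3 g4 g5]; split=> //; split=> // i j cond.
    have [/eqP[ei' ej']|ne] := boolP ((i, j) == (Ordinal lt_k, Ordinal lt_l)).
      by rewrite ei' ej'.
    apply: g5 => //; apply: h3; move: cond; rewrite ltnS => /orP[->//|/andP[ik lj]].
    apply/orP; right; rewrite ik /= ltn_neqAle lj andbT.
    apply: contra ne => /eqP jl; apply/eqP; congr pair; apply: val_inj => //=.
    exact/eqP.
  + split=> // i j; rewrite andbF orbF; exact: hP0.
  + by move: (n * Tb.+2)%N => u; lia.
  + move=> s1 [h1 h2 h3]; split=> //; split=> // i j; rewrite ltnS leq_eqVlt => /orP[ik|lt].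
      by apply: h3; rewrite ik /= ltn_ord orbT.
    by apply: h3; rewrite lt.
- by move=> s' [h1 h2]; apply: hQ => // i j; apply: h2.
Qed.

Lemma traced_seq c1 c2 s h t Q :
  traced c1 s h t (fun s1 h1 t1 => traced c2 s1 h1 t1 Q) ->
  traced (Seq c1 c2) s h t Q.
Proof.
move=> [s1 [t1 [q1 [E1 [s2 [t2 [q2 [E2 hQ]]]]]]]].
exists s2, (t1 + t2)%N, (q1 ++ q2); split; first exact: (ExecSeq E1 E2).
by rewrite catA addnA.
Qed.

Lemma traced_runs c s h t T (P : store -> Prop) (Q : _ -> _ -> _ -> Prop) :
  runs c s T P ->
  (forall s' t', P s' -> (t' <= t + T)%N -> Q s' h t') -> traced c s h t Q.
Proof.
move=> [s' [t' [E le hP]]] hQ; exists s', t', [::]; split=> //.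
by rewrite cats0; apply: hQ => //; rewrite leq_add2l.
Qed.

Lemma traced_conseq c s h t (Q Q' : _ -> _ -> _ -> Prop) :
  traced c s h t Q -> (forall s' h' t', Q s' h' t' -> Q' s' h' t') ->
  traced c s h t Q'.
Proof. by move=> [s' [t' [qs [E hQ]]]] h'; exists s', t', qs; split=> //; exact: h'. Qed.

Lemma traced_if s e1 e2 c1 c2 h t Q :
  (aeval s e1 <= aeval s e2 -> traced c1 s h t.+1 Q) ->
  (aeval s e2 < aeval s e1 -> traced c2 s h t.+1 Q) -> traced (If e1 e2 c1 c2) s h t Q.
Proof.
move=> h1 h2.
have [s' [t' [qs [E hQ]]]] :
    traced (if aeval s e1 <= aeval s e2 then c1 else c2) s h t.+1 Q.
  by case: leP => g; [exact: h1|exact: h2].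
by exists s', t'.+1, qs; split; [constructor|rewrite addnS -addSn].
Qed.

Lemma traced_while (I : nat -> store -> seq query -> nat -> Prop) e1 e2 c k s h t
    (Q : store -> seq query -> nat -> Prop) :
  (forall k s h t, I k s h t -> aeval s e1 <= aeval s e2 ->
     traced c s h t.+1 (fun s' h' t' => exists2 k', (k' < k)%N & I k' s' h' t')) ->
  I k s h t ->
  (forall k s h t, I k s h t -> aeval s e2 < aeval s e1 -> Q s h t.+1) ->
  traced (While e1 e2 c) s h t Q.
Proof.
move=> hb hI hQ; elim/ltn_ind: k s h t hI => k IH s h t hI.
have [le|gt] := leP (aeval s e1) (aeval s e2); last first.
  exists s, 1%N, [::]; split; first by apply: ExecWhileEnd; rewrite -ltNge.
  by rewrite cats0 addn1; exact: hQ hI gt.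
have [s1 [t1 [q1 [E1 [k' lt hI']]]]] := hb _ _ _ _ hI le.
have [s2 [t2 [q2 [E2 hQ2]]]] := IH _ lt _ _ _ hI'.
exists s2, (t1 + t2).+1, (q1 ++ q2); split; first exact: (ExecWhileStep le E1 E2).
by rewrite catA addnS addnA -!addSn.
Qed.
End Logic.

(** The value cell of an absent entry is left free, since the construction of a query writes a
    number there as well. *)
Definition stored (s : store) (f v m n : nat) (A : intmx m n) : Prop :=
  forall (i : 'I_m) (j : 'I_n),
    s f (i : nat)%:Z (j : nat)%:Z = (A i j != None : nat)%:Z /\
    forall z, A i j = Some z -> s v (i : nat)%:Z (j : nat)%:Z = z.

Lemma stored_read s f v m n (A : intmx m n) : stored s f v A -> read_mx s f v m n = A.
Proof.
move=> h; apply/matrixP => i j; rewrite mxE; case: (h i j) => -> hv.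
by case: (A i j) hv => [z|] //= hv; rewrite (hv z).
Qed.

Lemma read_queryE s f v f' v' m n em en (A B : intmx m n) :
  aeval s em = m%:Z -> aeval s en = n%:Z -> stored s f v A -> stored s f' v' B ->
  read_query s f v f' v' em en = Query A B.
Proof. by rewrite /read_query => -> -> /stored_read -> /stored_read ->. Qed.

Lemma cell_ord m n (A : intmx m n) (i : 'I_m) (j : 'I_n) :
  cell A (i : nat)%:Z (j : nat)%:Z = A i j.
Proof. by rewrite /cell !valK. Qed.

(** Leaves [e0 + eq * e] in array 25, for nonnegative [eq]. The multiplier is always a denominator,
    [kappa] or the number of columns, which keeps repeated addition affordable. *)
Definition MulAdd (e0 eq e : aexp) : cmd :=
  Seq (Assign 25 e0) (For 24 eq (Assign 25 (Add (V 25) e))).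

Lemma runs_MulAdd o e0 eq e (s : store) (q : nat) T (Q : store -> Prop) :
  avoids [:: 24; 25]%N eq -> avoids [:: 24; 25]%N e -> aeval s eq = q%:Z ->
  (q * 3 + 2 < T)%N ->
  (forall s', same_but [:: 24; 25]%N s s' ->
     s' 25%N 0 0 = aeval s e0 + q%:Z * aeval s e -> Q s') ->
  runs o (MulAdd e0 eq e) s T Q.
Proof.
move=> aq ae hq hT hQ; apply: runs_seq_set; first lia.
apply: (@runs_for _ (fun k s' => same_but [:: 24; 25]%N s s' /\
    s' 25%N 0 0 = aeval s e0 + k%:Z * aeval s e) _ _ _ _ _ q 1).
- by move=> k s' x [h1 h2]; split; [apply: same_but_upd|rewrite upd_other].
- by move=> k s' [h1 _] _; rewrite (aeval_same aq h1).
- move=> k s' _ [h1 h2] h3; apply: runs_set => //; split; first by rewrite upd_other.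
  split; first exact: same_but_upd.
  by rewrite upd_same /= h2 (aeval_same ae h1); lia.
- by split; [apply: same_but_upd|rewrite upd_same mul0r addr0].
- lia.
- by move=> s' [h1 h2]; exact: hQ.
Qed.

(** * Writing the query matrices *)

Definition ncols : aexp := Get 0 (Cst 0) (Cst 1).
Definition nrows : aexp := Get 0 (Cst 0) (Cst 0).
Definition At (a : nat) : aexp := Get a (V 22) (V 23).

(* The entries are multiplied by the denominator Q of the tested point P / Q. *)
Definition Build : cmd :=
  For 22 nrows (For 23 ncols
    (Seq (MulAdd (Cst 0) (V 21) (At 2))
    (Seq (Set_ 8 (V 22) (V 23) (V 25))
    (Seq (Set_ 10 (Add (V 22) nrows) (V 23) (V 25))
    (Seq (Set_ 7 (V 22) (V 23) (At 1))
    (Seq (Set_ 9 (Add (V 22) nrows) (V 23) (At 1))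
    (Seq (MulAdd (V 20) (V 21) (At 4))
    (Seq (Set_ 10 (V 22) (V 23) (V 25))
    (Seq (Set_ 8 (Add (V 22) nrows) (V 23) (V 25))
    (Seq (Set_ 9 (V 22) (V 23) (At 3))
         (Set_ 7 (Add (V 22) nrows) (V 23) (At 3)))))))))))).

Section OnInput.
Variables (m n : nat) (A B : intmx m n).

Definition holds_input (s : store) : Prop :=
  forall a, (a < 5)%N -> s a = init A B a.

Lemma holds_input_same l s s' : all (fun a => 4 < a)%N l ->
  same_but l s s' -> holds_input s -> holds_input s'.
Proof.
move=> hl h hs a a5; rewrite h ?hs //; apply: contraTN a5 => al.
by rewrite -leqNgt; exact: (allP hl).
Qed.

Lemma input_dims s : holds_input s -> s 0%N 0 0 = m%:Z /\ s 0%N 0 1 = n%:Z.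
Proof. by move=> h; rewrite h. Qed.

Lemma input_A s (i : 'I_m) (j : 'I_n) : holds_input s ->
  s 1%N (i : nat)%:Z (j : nat)%:Z = (A i j != None : nat)%:Z /\
  s 2%N (i : nat)%:Z (j : nat)%:Z = odflt 0 (A i j).
Proof. move=> h; rewrite !h //; split.
  change (init A B 1%N i j) with (if cell A i j is Some _ then 1 else 0 : int).
  by rewrite cell_ord; case: (A i j).
change (init A B 2%N i j) with (if cell A i j is Some z then z else 0 : int).
by rewrite cell_ord; case: (A i j).
Qed.

Lemma input_B s (i : 'I_m) (j : 'I_n) : holds_input s ->
  s 3%N (i : nat)%:Z (j : nat)%:Z = (B i j != None : nat)%:Z /\
  s 4%N (i : nat)%:Z (j : nat)%:Z = odflt 0 (B i j).
Proof. move=> h; rewrite !h //; split.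
  change (init A B 3%N i j) with (if cell B i j is Some _ then 1 else 0 : int).
  by rewrite cell_ord; case: (B i j).
change (init A B 4%N i j) with (if cell B i j is Some z then z else 0 : int).
by rewrite cell_ord; case: (B i j).
Qed.

Definition build_arrays : seq nat := [:: 7; 8; 9; 10; 22; 23; 24; 25]%N.

Definition built (s0 : store) (p q : int) (i : 'I_m) (j : 'I_n) (s : store) : Prop :=
  let x := (i : nat)%:Z in let y := (j : nat)%:Z in let x' := x + m%:Z in
  [/\ s 7%N x y = s0 1%N x y, s 8%N x y = q * s0 2%N x y,
      s 9%N x y = s0 3%N x y & s 10%N x y = p + q * s0 4%N x y] /\
  [/\ s 7%N x' y = s0 3%N x y, s 8%N x' y = p + q * s0 4%N x y,
      s 9%N x' y = s0 1%N x y & s 10%N x' y = q * s0 2%N x y].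

Lemma runs_Build o (s : store) (p : int) (q : nat) T (Q : store -> Prop) :
  holds_input s -> s 20%N 0 0 = p -> s 21%N 0 0 = q%:Z ->
  (m * (n * (q * 6 + 20) + 4) + 1 < T)%N ->
  (forall s', same_but build_arrays s s' ->
     stored s' 7 8 (q_A (query_at A B p q)) ->
     stored s' 9 10 (q_B (query_at A B p q)) -> Q s') ->
  runs o Build s T Q.
Proof.
move=> hin hp hq hT hQ.
apply: (@runs_for2 _ m n (built s p q) (same_but build_arrays s) _ _ _ _ _ _ _
  (q * 6 + 18)) => //.
- by move=> s1 x h; split; apply: same_but_upd.
- move=> s1 h; have h' := holds_input_same (isT : all (fun a => 4 < a)%N build_arrays) h hin.
  exact: input_dims h'.
- move=> i j s1 h hi hj.
  have hin1 := holds_input_same (isT : all (fun a => 4 < a)%N build_arrays) h hin.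
  have [d1 d2] := input_dims hin1.
  have e a : (a < 5)%N -> s1 a = s a by move=> a5; rewrite hin1 // hin.
  have [g1 g2 g3 g4] : [/\ s1 1%N = s 1%N, s1 2%N = s 2%N, s1 3%N = s 3%N & s1 4%N = s 4%N].
    by rewrite !e.
  have g20 : s1 20%N 0 0 = p by rewrite h.
  have g21 : s1 21%N 0 0 = q%:Z by rewrite h.
  apply: (@runs_seq _ _ _ _ (q * 3 + 3)); first lia.
  apply: (@runs_MulAdd _ _ _ _ _ q) => // [|s2 h2 a2]; first lia.
  move: a2; rewrite /= hi hj g2 add0r => a2.
  have [J22 J23 J0 J1] : [/\ s2 22%N 0 0 = i%:Z, s2 23%N 0 0 = j%:Z,
      s2 0%N 0 0 = m%:Z & s2 1%N = s 1%N] by rewrite !h2.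
  apply: (runs_seq_upd _ (i := i%:Z) (j := j%:Z) (v := q%:Z * s 2%N i j)) => //; first lia.
  apply: (runs_seq_upd _ (i := i%:Z + m%:Z) (j := j%:Z) (v := q%:Z * s 2%N i j));
    [lia|by rewrite /= /upd /= J22 J0|by []|by []|].
  apply: (runs_seq_upd _ (i := i%:Z) (j := j%:Z) (v := s 1%N i j));
    [lia|by []|by []|by rewrite /= /upd /= J22 J23 J1|].
  apply: (runs_seq_upd _ (i := i%:Z + m%:Z) (j := j%:Z) (v := s 1%N i j));
    [lia|by rewrite /= /upd /= J22 J0|by []|by rewrite /= /upd /= J22 J23 J1|].
  apply: (@runs_seq _ _ _ _ (q * 3 + 3)); first lia.
  set s3 := upd _ 9 _ _ _.
  have h3 : same_but [:: 7; 8; 9; 10; 24; 25]%N s1 s3.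
    rewrite /s3; do 4 (apply: same_but_upd => //).
    by apply: same_but_sub h2 => ?; rewrite !inE => /orP[]->; rewrite ?orbT.
  apply: (@runs_MulAdd _ _ _ _ _ q) => // [||s4 h4 a4].
  - by rewrite /= h3.
  - lia.
  move: a4; rewrite /= !h3 // hi hj g4 g20 => a4.
  have E k : (k \notin [:: 7; 8; 9; 10; 24; 25]%N) -> s4 k = s1 k.
    by move=> k1; rewrite h4 ?h3 //; apply: contra k1; rewrite !inE => /orP[]->; rewrite ?orbT.
  have [K22 K23 K0 K3] : [/\ s4 22%N 0 0 = i%:Z, s4 23%N 0 0 = j%:Z,
      s4 0%N 0 0 = m%:Z & s4 3%N = s 3%N] by rewrite !E.
  apply: (runs_seq_upd _ (i := i%:Z) (j := j%:Z) (v := p + q%:Z * s 4%N i j)) => //; first lia.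
  apply: (runs_seq_upd _ (i := i%:Z + m%:Z) (j := j%:Z) (v := p + q%:Z * s 4%N i j));
    [lia|by rewrite /= /upd /= K22 K0|by []|by []|].
  apply: (runs_seq_upd _ (i := i%:Z) (j := j%:Z) (v := s 3%N i j));
    [lia|by []|by []|by rewrite /= /upd /= K22 K23 K3|].
  apply: (runs_upd _ (i := i%:Z + m%:Z) (j := j%:Z) (v := s 3%N i j));
    [lia|by rewrite /= /upd /= K22 K0|by []|by rewrite /= /upd /= K22 K23 K3|].
  (* Writes to the upper and the lower half of the stacked matrices never collide, as
     [i' < m <= i + m]. *)
  have xx' (i' : 'I_m) : ((i' : nat)%:Z == (i : nat)%:Z + m%:Z) = false by have := ltn_ord i'; lia.
  have x'x (i' : 'I_m) : ((i' : nat)%:Z + m%:Z == (i : nat)%:Z) = false by have := ltn_ord i; lia.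
  have x'x' (i' : 'I_m) :
      ((i' : nat)%:Z + m%:Z == (i : nat)%:Z + m%:Z) = ((i' : nat)%:Z == (i : nat)%:Z).
    exact: (inj_eq (addIr _)).
  set s5 := upd _ 7 _ _ _.
  (* All writes of one turn at once; both the new cells and the preserved ones are read off from
     this table. *)
  have s5E k x y : s5 k x y = if k == 7%N then
      (if (x == i%:Z + m%:Z) && (y == j%:Z) then s 3%N i j else
       if (x == i%:Z) && (y == j%:Z) then s 1%N i j else s2 7%N x y)
    else if k == 9%N then
      (if (x == i%:Z) && (y == j%:Z) then s 3%N i j else
       if (x == i%:Z + m%:Z) && (y == j%:Z) then s 1%N i j else s2 9%N x y)
    else if k == 8%N then
      (if (x == i%:Z + m%:Z) && (y == j%:Z) then p + q%:Z * s 4%N i j else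
       if (x == i%:Z) && (y == j%:Z) then q%:Z * s 2%N i j else s2 8%N x y)
    else if k == 10%N then
      (if (x == i%:Z) && (y == j%:Z) then p + q%:Z * s 4%N i j else
       if (x == i%:Z + m%:Z) && (y == j%:Z) then q%:Z * s 2%N i j else s2 10%N x y)
    else s4 k x y.
    rewrite /s5 /upd.
    do 4 (case: (k =P _) => [->|_] /=; first by rewrite h4 // /s3 /upd /=).
    by [].
  split=> //.
  + by do 4 (apply: same_but_upd => //); apply: same_but_trans h _; apply: same_but_trans (same_but_sub _ h3) (same_but_sub _ h4) => ?; rewrite !inE; do ?(case: eqP => //= _).
  + by rewrite /built !s5E /= !eqxx /= ?xx' ?x'x.
  + move=> i' j' ne [[p1 p2 p3 p4] [p5 p6 p7 p8]].
    have ne' : (((i' : nat)%:Z == (i : nat)%:Z) && ((j' : nat)%:Z == (j : nat)%:Z)) = false.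
      apply: contraNF ne => /andP[/eqP[/val_inj ->] /eqP[/val_inj ->]] //.
    by rewrite /built !s5E /= !xx' !x'x !x'x' /= !ne' !h2.
- by lia.
move=> s1 h1 hb; apply: hQ => // i j.
  case: (split_ordP i) => {}i -> /=; rewrite mxE ?split_lshift ?split_rshift;
    case: (hb i j) => -[b1 b2 b3 b4] [b5 b6 b7 b8].
    have [a1 a2] := input_A i j hin.
    by rewrite b1 a1 b2 a2; case: (A i j) => [a|] //=; split=> // z [].
  have [a1 a2] := input_B i j hin.
  rewrite PoszD addrC b5 a1 b6 a2; case: (B i j) => [a|] //=; split=> // z [] //.
case: (split_ordP i) => {}i -> /=; rewrite mxE ?split_lshift ?split_rshift;
  case: (hb i j) => -[b1 b2 b3 b4] [b5 b6 b7 b8].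
  have [a1 a2] := input_B i j hin.
  by rewrite b3 a1 b4 a2; case: (B i j) => [a|] //=; split=> // z [].
have [a1 a2] := input_A i j hin.
rewrite PoszD addrC b7 a1 b8 a2; case: (A i j) => [a|] //=; split=> // z [] //.
Qed.
End OnInput.

(** * Testing one point and recording an interval *)

Definition work_arrays : seq nat :=
  [:: 7; 8; 9; 10; 11; 20; 21; 22; 23; 24; 25; 34; 35; 36; 37; 38]%N.

Definition test_arrays : seq nat := [:: 11; 22; 23; 24; 25; 34; 35; 36; 37; 38]%N.

(* [asks] tells whether the test queries the oracle. *)
Definition test_correct (R : realType) (o : oracle) (c : cmd) (asks : bool) (TT : nat)
    (good : query -> bool) : Prop :=
  forall m n (A B : intmx m n) s h t,
    s 0%N 0 0 + s 0%N 0 0 = m%:Z -> s 0%N 0 1 = n%:Z ->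
    stored s 7 8 A -> stored s 9 10 B -> good (Query A B) ->
    traced o c s h t (fun s' h' t' =>
      [/\ same_but test_arrays s s',
          0 <= s' 11%N 0 0 <-> subeigenvalue A B (0 : R),
          h' = h ++ nseq asks (Query A B) & (t' <= t + TT)%N]).

Definition AskOracle : cmd := Call 7 8 9 10 (Add nrows nrows) ncols 11.

Lemma AskOracle_correct (R : realType) o (good : query -> bool) :
  mpg_oracle R o -> (forall q, good q -> playable q) ->
  test_correct R o AskOracle true 1 good.
Proof.
move=> ho pl m n A B s h t hm hn sA sB /pl hq.
set q := Query A B.
have qE : read_query s 7 8 9 10 (Add nrows nrows) ncols = q.
  by apply: read_queryE => //=.
pose s' := upd (upd s 11 0 0 (numq (answer o q))) 11 0 1 (denq (answer o q)).
exists s', 1%N, [:: q]; split; first by rewrite /s' -qE; exact: ExecCall.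
split=> //; first by do 2 (apply: same_but_upd => //).
by rewrite /s' /upd /=; apply: oracle_sign.
Qed.

Section Outputs.
Variable R : realType.

Definition in_row (f p q f' p' q' : int) (l : R) : Prop :=
  (f != 0 -> p%:~R / q%:~R <= l) /\ (f' != 0 -> l <= p'%:~R / q'%:~R).

Definition Emit (e0 e1 e2 e3 e4 e5 : aexp) : cmd :=
  Seq (Set_ 6 (V 5) (Cst 0) e0)
  (Seq (Set_ 6 (V 5) (Cst 1) e1)
  (Seq (Set_ 6 (V 5) (Cst 2) e2)
  (Seq (Set_ 6 (V 5) (Cst 3) e3)
  (Seq (Set_ 6 (V 5) (Cst 4) e4)
  (Seq (Set_ 6 (V 5) (Cst 5) e5)
       (Assign 5 (Add (V 5) (Cst 1)))))))).

Lemma runs_Emit o e0 e1 e2 e3 e4 e5 s (k : nat) T (Q : store -> Prop) :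
  all (avoids [:: 5; 6]%N) [:: e0; e1; e2; e3; e4; e5] ->
  s 5%N 0 0 = k%:Z -> (7 <= T)%N ->
  (forall s', same_but [:: 5; 6]%N s s' -> s' 5%N 0 0 = k.+1%:Z ->
     (forall l, output R s' l <-> output R s l \/
        in_row (aeval s e0) (aeval s e1) (aeval s e2)
               (aeval s e3) (aeval s e4) (aeval s e5) l) -> Q s') ->
  runs o (Emit e0 e1 e2 e3 e4 e5) s T Q.
Proof.
move=> /= /and5P[a0 a1 a2 a3 /andP[a4 /andP[a5 _]]] hk hT hQ.
have st s' i j v : same_but [:: 5; 6]%N s s' -> same_but [:: 5; 6]%N s (upd s' 6 i j v).
  by move=> h; apply: same_but_upd.
have step s' e j v c T' : (0 < T')%N -> avoids [:: 5; 6]%N e -> v = aeval s e ->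
    same_but [:: 5; 6]%N s s' -> s' 5%N 0 0 = k%:Z ->
    runs o c (upd s' 6 k%:Z j v) T'.-1 Q ->
    runs o (Seq (Set_ 6 (V 5) (Cst j) e) c) s' T' Q.
  move=> T0 ae -> hs h5; apply: runs_seq_upd => //; exact: aeval_same ae hs.
do 6 (apply: (step); [lia|by []|reflexivity|by do ?[apply: (st)]|by rewrite /upd /=|]).
apply: runs_upd => //; first lia.
set s' := upd _ 5 _ _ _.
have h' : same_but [:: 5; 6]%N s s' by do 7 (apply: same_but_upd => //).
have e5' : s' 5%N 0 0 = k.+1%:Z by rewrite /s' /upd /= hk; lia.
apply: hQ => // l.
have old (i : nat) : (i < k)%N -> @out_interval R s' i%:Z l <-> @out_interval R s i%:Z l.
  move=> lt; have ne : (i%:Z == k%:Z :> int) = false by lia.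
  by rewrite /out_interval /s' /upd /= ne.
have new : @out_interval R s' k%:Z l <-> in_row (aeval s e0) (aeval s e1) (aeval s e2)
               (aeval s e3) (aeval s e4) (aeval s e5) l.
  by rewrite /out_interval /in_row /s' /upd /= eqxx.
rewrite /output /= e5' hk; split.
  case=> i []; rewrite ltz_nat ltnS leq_eqVlt => /orP[/eqP->|lt] hi.
    by right; apply/new.
  by left; exists i; split; [rewrite ltz_nat|apply/old].
case=> [[i [lt hi]]|hi]; last by exists k; split; [rewrite ltz_nat|apply/new].
rewrite ltz_nat in lt; exists i; split; last exact/old.
by rewrite ltz_nat ltnS ltnW.
Qed.
End Outputs.

(** The tested point and the recorded interval are independent: a test at a mediant, or just beyond
    an end, stands for a whole cell or ray. *)
Definition Probe (Test : cmd) (eP eQ e0 e1 e2 e3 e4 e5 : aexp) : cmd :=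
  Seq (Assign 20 eP)
  (Seq (Assign 21 eQ)
  (Seq Build
  (Seq Test
       (If (Cst 0) (V 11) (Emit e0 e1 e2 e3 e4 e5) Skip)))).

Definition probe_arrays : seq nat := [:: 5; 6]%N ++ work_arrays.

Section Probing.
Variables (R : realType) (o : oracle) (m n : nat) (A B : intmx m n).
Variables (Test : cmd) (asks : bool) (TT : nat) (good : query -> bool).
Hypothesis TestP : test_correct R o Test asks TT good.

Local Notation Sp := (spec (Rmx R A) (Rmx R B)).

Definition probe_time (q : nat) : nat := (m * (n * (q * 6 + 20) + 4) + TT + 12)%N.

Lemma traced_Probe eP eQ e0 e1 e2 e3 e4 e5 s h t (k q : nat) (p : int) :
  holds_input A B s -> s 5%N 0 0 = k%:Z ->
  all (avoids probe_arrays) [:: eP; eQ; e0; e1; e2; e3; e4; e5] ->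
  aeval s eP = p -> aeval s eQ = q%:Z -> (0 < q)%N -> good (query_at A B p q) ->
  traced o (Probe Test eP eQ e0 e1 e2 e3 e4 e5) s h t (fun s' h' t' =>
    [/\ same_but probe_arrays s s' /\ (exists k' : nat, s' 5%N 0 0 = k'%:Z),
        forall l, output R s' l <-> output R s l \/
          (Sp (p%:~R / q%:R) /\
           in_row (aeval s e0) (aeval s e1) (aeval s e2)
                  (aeval s e3) (aeval s e4) (aeval s e5) l),
        h' = h ++ nseq asks (query_at A B p q) &
        (t' <= t + probe_time q)%N]).
Proof.
move=> hin hk /= /and5P[aP aQ a0 a1 /and5P[a2 a3 a4 a5 _]] hP hQ q0 hg.
apply: traced_seq.
have sub (l : seq nat) (s1 s2 : store) : all (fun a => a \in probe_arrays) l ->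
    same_but l s1 s2 -> same_but probe_arrays s1 s2.
  by move=> /allP hl; apply: same_but_sub.
apply: (@traced_runs o _ _ _ _ 1 (fun s' => s' = upd s 20 0 0 p)).
  by apply: (@runs_upd _ _ _ _ _ _ 0 0 p).
move=> _ t1 -> le1; apply: traced_seq.
set s1 := upd s 20 0 0 p.
have h1 : same_but probe_arrays s s1 by apply: same_but_upd.
apply: (@traced_runs o _ _ _ _ 1 (fun s' => s' = upd s1 21 0 0 q)).
  by apply: (@runs_upd _ _ _ _ _ _ 0 0 q) => //=; rewrite (aeval_same aQ h1).
move=> _ t2 -> le2; apply: traced_seq.
set s2 := upd s1 21 0 0 q.
have h2 : same_but probe_arrays s s2 by apply: same_but_upd.
have out2 : s2 5%N = s 5%N /\ s2 6%N = s 6%N by [].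
have inp a : same_but probe_arrays s a -> holds_input A B a.
  by move=> ha; apply: holds_input_same ha hin.
apply: (@traced_runs o _ _ _ _ (m * (n * (q * 6 + 20) + 4) + 2)%N (fun s' =>
  [/\ same_but build_arrays s2 s', stored s' 7 8 (q_A (query_at A B p q)) &
     stored s' 9 10 (q_B (query_at A B p q))])).
  by apply: (runs_Build _ (inp _ h2)) => //; move: (m * _)%N => u; lia.
move=> s3 t3 [h3 sA sB] le3; apply: traced_seq.
have h3' : same_but probe_arrays s s3 by apply: same_but_trans h2 (@sub build_arrays _ _ isT h3).
have [d1 d2] := input_dims (inp _ h3').
apply: (traced_conseq (TestP h t3 _ _ sA sB _)) => //; first by rewrite d1.
move=> s4 h' t4 [h4 hs -> le4].
have h4' : same_but probe_arrays s s4 by apply: same_but_trans h3' (@sub test_arrays _ _ isT h4).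
have [o5 o6] : s4 5%N = s 5%N /\ s4 6%N = s 6%N.
  by rewrite !h4 // !h3.
have outE l : output R s4 l <-> output R s l.
  by rewrite /output /out_interval /= o5 o6.
have spE : 0 <= s4 11%N 0 0 <-> Sp (p%:~R / q%:R).
  by apply: iff_trans hs _; rewrite pmulrn; apply: query_atP; lia.
apply: traced_if => /= hsign.
  have hsp : Sp (p%:~R / q%:R) by apply/spE.
  have sub56 : {subset [:: 5; 6]%N <= probe_arrays} by move=> a; rewrite mem_cat => ->.
  have av e : avoids probe_arrays e -> avoids [:: 5; 6]%N e.
    by move=> /allP he; apply/allP => a /he; apply: contra; exact: sub56.
  apply: (@traced_runs o _ _ _ _ 7 (fun s' => [/\ same_but [:: 5; 6]%N s4 s',
     s' 5%N 0 0 = k.+1%:Z & forall l, output R s' l <-> output R s4 l \/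
        in_row (aeval s4 e0) (aeval s4 e1) (aeval s4 e2)
               (aeval s4 e3) (aeval s4 e4) (aeval s4 e5) l])).
    apply: (runs_Emit o (R := R) (k := k)) => //=; first by rewrite !av.
    by rewrite o5.
  move=> s5 t5 [h5 g5 out5] le5; split=> //.
  - by split; [apply: same_but_trans h4' (@sub [:: 5; 6]%N _ _ isT h5)|exists k.+1].
  - move=> l; rewrite out5 outE !(aeval_same _ h4') //.
    by split; [case; [left|right]|case; [left|case; right]].
  - rewrite /probe_time; lia.
apply: (@traced_runs o _ _ _ _ 1 (fun s' => s' = s4)); first exact: runs_skip.
move=> _ t5 -> le5; split=> //.
- by split=> //; exists k; rewrite o5.
- move=> l; rewrite outE; split; [by left|case=> // -[/spE]].
  by rewrite leNgt hsign.
- rewrite /probe_time; lia.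
Qed.
End Probing.

(** * Enumeration of the Farey fractions *)

Definition FareyStep : cmd :=
  Seq (Assign 30 (Defs.Sub (Cst 0) (V 14)))
  (Seq (Assign 31 (Defs.Sub (Cst 0) (V 15)))
  (Seq (Assign 32 (Defs.Sub (Cst 0) (V 16)))
  (Seq (While (Add (V 31) (V 18)) (V 12)
    (Seq (Assign 30 (Add (V 30) (V 17)))
    (Seq (Assign 31 (Add (V 31) (V 18)))
         (Assign 32 (Add (V 32) (V 19))))))
  (Seq (Assign 14 (V 17))
  (Seq (Assign 15 (V 18))
  (Seq (Assign 16 (V 19))
  (Seq (Assign 17 (V 30))
  (Seq (Assign 18 (V 31))
       (Assign 19 (V 32)))))))))).

Definition farey_arrays : seq nat := [:: 14; 15; 16; 17; 18; 19; 30; 31; 32]%N.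

Definition registers (s : store) (a b z c d y : int) : Prop :=
  [/\ s 14%N 0 0 = a, s 15%N 0 0 = b & s 16%N 0 0 = z] /\
  [/\ s 17%N 0 0 = c, s 18%N 0 0 = d & s 19%N 0 0 = y].

(* [a / b < c / d] are neighbours in the Farey sequence of order [kap];
   [z] and [y] are their scaled distances to the upper end [U]. *)
Definition neighbours (kap : nat) (U a b z c d y : int) : Prop :=
  [/\ 0 < b, 0 < d & kap%:Z < b + d] /\
  [/\ b <= kap%:Z, d <= kap%:Z, c * b - a * d = 1, z = U * b - a & y = U * d - c].

(** The upper end is an integer, hence itself a Farey fraction, and no cell straddles it: a step
    from below cannot overshoot. *)
Lemma neighbour_distance_ge0 (b d z y : int) : 0 < b -> 0 < d ->
  z * d - y * b = 1 -> 0 < z -> 0 <= y.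
Proof.
move=> b0 d0 zy z0; rewrite leNgt; apply/negP => y0.
have hb : b * 1 <= b * - y by rewrite ler_pM2l //; lia.
have hd : d * 1 <= d * z by rewrite ler_pM2l //; lia.
have e : z * d - y * b = d * z + b * - y by ring.
by move: hb hd zy; rewrite e; clear -b0 d0; move: (d * z) (b * - y) => u v; lia.
Qed.

Lemma neighbour_distance_lt0 (b d z y : int) : 0 < b ->
  z * d - y * b = 1 -> z = 0 -> y < 0.
Proof.
move=> b0 zy z0; rewrite ltNge; apply/negP => y0.
have h : 0 <= y * b by rewrite mulr_ge0 // ltW.
by move: zy h; rewrite z0 mul0r; move: (y * b) => u; lia.
Qed.

(** The successor is [(t c - a) / (t d - b)] with the largest [t] that keeps the denominator at most
    [kappa]. Starting from [- a], [- b] and adding [c], [d] replaces the division. The determinant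
    with [c / d] stays 1, and at the exit [f + d > kappa] makes the pair adjacent. *)
Lemma runs_FareyStep o s kap U a b z c d y T (Q : store -> Prop) :
  s 12%N 0 0 = kap%:Z -> registers s a b z c d y -> neighbours kap U a b z c d y ->
  (8 * kap + 13 <= T)%N ->
  (forall s' e f g, same_but farey_arrays s s' -> registers s' c d y e f g ->
     neighbours kap U c d y e f g -> Q s') ->
  runs o FareyStep s T Q.
Proof.
move=> hk [[ra rb rz] [rc rd ry]] [[b0 d0 bd] [bk dk det hz hy]] hT hQ.
apply: (@runs_seq_upd _ _ _ _ _ _ 0 0 (- a)) => //; [lia|by rewrite /= ra sub0r|].
apply: (@runs_seq_upd _ _ _ _ _ _ 0 0 (- b)) => //; [lia|by rewrite /= /upd /= rb sub0r|].
apply: (@runs_seq_upd _ _ _ _ _ _ 0 0 (- z)) => //; [lia|by rewrite /= /upd /= rz sub0r|].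
set s1 := upd _ 32 _ _ _.
have h1 : same_but farey_arrays s s1 by do 3 (apply: same_but_upd => //).
have k1 : same_but [:: 30; 31; 32]%N s s1 by do 3 (apply: same_but_upd => //).
pose I r (s' : store) := exists e f, [/\ same_but [:: 30; 31; 32]%N s s',
  [/\ s' 30%N 0 0 = e, s' 31%N 0 0 = f & s' 32%N 0 0 = U * f - e],
  e * d - c * f = 1, f <= kap%:Z & kap%:Z - f <= r%:Z].
apply: (@runs_seq _ _ _ _ (8 * kap + 2)%N); first lia.
(* The denominator rises from [- b >= - kap] to at most [kap] in steps of [d >= 1], hence in at most
   [2 * kap] turns. *)
apply: (@runs_while _ I _ _ _ (2 * kap) _ _ 3).
- move=> r s2 [e [f [h2 [re rf rg] det2 fk fr]]] /=.
  rewrite rf !h2 // rd hk => le.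
  apply: (@runs_seq_upd _ _ _ _ _ _ 0 0 (e + c)) => //; first by rewrite /= re h2 // rc.
  apply: (@runs_seq_upd _ _ _ _ _ _ 0 0 (f + d)) => //.
    by rewrite /= /upd /= rf h2 // rd.
  apply: (@runs_upd _ _ _ _ _ _ 0 0 (U * (f + d) - (e + c))) => //.
    by rewrite /= /upd /= rg h2 // ry hy; ring.
  exists r.-1; first by lia.
  exists (e + c), (f + d); split=> //.
  + by do 3 (apply: same_but_upd => //).
  + by rewrite -det2; ring.
  + lia.
- exists (- a), (- b); split=> //; [|by rewrite -det; ring|lia|lia].
  by rewrite /s1 /upd /=; split=> //; rewrite hz; ring.
- lia.
move=> r s2 [e [f [h2 [re rf rg] det2 fk fr]]] /=.
rewrite rf !h2 // rd hk => gt.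
do 5 (apply: runs_seq_set; first lia).
apply: runs_set; first lia.
set s3 := upd _ 19 _ _ _.
have g14 : s2 17%N 0 0 = c by rewrite h2.
have g15 : s2 18%N 0 0 = d by rewrite h2.
have g16 : s2 19%N 0 0 = y by rewrite h2.
apply: (hQ s3 e f (U * f - e)).
- do 6 (apply: same_but_upd => //); apply: same_but_sub h2 => x.
  by rewrite !inE => /or3P[] /eqP->.
- by rewrite /registers /s3 /= /upd /= g14 g15 g16 re rf rg.
- split; split=> //; lia.
Qed.

Section FareyLoop.
Variables (R : realType) (o : oracle) (m n : nat) (A B : intmx m n).
Variables (Test : cmd) (asks : bool) (TT : nat) (good : query -> bool).
Hypothesis TestP : test_correct R o Test asks TT good.
Hypothesis no_col : no_common_infty_col A B.
Variable M : nat.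
Hypotheses (bA : entries_bounded M A) (bB : entries_bounded M B).

Local Notation Sp := (spec (Rmx R A) (Rmx R B)).
Local Notation kappa := (minn (2 * m) n).

Variables (L U : int).
Hypothesis good_query : forall (p : int) (q : nat), (0 < q <= 2 * kappa)%N ->
  L * q%:Z <= p -> p <= U * q%:Z -> good (query_at A B p q).

(** The sign of [z = U b - a] in cell 16 decides both tests: the loop runs while [a / b <= U], and
    the cell to the right is probed only if [a / b < U]. *)
Definition FareyLoop : cmd :=
  While (Cst 0) (V 16)
    (Seq (Probe Test (V 14) (V 15) (Cst 1) (V 14) (V 15) (Cst 1) (V 14) (V 15))
    (Seq (If (Cst 1) (V 16)
           (Probe Test (Add (V 14) (V 17)) (Add (V 15) (V 18))
              (Cst 1) (V 14) (V 15) (Cst 1) (V 17) (V 18))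
           Skip)
         FareyStep)).

Lemma probe_time_mono q q' : (q <= q')%N ->
  (probe_time m n TT q <= probe_time m n TT q')%N.
Proof.
move=> le; rewrite /probe_time !leq_add2r leq_mul2l leq_add2r leq_mul2l leq_add2r.
by rewrite leq_mul2r le !orbT.
Qed.

Definition loop_time : nat :=
  (probe_time m n TT kappa + probe_time m n TT (2 * kappa) + 8 * kappa + 16)%N.

Lemma between_neighbours (a b c d : int) : 0 < b -> 0 < d -> c * b - a * d = 1 ->
  a%:~R < (a + c)%:~R / (b + d)%:~R * b%:~R :> R /\
  (a + c)%:~R / (b + d)%:~R * d%:~R < c%:~R :> R.
Proof.
move=> b0 d0 det.
have bd0 : (0 : R) < (b + d)%:~R by rewrite ltr0z addr_gt0.
rewrite ![_ / _ * _]mulrAC ltr_pdivlMr // ltr_pdivrMr // -!rmorphM !ltr_int.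
have e1 : (a + c) * b = a * (b + d) + (c * b - a * d) by ring.
have e2 : c * (b + d) = (a + c) * d + (c * b - a * d) by ring.
by rewrite e1 e2 det !ltrDl.
Qed.

Section Invariant.
Variables (h0 : seq query) (t0 k0 : nat).

(** The clause beyond [U] is provided by the outer ray in general and by the absence of spectrum
    there in part 2. *)
Definition covered (s : store) (a b : int) : Prop :=
  [/\ forall l, output R s l -> Sp l,
      forall l, Sp l -> l * b%:~R < a%:~R -> output R s l &
      forall l, Sp l -> U%:~R < l -> output R s l].

(** [k] bounds the turns left and [it] counts those made. The last turn, at the upper end, makes one
    query instead of two; this saving yields a single query when the interval is a point. The lower
    bound on the number of queries later bounds the time per query. *)
Definition counted (z : int) (k it : nat) (h : seq query) (t : nat) : Prop :=
  [/\ (it + k <= k0)%N,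
      (t <= t0 + it * loop_time)%N,
      (size h0 + it * asks <= size h)%N &
      all good h] /\
  [/\ 0 <= z -> (size h + 2 * k * asks <= size h0 + 2 * k0 * asks)%N &
      z < 0 -> h = h0 \/ (size h + (2 * k + 1) * asks <= size h0 + 2 * k0 * asks)%N].

(** The inequality on [z] says that the remaining distance [z / b] is at most [(k - 1) / kappa^2];
    one step covers [1 / (b d) >= 1 / kappa^2]. *)
Definition farey_inv (k : nat) (s : store) (h : seq query) (t : nat) : Prop :=
  exists a b z c d y it,
    [/\ [/\ holds_input A B s, exists l : nat, s 5%N 0 0 = l%:Z & s 12%N 0 0 = kappa%:Z],
        registers s a b z c d y /\ neighbours kappa U a b z c d y,
        L * b <= a /\ z * (kappa ^ 2)%N%:Z <= (k%:Z - 1) * b,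
        covered s a b & counted z k it h t].

Lemma in_row_point (a b : int) (l : R) : 0 < b ->
  in_row 1 a b 1 a b l <-> l * b%:~R = a%:~R.
Proof.
move=> b0; have b0R : (0 : R) < b%:~R by rewrite ltr0z.
rewrite /in_row ler_pdivrMr // ler_pdivlMr //; split=> [[h1 h2]|->//].
by apply/eqP; rewrite eq_le h1 ?h2.
Qed.

Lemma in_row_segment (a b c d : int) (l : R) : 0 < b -> 0 < d ->
  in_row 1 a b 1 c d l <-> a%:~R <= l * b%:~R /\ l * d%:~R <= c%:~R.
Proof.
move=> b0 d0; have b0R : (0 : R) < b%:~R by rewrite ltr0z.
have d0R : (0 : R) < d%:~R by rewrite ltr0z.
rewrite /in_row ler_pdivrMr // ler_pdivlMr //.
by split=> [[h1 h2]|[h1 h2]]; split=> *; [exact: h1|exact: h2| |].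
Qed.

Lemma farey_invariant_step k s h t : farey_inv k s h t -> 0 <= s 16%N 0 0 ->
  traced o (Seq (Probe Test (V 14) (V 15) (Cst 1) (V 14) (V 15) (Cst 1) (V 14) (V 15))
    (Seq (If (Cst 1) (V 16)
           (Probe Test (Add (V 14) (V 17)) (Add (V 15) (V 18))
              (Cst 1) (V 14) (V 15) (Cst 1) (V 17) (V 18))
           Skip)
         FareyStep)) s h t.+1
    (fun s' h' t' => exists2 k', (k' < k)%N & farey_inv k' s' h' t').
Proof.
case=> a [b [z [c [d [y [it [[hin [len hlen] hk] [hreg hN] [La zk] hcov hcnt]]]]]]].
have [[ra rb rz] [rc rd ry]] := hreg.
have [[b0 d0 bd] [bk dk det hz hy]] := hN.
rewrite rz => z0.
have [[itk let1 itlen hgood] [cnt1 _]] := hcnt.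
have [cov1 cov2 cov3] := hcov.
have b0R : (0 : R) < b%:~R by rewrite ltr0z.
have d0R : (0 : R) < d%:~R by rewrite ltr0z.
have zy : z * d - y * b = 1 by rewrite hz hy -det; ring.
have k_gt0 : (0 < k)%N.
  rewrite lt0n; apply: contraTneq zk => ->; rewrite -ltNge sub0r mulN1r.
  by apply: (@lt_le_trans _ _ 0); rewrite ?oppr_lt0 // mulr_ge0.
case: b hreg hN b0 bd bk det hz La zk hcov cov2 rb b0R zy =>
  // b hreg hN b0 bd bk det hz La zk hcov cov2 rb b0R zy.
case: d hreg hN d0 bd dk det hy rd d0R zy => // d hreg hN d0 bd dk det hy rd d0R zy.
have hb : (0 < b <= 2 * kappa)%N by clear -b0 bk; lia.
have hbd : (0 < b + d <= 2 * kappa)%N by clear -b0 d0 bk dk; lia.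
have hU : a <= U * b%:Z by rewrite -subr_ge0 -hz.
apply: traced_seq.
apply: (traced_conseq (traced_Probe TestP h t.+1 (k := len) (q := b) (p := a) hin hlen _ _ _ _ _)) => //.
  exact: good_query hb La hU.
move=> s1 h1 t1 [[eq1 [len1 hlen1]] out1 -> le1].
have {}le1 : (t1 <= t.+1 + probe_time m n TT kappa)%N.
  by apply: leq_trans le1 _; rewrite leq_add2l probe_time_mono.
have hin1 : holds_input A B s1 by apply: holds_input_same eq1 hin.
have hk1 : s1 12%N 0 0 = kappa%:Z by rewrite eq1.
have hreg1 : registers s1 a b z c d y by rewrite /registers !eq1.
have good1 : all good (h ++ nseq asks (query_at A B a b)).
  by rewrite all_cat hgood all_nseq good_query ?orbT.
move: out1; rewrite /= ra rb => out1.
have {}out1 l : output R s1 l <-> output R s l \/ (Sp l /\ l * (b%:Z)%:~R = a%:~R).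
  rewrite out1 in_row_point //; split=> -[|[hp e]]; try by left.
    by right; split=> //; have <- : a%:~R / b%:R = l :> R
      by rewrite -e -pmulrn mulfK // gt_eqF.
  by right; split=> //; rewrite -e -pmulrn mulfK // gt_eqF.
(* Common end of the two branches; [g] holds the query made at the mediant, if any. *)
have step2 s2 (g : seq query) t2 : same_but probe_arrays s1 s2 ->
    (exists len2 : nat, s2 5%N 0 0 = len2%:Z) ->
    (forall l, output R s2 l -> Sp l) ->
    (forall l, output R s1 l -> output R s2 l) ->
    (forall l, Sp l -> a%:~R < l * (b%:Z)%:~R -> l * (d%:Z)%:~R < c%:~R -> output R s2 l) ->
    (0 < z -> g = nseq asks (query_at A B (a + c) (b + d)%N)) ->
    (z = 0 -> g = [::]) -> all good g ->
    (t2 <= t1 + probe_time m n TT (2 * kappa) + 2)%N ->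
    traced o FareyStep s2 ((h ++ nseq asks (query_at A B a b)) ++ g) t2
      (fun s' h' t' => exists2 k', (k' < k)%N & farey_inv k' s' h' t').
  move=> eq2 hlen2 snd2 mon2 cell2 gz gz0 good2 le2.
  pose P s' := exists e f g, [/\ same_but farey_arrays s2 s',
    registers s' c d y e f g & neighbours kappa U c d y e f g].
  apply: (@traced_runs o _ _ _ _ (8 * kappa + 13) P).
    have hreg2 : registers s2 a b z c d y.
      by rewrite /registers !eq2 //; case: hreg1.
    apply: (@runs_FareyStep _ _ kappa _ _ _ _ _ _ _ _ _ _ hreg2 hN) => //.
      by rewrite eq2.
    by move=> s' e f g' *; exists e, f, g'.
  move=> s3 t3 [e [f [g' [eq3 hreg3 hN3]]]] le3.
  exists k.-1; first by rewrite ltn_predL.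
  have hlen3 : exists l : nat, s3 5%N 0 0 = l%:Z by rewrite eq3.
  have hin3 : holds_input A B s3.
    by apply: (holds_input_same _ eq3) => //; apply: (holds_input_same _ eq2).
  have outE l : output R s3 l <-> output R s2 l.
    by rewrite /output /out_interval /= !eq3.
  exists c, d, y, e, f, g', it.+1; split=> //.
  - by split=> //; rewrite eq3 // eq2.
  - split.
      have : L * b%:Z * d%:Z <= c * b%:Z.
        apply: (@le_trans _ _ (a * d%:Z)); first by rewrite ler_pM2r.
        by rewrite -subr_ge0 det.
      by rewrite mulrAC ler_pM2r.
    have kE : k.-1%:Z = k%:Z - 1 by clear -k_gt0; lia.
    have kap2 : b%:Z * d%:Z <= (kappa ^ 2)%N%:Z by rewrite expnS expn1 PoszM ler_pM.
    rewrite -(ler_pM2r b0).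
    (* From [z d - y b = 1]: up to the factor [b d kappa^2], the distance [z / b] drops by
       [1 / (b d)]. *)
    have -> : y * (kappa ^ 2)%N%:Z * b = z * (kappa ^ 2)%N%:Z * d - (kappa ^ 2)%N%:Z.
      by rewrite -[X in _ - X]mul1r -zy; ring.
    have : z * (kappa ^ 2)%N%:Z * d <= (k%:Z - 1) * b * d by rewrite ler_pM2r.
    have -> : (k.-1%:Z - 1) * d%:Z * b = (k%:Z - 1) * b%:Z * d%:Z - b%:Z * d%:Z.
      by rewrite kE; ring.
    move: kap2; move: (z * _ * _) ((k%:Z - 1) * _ * _) (b%:Z * d%:Z) => u v w; clear; lia.
  - split.
    + by move=> l /outE; exact: snd2.
    + move=> l hl lt; apply/outE.
      have [lt1|gt1|eq1'] := ltgtP (l * (b%:Z)%:~R) a%:~R.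
      * by apply: mon2; apply/out1; left; apply: cov2.
      * exact: cell2.
      * by apply: mon2; apply/out1; right.
    + by move=> l hl lt; apply/outE; apply: mon2; apply/out1; left; apply: cov3.
  - have sz1 : size (nseq asks (query_at A B a b)) = asks by rewrite size_nseq.
    have := cnt1 z0.
    have tim : (t3 <= t0 + it.+1 * loop_time)%N.
      apply: leq_trans le3 _; rewrite (mulSn it) /loop_time.
      move: let1 le1 le2; rewrite /loop_time.
        move: (probe_time _ _ _ (2 * _)) (probe_time _ _ _ _) (8 * _)%N => v w x.
        move: (it * _)%N => u; clear; lia.
    have [z_gt0|z_eq0] : 0 < z \/ z = 0 by clear -z0; lia.
      have y0 : 0 <= y := neighbour_distance_ge0 b0 d0 zy z_gt0.
      rewrite (gz z_gt0) => cnt; split; split.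
      + by clear -itk k_gt0; lia.
      + exact: tim.
      + by rewrite !size_cat !size_nseq; clear -itlen; case: asks itlen; lia.
      + by rewrite all_cat good1 -(gz z_gt0).
      + by rewrite !size_cat !size_nseq => _; clear -cnt k_gt0; case: asks cnt; lia.
      + by rewrite ltNge y0.
    have y0 : y < 0 := neighbour_distance_lt0 b0 zy z_eq0.
    rewrite (gz0 z_eq0) cats0 => cnt; split; split.
    + by clear -itk k_gt0; lia.
    + exact: tim.
    + by rewrite !size_cat !size_nseq; clear -itlen; case: asks itlen; lia.
    + by [].
    + by rewrite leNgt y0.
    + by rewrite !size_cat !size_nseq => _; right; clear -cnt k_gt0; case: asks cnt; lia.
have [h16] : s1 16%N 0 0 = z by rewrite eq1.
apply: traced_seq; apply: traced_if => /=; rewrite h16 => hz1.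
  have between := between_neighbours b0 d0 det.
  have cellP l l' : Sp l -> a%:~R < l * (b%:Z)%:~R -> l * (d%:Z)%:~R < c%:~R ->
      a%:~R <= l' * (b%:Z)%:~R -> l' * (d%:Z)%:~R <= c%:~R -> Sp l'.
    exact: (spec_farey_cell no_col bA bB b0 d0 det bd).
  have y0 : 0 <= y := neighbour_distance_ge0 b0 d0 zy hz1.
  have Lc : L * d%:Z <= c.
    have : L * b%:Z * d%:Z <= c * b%:Z.
      apply: (@le_trans _ _ (a * d%:Z)); first by rewrite ler_pM2r.
      by rewrite -subr_ge0 det.
    by rewrite mulrAC ler_pM2r.
  have goodq : good (query_at A B (a + c) (b + d)%N).
    apply: good_query => //.
      by rewrite PoszD mulrDr lerD.
    by rewrite PoszD mulrDr lerD // -subr_ge0 -hy.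
  have [[ra1 rb1 rz1] [rc1 rd1 ry1]] := hreg1.
  apply: (traced_conseq (traced_Probe TestP _ _ (k := len1) (q := (b + d)%N) (p := a + c)
     hin1 hlen1 _ _ _ _ goodq)) => //=.
  - by rewrite ra1 rc1.
  - by rewrite rb1 rd1.
  - by case/andP: hbd.
  move=> s2 h2 t2 [[eq2 hlen2] out2 -> le2].
  move: out2; rewrite ra1 rb1 rc1 rd1 => out2.
  have medE : (b + d)%:R = (b%:Z + d%:Z)%:~R :> R by rewrite -PoszD.
  have {}out2 l : output R s2 l <-> output R s1 l \/
      (Sp ((a + c)%:~R / (b%:Z + d%:Z)%:~R) /\
       a%:~R <= l * (b%:Z)%:~R /\ l * (d%:Z)%:~R <= c%:~R).
    by rewrite out2 in_row_segment // -medE.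
  apply: step2 => //.
  - move=> l /out2[/out1[/cov1 //|[]//]|[hm [g1 g2]]].
    by apply: (cellP _ _ hm) => //; case: between.
  - by move=> l ?; apply/out2; left.
  - move=> l hl g1 g2; apply/out2; right; split; last by rewrite !ltW.
    by case: between => m1 m2; apply: (cellP _ _ hl g1 g2); rewrite ltW.
  - by move=> z_eq0; move: hz1; rewrite z_eq0.
  - by rewrite all_nseq goodq orbT.
  - have : (probe_time m n TT (b + d) <= probe_time m n TT (2 * kappa))%N.
      by apply: probe_time_mono; case/andP: hbd.
    by move: le2; clear; move: (probe_time _ _ _ _) (probe_time _ _ _ _) => u v; lia.
apply: (@traced_runs o _ _ _ _ 1 (fun s' => s' = s1)); first exact: runs_skip.
move=> _ t2 -> le2; rewrite -[h ++ nseq _ _]cats0; apply: step2 => //.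
- exists len1. by [].
- by move=> l /out1[/cov1 //|[]//].
(* Here [a / b = U], so the cell lies beyond the search interval and is already covered. *)
- move=> l hl g1 _; apply/out1; left; apply: cov3 => //.
  have z_eq0 : z = 0 by clear -z0 hz1; lia.
  have aE : a = U * b%:Z by apply/esym/eqP; rewrite -subr_eq0 -hz z_eq0.
  by move: g1; rewrite aE rmorphM /= ltr_pM2r.
- by move=> z_gt0; move: hz1; rewrite ltNge; clear -z_gt0; lia.
- by move: le2; clear; lia.
Qed.
End Invariant.

(** [k0 - 1] bounds the gaps and [k0] the points, with two queries for each point but the last. For
    [U < L] the hypothesis allows [k0 = 0]. *)
Lemma traced_FareyLoop (k0 : nat) s h t : (0 < kappa)%N ->
  holds_input A B s -> (exists l : nat, s 5%N 0 0 = l%:Z) -> s 12%N 0 0 = kappa%:Z ->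
  registers s L 1 (U - L) (L * kappa%:Z + 1) kappa%:Z (U * kappa%:Z - (L * kappa%:Z + 1)) ->
  (U - L) * (kappa ^ 2)%N%:Z <= k0%:Z - 1 -> covered s L 1 -> all good h ->
  traced o FareyLoop s h t (fun s' h' t' =>
    [/\ forall l, output R s' l <-> Sp l, all good h',
        exists2 it, (size h + it * asks <= size h')%N &
          (it <= k0)%N /\ (t' <= t + it * loop_time + 1)%N &
        h' = h \/ (size h' + asks <= size h + 2 * k0 * asks)%N]).
Proof.
move=> kap0 hin hlen hk hreg hk0 hcov hgood.
apply: (@traced_while _ (farey_inv h t k0) _ _ _ k0).
- by move=> k s1 h1 t1 hI /= z0; apply: farey_invariant_step.
- exists L, 1, (U - L), (L * kappa%:Z + 1), kappa%:Z, (U * kappa%:Z - (L * kappa%:Z + 1)), 0%N.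
  rewrite !mulr1; split=> //.
  + split=> //; split; split=> //; [lia|lia|ring].
  + by split; split; rewrite ?mul0n ?addn0 //; left.
move=> k s1 h1 t1 [a [b [z [c [d [y [it [_ [[[_ _ rz] _] [[b0 _ _] [_ _ _ hz _]]] _]]]]]]]].
move=> [cov1 cov2 cov3] [[itk let1 itlen hg] [_ cnt]] /=; rewrite rz => z_lt0.
split=> //.
- move=> l; split; first exact: cov1.
  move=> hl; have [le|gt] := leP l U%:~R; last exact: cov3.
  apply: cov2 => //; have b0R : (0 : R) < b%:~R by rewrite ltr0z.
  apply: (@le_lt_trans _ _ (U%:~R * b%:~R)); first by rewrite ler_pM2r.
  by rewrite -rmorphM ltr_int /=; move: z_lt0; rewrite hz; move: (U * b) => u; lia.
- exists it => //; split; first by lia.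
  by rewrite addn1 ltnS.
- case: (cnt z_lt0) => [|le]; [by left|right].
  by case: asks le {itlen}; lia.
Qed.
End FareyLoop.

(** * Running maxima and the search bounds *)

Definition Raise (acc : nat) (e : aexp) : cmd := If (V acc) e (Assign acc e) Skip.

Lemma runs_Raise o acc e s T (Q : store -> Prop) : (2 <= T)%N ->
  (forall s', same_but [:: acc] s s' ->
     s' acc 0 0 = Num.max (s acc 0 0) (aeval s e) -> Q s') ->
  runs o (Raise acc e) s T Q.
Proof.
move=> hT hQ; apply: runs_if => [|/= le|/= lt]; first lia.
  apply: runs_set; [lia|apply: hQ; first by apply: same_but_upd; rewrite ?inE].
  by rewrite upd_same max_r.
apply: runs_skip; [lia|apply: hQ => //].
by rewrite max_l // ltW.
Qed.

Section MaxUpto.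
Variables (N : nat) (f : 'I_N -> option int) (acc0 : int).

Definition is_max (x : int) : Prop :=
  (forall k a, f k = Some a -> a <= x) /\ exists k, f k = Some x.

(** State of a running maximum started at [acc0]; when this start lies below all values, the final
    state is the true maximum, and absent entries can simply be skipped. *)
Definition max_upto (l : nat) (x : int) : Prop :=
  [/\ acc0 <= x, forall (k : 'I_N) a, (k < l)%N -> f k = Some a -> a <= x &
      x = acc0 \/ exists k, f k = Some x].

Lemma max_upto0 : max_upto 0 acc0.
Proof. by split=> //; left. Qed.

Lemma max_upto_None l x (k : 'I_N) : k = l :> nat -> f k = None ->
  max_upto l x -> max_upto l.+1 x.
Proof.
move=> kl fk [h1 h2 h3]; split=> // k' a; rewrite ltnS leq_eqVlt => /orP[/eqP e|]; last exact: h2.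
have -> : k' = k by apply: val_inj; rewrite /= e kl.
by rewrite fk.
Qed.

Lemma max_upto_Some l x (k : 'I_N) b : k = l :> nat -> f k = Some b ->
  max_upto l x -> max_upto l.+1 (Num.max x b).
Proof.
move=> kl fk [h1 h2 h3]; split.
- by rewrite le_max h1.
- move=> k' a; rewrite ltnS leq_eqVlt => /orP[/eqP e|lt].
    have -> : k' = k by apply: val_inj; rewrite /= e kl.
    by rewrite fk => -[<-]; rewrite le_max lexx orbT.
  by move=> /(h2 _ _ lt) le; rewrite le_max le.
- rewrite maxEle; case: ifP => _; last exact: h3.
  by right; exists k.
Qed.

Lemma max_upto_is_max x : max_upto N x -> (exists k, f k != None) ->
  (forall k a, f k = Some a -> acc0 <= a) -> is_max x.
Proof.
move=> [h1 h2 h3] [k fk] hacc; split=> [k' a|]; first exact: h2.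
case: h3 => // xE; exists k; case fkE: (f k) fk => [a|] // _.
congr Some; apply/eqP; rewrite eq_le (h2 k a) // xE.
exact: hacc fkE.
Qed.
End MaxUpto.

Lemma ereal_of_lower (R : realType) (u : \bar R) (x : R) :
  (forall v : R, (v%:E <= u)%E <-> v <= x) -> u = x%:E.
Proof.
move=> h; have hx : (x%:E <= u)%E by apply/h.
case: u h hx => [r| |] // h hx.
  congr (_%:E); apply/eqP; rewrite eq_le -!lee_fin hx andbT lee_fin.
  by apply/h; rewrite lee_fin.
have : x + 1 <= x by apply/h; rewrite leey.
by rewrite gerDl ler10.
Qed.

Section MaxRes.
Variables (R : realType) (m n : nat) (A B : intmx m n).

(** [r] is the vector [A 0], and [- g j = min_i (r i - B i j)] is [(B^# A 0)_j]. Writing the minimum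
    as a maximum leaves a single kind of accumulator to program. *)
Lemma max_resE (r : 'I_m -> int) (g : 'I_n -> int) (u : int) :
  (forall i, is_max (A i) (r i)) ->
  (forall j, is_max (fun i => omap (fun b => b - r i) (B i j)) (g j)) ->
  is_max (fun j => Some (- g j)) u ->
  max_res (Rmx R A) (Rmx R B) = (u%:~R)%:E.
Proof.
move=> hr hg [hu1 [ju [hu2]]]; apply: ereal_of_lower => v.
have h0 : @Rmax_vec R n (fun=> 0%E) by [].
have resE j : (v%:E <= mpres (Rmx R B) (mpmul (Rmx R A) (fun=> 0%E)) j)%E <->
    v <= (- g j)%:~R.
  apply: iff_trans (le_mpres _ _ _ _ h0) _; case: (hg j) => g1 [ig].
  case Bg: (B ig j) => [b|] //= [gE]; split.
    case/(_ _ _ Bg) => k [a [Ak]]; rewrite adde0 lee_fin.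
    have [r1 _] := hr ig; have := r1 _ _ Ak; rewrite -(ler_int R) -gE rmorphN rmorphB /=; lra.
  move=> le i c Bc; have [_ [k rk]] := hr i; exists k, (r i); split=> //.
  rewrite adde0 lee_fin; have := g1 i (c - r i); rewrite Bc /= => /(_ erefl).
  by move: le; rewrite -(ler_int R) rmorphN rmorphB /=; lra.
split.
  case/bigmax_geP => [|[j _ /resE le]]; first by rewrite leeNy_eq.
  by apply: le_trans le _; rewrite ler_int; exact: hu1.
by rewrite -hu2 => le; apply/bigmax_geP; right; exists ju => //; apply/resE.
Qed.

Lemma exists_is_max N (f : 'I_N -> option int) : (exists k, f k != None) ->
  exists x, is_max f x.
Proof.
case=> k0 fk0; case: (@arg_maxP _ _ _ k0 (fun k => f k != None) (fun k => odflt 0 (f k)) fk0).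
move=> k; case fk: (f k) => [x|] // _ hmax; exists x; split; last by exists k.
by move=> k' a fk'; have : odflt 0 (f k') <= x := hmax k' _; rewrite fk' /=; apply.
Qed.

Lemma is_max_uniq N (f : 'I_N -> option int) x y : is_max f x -> is_max f y -> x = y.
Proof.
move=> [h1 [k hk]] [g1 [l gl]]; apply/eqP; rewrite eq_le.
by rewrite (g1 _ _ hk) (h1 _ _ gl).
Qed.
End MaxRes.

(* [Res f v f' v'] computes max_j (D^# C 0)_j for the matrix C stored in
   (f, v) and D stored in (f', v'); cell 26 bounds the entries. *)
Definition RowMax (f v : nat) : cmd :=
  Seq (Assign 41 (Defs.Sub (Cst 0) (V 26)))
      (For 24 ncols (If (Cst 1) (Get f (V 22) (V 24)) (Raise 41 (Get v (V 22) (V 24))) Skip)).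

(** With [W] in cell 26, the start [- 2 W] lies below every difference of an entry and a row
    maximum. *)
Definition ColMax (f v f' v' : nat) : cmd :=
  Seq (Assign 40 (Defs.Sub (Defs.Sub (Cst 0) (V 26)) (V 26)))
      (For 22 nrows (If (Cst 1) (Get f' (V 22) (V 23))
         (Seq (RowMax f v) (Raise 40 (Defs.Sub (Get v' (V 22) (V 23)) (V 41)))) Skip)).

Definition Res (f v f' v' : nat) : cmd :=
  Seq (Assign 39 (Defs.Sub (Defs.Sub (Cst 0) (V 26)) (V 26)))
      (For 23 ncols (Seq (ColMax f v f' v') (Raise 39 (Defs.Sub (Cst 0) (V 40))))).

Section RunRes.
Variables (o : oracle) (m n : nat) (A B : intmx m n) (f v f' v' : nat) (W : nat).
Hypotheses (f5 : (f < 5)%N) (v5 : (v < 5)%N) (f'5 : (f' < 5)%N) (v'5 : (v' < 5)%N).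
Variable s0 : store.
Hypotheses (sA : stored s0 f v A) (sB : stored s0 f' v' B).
Hypotheses (bA : entries_bounded W A) (bB : entries_bounded W B).
Hypotheses (rowA : no_infty_row A) (colB : no_infty_col B).
Hypotheses (hm : s0 0%N 0 0 = m%:Z) (hn : s0 0%N 0 1 = n%:Z) (hW : s0 26%N 0 0 = W%:Z).

Let res_arrays : seq nat := [:: 22; 23; 24; 39; 40; 41]%N.

Lemma res_frame (l : seq nat) s (a : nat) : all (fun a => a \in res_arrays) l ->
  (a < 5)%N || (a == 26)%N -> same_but l s0 s -> s a = s0 a.
Proof.
move=> /allP hl ha h; apply: h; apply: contraL ha => /hl.
by rewrite !inE => h; do ?[case/orP: h => [/eqP->//|h]]; rewrite (eqP h).
Qed.

Lemma runs_RowMax s (i : 'I_m) r T (Q : store -> Prop) :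
  same_but res_arrays s0 s -> s 22%N 0 0 = (i : nat)%:Z -> is_max (A i) r ->
  (n * 5 + 3 <= T)%N ->
  (forall s', same_but [:: 24; 41]%N s s' -> s' 41%N 0 0 = r -> Q s') ->
  runs o (RowMax f v) s T Q.
Proof.
move=> hs hi hr hT hQ.
have sE a : (a < 5)%N || (a == 26)%N -> s a = s0 a.
  by move=> ha; apply: (@res_frame res_arrays); rewrite ?all_mem //; apply/allP.
apply: (@runs_seq_upd _ _ _ _ _ _ 0 0 (- W%:Z)) => //; first lia.
  by rewrite /= sE // hW sub0r.
apply: (@runs_for _ (fun k s' => same_but [:: 24; 41]%N s s' /\
   max_upto (A i) (- W%:Z) k (s' 41%N 0 0)) _ _ _ _ _ n 3).
- by move=> k s' x [h1 h2]; split; [apply: same_but_upd|rewrite upd_other].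
- by move=> k s' [h1 _] _; rewrite /= h1 // sE.
- move=> k s' lt [h1 h2] h24; pose j := Ordinal lt.
  have fE : aeval s' (Get f (V 22) (V 24)) = (A i j != None : nat)%:Z.
    rewrite /= h24 !h1 // ?hi ?sE ?f5 //; last by rewrite !inE; lia.
    by have [-> _] := sA i j.
  have vE a : A i j = Some a -> aeval s' (Get v (V 22) (V 24)) = a.
    rewrite /= h24 !h1 // ?hi ?sE ?v5 //; last by rewrite !inE; lia.
    by have [_ h] := sA i j; apply: h.
  apply: runs_if => //; rewrite fE => le.
    case Aij: (A i j) le => [a|] //= _.
    apply: runs_Raise => // s'' h3 h4; rewrite h3 // h24; split=> //; split.
      by apply: same_but_trans h1 _; apply: same_but_sub h3 => ?; rewrite !inE => /eqP->.
    by rewrite h4 (vE _ Aij); apply: (max_upto_Some (k := j)).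
  apply: runs_skip => //; split=> //; split=> //.
  by apply: (max_upto_None (k := j)) => //; case: (A i j) le.
- by split; [apply: same_but_upd|rewrite upd_same; exact: max_upto0].
- lia.
move=> s' [h1 h2]; apply: hQ => //; apply: is_max_uniq hr.
apply: max_upto_is_max h2 _ _; first by case/existsP: (forallP rowA i) => j; exists j.
by move=> k a Ak; have := bounded_entry bA Ak; lia.
Qed.

Variable r : 'I_m -> int.
Hypothesis hr : forall i, is_max (A i) (r i).

Lemma row_max_bounded i : (`|r i| <= W)%N.
Proof. by have [_ [k /(bounded_entry bA)]] := hr i. Qed.

Lemma runs_ColMax s (j : 'I_n) g T (Q : store -> Prop) :
  same_but res_arrays s0 s -> s 23%N 0 0 = (j : nat)%:Z ->
  is_max (fun i => omap (fun b => b - r i) (B i j)) g ->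
  (m * (n * 5 + 8) + 3 <= T)%N ->
  (forall s', same_but [:: 22; 24; 40; 41]%N s s' -> s' 40%N 0 0 = g -> Q s') ->
  runs o (ColMax f v f' v') s T Q.
Proof.
move=> hs hj hg hT hQ.
have sE a : (a < 5)%N || (a == 26)%N -> s a = s0 a.
  by move=> ha; apply: (@res_frame res_arrays); rewrite ?all_mem //; apply/allP.
apply: (@runs_seq_upd _ _ _ _ _ _ 0 0 (- W%:Z - W%:Z)) => //; first lia.
  by rewrite /= sE // hW sub0r.
apply: (@runs_for _ (fun k s' => same_but [:: 22; 24; 40; 41]%N s s' /\
   max_upto (fun i => omap (fun b => b - r i) (B i j)) (- W%:Z - W%:Z) k (s' 40%N 0 0))
   _ _ _ _ _ m (n * 5 + 6)).
- by move=> k s' x [h1 h2]; split; [apply: same_but_upd|rewrite upd_other].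
- by move=> k s' [h1 _] _; rewrite /= h1 // sE.
- move=> k s' lt [h1 h2] h22; pose i := Ordinal lt.
  have fE : aeval s' (Get f' (V 22) (V 23)) = (B i j != None : nat)%:Z.
    rewrite /= h22 !h1 // ?hj ?sE ?f'5 //; last by rewrite !inE; lia.
    by have [-> _] := sB i j.
  have sub1 : same_but res_arrays s0 s'.
    apply: same_but_trans hs _; apply: same_but_sub h1 => ?.
    by rewrite !inE => /or4P[] /eqP->.
  apply: runs_if; [lia| |]; rewrite fE => le.
    case Bij: (B i j) le => [b|] //= _.
    apply: (@runs_seq _ _ _ _ (n * 5 + 3)); first lia.
    apply: (runs_RowMax sub1 (i := i) h22 (hr i)) => // s2 h3 h41.
    have vE : aeval s2 (Defs.Sub (Get v' (V 22) (V 23)) (V 41)) = b - r i.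
      rewrite /= h41 !h3 // ?h22 ?h1 // ?hj ?sE ?v'5 //; try by rewrite !inE; lia.
      by have [_ /(_ _ Bij) ->] := sB i j.
    apply: runs_Raise => [|s3 h4 h40]; first lia.
    rewrite h4 // h3 // h22; split=> //; split.
      apply: same_but_trans h1 _; apply: same_but_trans (same_but_sub _ h3) (same_but_sub _ h4) => ?.
        by rewrite !inE => /orP[] /eqP->.
      by rewrite !inE => /eqP->.
    by rewrite h40 vE h3 //; apply: (max_upto_Some (k := i)) => //; rewrite Bij.
  apply: runs_skip; first lia.
  split=> //; split=> //.
  by apply: (max_upto_None (k := i)) => //; case: (B i j) le.
- by split; [apply: same_but_upd|rewrite upd_same; exact: max_upto0].
- lia.
move=> s' [h1 h2]; apply: hQ => //; apply: is_max_uniq hg.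
apply: max_upto_is_max h2 _ _.
  by case/existsP: (forallP colB j) => i Bi; exists i; case: (B i j) Bi.
move=> k a; case Bk: (B k j) => [b|] //= [<-].
by have := bounded_entry bB Bk; have := row_max_bounded k; lia.
Qed.

Lemma runs_Res g u T (Q : store -> Prop) :
  (forall j, is_max (fun i => omap (fun b => b - r i) (B i j)) (g j)) ->
  is_max (fun j => Some (- g j)) u -> (n * (m * (n * 5 + 8) + 8) + 3 <= T)%N ->
  (forall s', same_but res_arrays s0 s' -> s' 39%N 0 0 = u -> Q s') ->
  runs o (Res f v f' v') s0 T Q.
Proof.
move=> hg hu hT hQ.
apply: (@runs_seq_upd _ _ _ _ _ _ 0 0 (- W%:Z - W%:Z)) => //; first lia.
  by rewrite /= hW sub0r.
apply: (@runs_for _ (fun k s' => same_but res_arrays s0 s' /\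
   max_upto (fun j => Some (- g j)) (- W%:Z - W%:Z) k (s' 39%N 0 0))
   _ _ _ _ _ n (m * (n * 5 + 8) + 5)).
- by move=> k s' x [h1 h2]; split; [apply: same_but_upd|rewrite upd_other].
- by move=> k s' [h1 _] _; rewrite /= h1.
- move=> k s' lt [h1 h2] h23; pose j := Ordinal lt.
  apply: (@runs_seq _ _ _ _ (m * (n * 5 + 8) + 3)); first lia.
  apply: (runs_ColMax h1 (j := j) h23 (hg j)) => // s2 h3 h40.
  apply: runs_Raise => [|s3 h4 h39]; first lia.
  rewrite h4 // h3 // h23; split=> //; split.
    apply: same_but_trans h1 _; apply: same_but_trans (same_but_sub _ h3) (same_but_sub _ h4) => ?.
      by rewrite !inE => /or4P[] /eqP->.
    by rewrite !inE => /eqP->.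
  rewrite h39 /= h40 sub0r h3 //; exact: (max_upto_Some (k := j)).
- by split; [apply: same_but_upd|rewrite upd_same; exact: max_upto0].
- by move: hT; move: (m * _)%N => w; lia.
move=> s' [h1 h2]; apply: hQ => //; apply: (is_max_uniq _ hu).
apply: max_upto_is_max h2 _ _; first by case: hu => _ [j _]; exists j.
move=> k a [<-]; have [_ [i]] := hg k; case Bi: (B i k) => [b|] //= [<-].
by have := bounded_entry bB Bi; have := row_max_bounded i; lia.
Qed.
End RunRes.

Definition Kappa : cmd :=
  Seq (Assign 12 (Add nrows nrows)) (If ncols (V 12) (Assign 12 ncols) Skip).

(** Absent entries have the value 0 in the input arrays, so the flags need not be read. Starting at
    1 yields the least positive bound. *)
Definition MaxAbs : cmd :=
  Seq (Assign 26 (Cst 1))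
  (For 22 nrows (For 23 ncols
    (Seq (Raise 26 (At 2))
    (Seq (Raise 26 (Defs.Sub (Cst 0) (At 2)))
    (Seq (Raise 26 (At 4))
         (Raise 26 (Defs.Sub (Cst 0) (At 4)))))))).

(* The first two Farey fractions from [L] on are [L / 1] and [(L * kappa + 1) / kappa]. *)
Definition InitFarey : cmd :=
  Seq (Assign 14 (V 13))
  (Seq (Assign 15 (Cst 1))
  (Seq (Assign 16 (Defs.Sub (V 33) (V 13)))
  (Seq (MulAdd (Cst 1) (V 12) (V 13))
  (Seq (Assign 17 (V 25))
  (Seq (Assign 18 (V 12))
  (Seq (MulAdd (Defs.Sub (Cst 0) (V 17)) (V 12) (V 33))
       (Assign 19 (V 25)))))))).

(** The interval outside which [spec_ray_le] and [spec_ray_ge] show membership to be constant. *)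
Definition WideBounds : cmd :=
  Seq (MulAdd (Cst 0) (V 12) (Add (V 26) (V 26)))
  (Seq (Assign 33 (V 25)) (Assign 13 (Defs.Sub (Cst 0) (V 25)))).

(** [spec_le_max_res] gives the upper end and, through [spec_swap], the lower one. *)
Definition TightBounds : cmd :=
  Seq (Res 3 4 1 2)
  (Seq (Assign 13 (Defs.Sub (Cst 0) (V 39)))
  (Seq (Res 1 2 3 4) (Assign 33 (V 39)))).

Definition Setup (bounds : cmd) : cmd :=
  Seq Kappa (Seq MaxAbs (Seq bounds InitFarey)).

Definition setup_arrays : seq nat :=
  [:: 12; 13; 14; 15; 16; 17; 18; 19; 22; 23; 24; 25; 26; 33; 39; 40; 41]%N.

Section Setups.
Variables (o : oracle) (m n : nat) (A B : intmx m n).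

Local Notation kappa := (minn (2 * m) n).

Lemma runs_Kappa s T (Q : store -> Prop) : holds_input A B s -> (3 <= T)%N ->
  (forall s', same_but [:: 12]%N s s' -> s' 12%N 0 0 = kappa%:Z -> Q s') ->
  runs o Kappa s T Q.
Proof.
move=> hin hT hQ; have [d1 d2] := input_dims hin.
apply: (@runs_seq_upd _ _ _ _ _ _ 0 0 (2 * m)%N%:Z) => //; first lia.
  by rewrite /= d1 mul2n -addnn.
set s1 := upd _ 12 _ _ _.
have e1 : aeval s1 ncols = n%:Z by rewrite -d2.
have e2 : aeval s1 (V 12) = (2 * m)%N%:Z by rewrite /s1 /= upd_same.
apply: runs_if; rewrite ?e1 ?e2; first lia.
  move=> le; apply: runs_set; first lia.
  apply: hQ; first by do 2 apply: same_but_upd => //.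
  by rewrite upd_same e1; lia.
move=> lt; apply: runs_skip; first lia.
apply: hQ; first by apply: same_but_upd.
by rewrite /s1 upd_same; lia.
Qed.

Lemma runs_MaxAbs s T (Q : store -> Prop) : holds_input A B s ->
  (m * (n * 10 + 4) + 3 <= T)%N ->
  (forall s' (M1 : nat), same_but [:: 22; 23; 26]%N s s' -> s' 26%N 0 0 = M1%:Z ->
    (0 < M1)%N -> entries_bounded M1 A -> entries_bounded M1 B ->
    (forall M, (0 < M)%N -> entries_bounded M A -> entries_bounded M B -> (M1 <= M)%N) ->
    Q s') ->
  runs o MaxAbs s T Q.
Proof.
move=> hin hT hQ; have [d1 d2] := input_dims hin.
apply: (@runs_seq_upd _ _ _ _ _ _ 0 0 1) => //; first lia.
pose F s' := same_but [:: 22; 23; 26]%N s s' /\ exists M1 : nat,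
  [/\ s' 26%N 0 0 = M1%:Z, (0 < M1)%N & forall M, (0 < M)%N ->
    entries_bounded M A -> entries_bounded M B -> (M1 <= M)%N].
pose P (i : 'I_m) (j : 'I_n) (s' : store) :=
  (`|odflt 0%R (A i j)|%N%:Z <= s' 26%N 0 0) && (`|odflt 0%R (B i j)|%N%:Z <= s' 26%N 0 0).
apply: (@runs_for2 _ _ _ P F _ _ _ _ _ _ _ 8) => //.
- by move=> s1 x [h1 h2]; split; (split; [apply: same_but_upd|rewrite upd_other]).
- by move=> s1 [h1 _]; split; rewrite /= h1.
- move=> i j s1 [h1 [M1 [h26 M1_gt0 hmin]]] hi hj.
  have [_ a2] := input_A i j hin; have [_ b2] := input_B i j hin.
  apply: (@runs_seq _ _ _ _ 2) => //; apply: runs_Raise => // s2 g2 e2.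
  apply: (@runs_seq _ _ _ _ 2) => //; apply: runs_Raise => // s3 g3 e3.
  apply: (@runs_seq _ _ _ _ 2) => //; apply: runs_Raise => // s4 g4 e4.
  apply: runs_Raise => // s5 g5 e5.
  move: e5; rewrite e4 e3 e2 /= !(g4, g3, g2) // hi hj !(h1 2%N, h1 4%N) // a2 b2 h26 !sub0r => e5.
  have k5 : same_but [:: 26]%N s1 s5.
    by apply: same_but_trans g5; apply: same_but_trans g4; apply: same_but_trans g3.
  have e5' : s5 26%N 0 0 =
      (maxn (maxn M1 `|odflt 0%R (A i j)|) `|odflt 0%R (B i j)|)%N%:Z.
    by rewrite e5; move: (odflt _ _) (odflt _ _) => a b; clear; lia.
  split; rewrite ?k5 //.
  + split.
      apply: same_but_trans h1 _; apply: same_but_sub k5 => ?.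
      by rewrite !inE => /eqP->.
    eexists; split; first exact: e5'.
      by rewrite !leq_max M1_gt0.
    move=> M M_gt0 hA hB; rewrite !geq_max hmin //=.
    by case Aij: (A i j) => [a|] /=; case Bij: (B i j) => [b|] /=;
      rewrite ?(bounded_entry hA Aij) ?(bounded_entry hB Bij).
  + by rewrite /P e5'; lia.
  + have mono : s1 26%N 0 0 <= s5 26%N 0 0 by rewrite e5' h26 lez_nat !leq_max leqnn.
    by move=> i' j' _ /andP[p1 p2]; rewrite /P !(le_trans _ mono).
- split; first by apply: same_but_upd.
  by exists 1%N; rewrite upd_same; split.
- lia.
move=> s1 [h1 [M1 [h26 M1_gt0 hmin]]] hP; apply: (hQ s1 M1) => //.
  apply/forallP => i; apply/forallP => j; have := hP i j; rewrite /P h26.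
  by case: (A i j) => [a|] //= /andP[].
apply/forallP => i; apply/forallP => j; have := hP i j; rewrite /P h26.
by case: (B i j) => [a|] //= /andP[].
Qed.

Definition initialised (s : store) (L U : int) : Prop :=
  [/\ s 12%N 0 0 = kappa%:Z, s 13%N 0 0 = L, s 33%N 0 0 = U &
      registers s L 1 (U - L) (L * kappa%:Z + 1) kappa%:Z (U * kappa%:Z - (L * kappa%:Z + 1))].

Lemma runs_InitFarey s L U T (Q : store -> Prop) :
  s 12%N 0 0 = kappa%:Z -> s 13%N 0 0 = L -> s 33%N 0 0 = U -> (6 * kappa + 12 <= T)%N ->
  (forall s', same_but [:: 14; 15; 16; 17; 18; 19; 24; 25]%N s s' ->
     initialised s' L U -> Q s') ->
  runs o InitFarey s T Q.
Proof.
move=> hk hL hU hT hQ.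
apply: (@runs_seq_upd _ _ _ _ _ _ 0 0 L) => //; first lia.
apply: (@runs_seq_upd _ _ _ _ _ _ 0 0 1) => //; first lia.
apply: (@runs_seq_upd _ _ _ _ _ _ 0 0 (U - L)) => //; first lia.
  by rewrite /= /upd /= hL hU.
apply: (@runs_seq _ _ _ _ (kappa * 3 + 3)); first lia.
set s1 := upd _ 16 _ _ _.
apply: (@runs_MulAdd _ _ _ _ _ kappa) => // [|s2 h2]; first lia.
rewrite /s1 /= /upd /= hL => e2.
apply: (@runs_seq_upd _ _ _ _ _ _ 0 0 (L * kappa%:Z + 1)) => //; first lia.
  by rewrite /= e2; ring.
apply: (@runs_seq_upd _ _ _ _ _ _ 0 0 kappa%:Z) => //; first lia.
  by rewrite /= /upd /= h2.
apply: (@runs_seq _ _ _ _ (kappa * 3 + 3)); first lia.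
set s3 := upd _ 18 _ _ _.
have e3 a : (a \notin [:: 17; 18; 24; 25]%N) -> s3 a = s1 a.
  rewrite !inE !negb_or => /and4P[? ? ? ?].
  by rewrite /s3 !upd_other // h2 // !inE negb_or; apply/andP.
apply: (@runs_MulAdd _ _ _ _ _ kappa) => // [| |s4 h4].
- by rewrite /= e3.
- lia.
have -> : aeval s3 (V 33) = U by rewrite /= e3.
have -> : aeval s3 (Defs.Sub (Cst 0) (V 17)) = - (L * kappa%:Z + 1).
  by rewrite /= /s3 /upd /= sub0r.
move=> e4; apply: (@runs_upd _ _ _ _ _ _ 0 0 (U * kappa%:Z - (L * kappa%:Z + 1))) => //.
- lia.
- by rewrite /= e4; ring.
set s5 := upd _ 19 _ _ _.
have e5 a : (a \notin [:: 19; 17; 18; 24; 25]%N) -> s5 a = s1 a.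
  rewrite in_cons negb_or => /andP[ha ha'].
  by rewrite /s5 upd_other // h4 ?e3 //; apply: contra ha'; rewrite !inE => /orP[]->; rewrite ?orbT.
apply: hQ.
  move=> a ha; rewrite e5; last first.
    by apply: contra ha; rewrite !inE => h; do ?[case/orP: h => [/eqP->//|h]]; rewrite (eqP h).
  by rewrite /s1 !upd_other //; apply: contraNneq ha => ->.
have [e17 e18] : s4 17%N 0 0 = L * kappa%:Z + 1 /\ s4 18%N 0 0 = kappa%:Z.
  by rewrite !h4 // /s3 /upd /=.
split; rewrite ?e5 //; split; split; rewrite ?[s5 14%N]e5 ?[s5 15%N]e5 ?[s5 16%N]e5 //.
Qed.

Definition setup_time : nat := (m * (n * 10 + 4) + 6 * kappa + 20)%N.

Lemma runs_Setup s bounds Tb T (Q : store -> Prop) : holds_input A B s ->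
  (setup_time + Tb <= T)%N ->
  (forall s' M1 T', same_but [:: 12; 22; 23; 26]%N s s' ->
     s' 12%N 0 0 = kappa%:Z -> s' 26%N 0 0 = M1%:Z ->
    (0 < M1)%N -> entries_bounded M1 A -> entries_bounded M1 B ->
    (forall M, (0 < M)%N -> entries_bounded M A -> entries_bounded M B -> (M1 <= M)%N) ->
    (Tb + 6 * kappa + 12 <= T')%N -> runs o (Seq bounds InitFarey) s' T' Q) ->
  runs o (Setup bounds) s T Q.
Proof.
rewrite /setup_time => hin hT hQ.
apply: (@runs_seq _ _ _ _ 3); first lia.
apply: (runs_Kappa hin) => // s1 h1 e1.
have hin1 : holds_input A B s1 by apply: (holds_input_same _ h1).
apply: (@runs_seq _ _ _ _ (m * (n * 10 + 4) + 3)); first lia.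
apply: (runs_MaxAbs hin1) => // s2 M1 h2 e2 M1_gt0 bA bB hmin.
apply: (hQ s2 M1) => //; last lia.
  apply: same_but_trans (same_but_sub _ h1) (same_but_sub _ h2) => a.
    by rewrite !inE => /eqP->.
  by rewrite !inE => /or3P[] /eqP->.
by rewrite h2.
Qed.

Definition wide_post (s s' : store) : Prop :=
  exists M1 : nat, [/\ (0 < M1)%N, entries_bounded M1 A, entries_bounded M1 B,
    (forall M, (0 < M)%N -> entries_bounded M A -> entries_bounded M B -> (M1 <= M)%N) &
    same_but setup_arrays s s' /\
    initialised s' (- (2 * M1 * kappa)%N%:Z) (2 * M1 * kappa)%N%:Z].

Lemma runs_WideSetup s T : holds_input A B s ->
  (setup_time + 3 * kappa + 5 <= T)%N -> runs o (Setup WideBounds) s T (wide_post s).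
Proof.
move=> hin hT; apply: (runs_Setup (Tb := (3 * kappa + 5)%N) hin); first lia.
move=> s1 M1 T' h1 hk h26 M1_gt0 bA bB hmin hT'.
apply: (@runs_seq _ _ _ _ (3 * kappa + 5)); first lia.
apply: (@runs_seq _ _ _ _ (3 * kappa + 3)); first lia.
apply: (@runs_MulAdd _ _ _ _ _ kappa) => // [|s2 h2]; first lia.
rewrite /= h26 => e2.
apply: (@runs_seq_upd _ _ _ _ _ _ 0 0 (2 * M1 * kappa)%N%:Z) => //; first lia.
  by rewrite /= e2; lia.
apply: (@runs_upd _ _ _ _ _ _ 0 0 (- (2 * M1 * kappa)%N%:Z)) => //; first lia.
  by rewrite /= /upd /= e2; lia.
set s3 := upd _ 13 _ _ _.
have h3 : same_but [:: 13; 33; 24; 25]%N s1 s3.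
  do 2 (apply: same_but_upd => //); apply: same_but_sub h2 => a.
  by rewrite !inE => /orP[]->; rewrite !orbT.
apply: (runs_InitFarey (L := - (2 * M1 * kappa)%N%:Z) (U := (2 * M1 * kappa)%N%:Z)) => //.
- by rewrite h3.
- lia.
move=> s4 h4 hi; exists M1; split=> //; split=> //.
apply: same_but_trans (same_but_sub _ h1) _.
  by move=> a; rewrite !inE => /or4P[] /eqP->.
apply: same_but_trans (same_but_sub _ h3) (same_but_sub _ h4) => a; rewrite !inE.
  by move=> /or4P[] /eqP->.
by move=> h; do ?[case/orP: h => [/eqP->//|h]]; rewrite (eqP h).
Qed.

Lemma stored_input s : holds_input A B s -> stored s 1 2 A /\ stored s 3 4 B.
Proof.
move=> hin; split=> i j.
  by have [-> ->] := input_A i j hin; split=> // z ->.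
by have [-> ->] := input_B i j hin; split=> // z ->.
Qed.

Lemma max_res_data (R : realType) (C D : intmx m n) : (0 < n)%N ->
  no_infty_row C -> no_infty_col D ->
  exists r g u, [/\ forall i, is_max (C i) (r i),
    forall j, is_max (fun i => omap (fun b => b - r i) (D i j)) (g j),
    is_max (fun j => Some (- g j)) u &
    max_res (Rmx R C) (Rmx R D) = (u%:~R)%:E].
Proof.
move=> n_gt0 rowC colD.
have [r hr] : exists r : 'I_m -> int, forall i, is_max (C i) (r i).
  apply: (@fin_all_exists _ (fun=> int) (fun i x => is_max (C i) x)) => i.
  by apply: exists_is_max; apply/existsP; exact: (forallP rowC).
have [g hg] : exists g : 'I_n -> int,
    forall j, is_max (fun i => omap (fun b => b - r i) (D i j)) (g j).
  apply: (@fin_all_exists _ (fun=> int)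
    (fun j x => is_max (fun i => omap (fun b => b - r i) (D i j)) x)) => j.
  apply: exists_is_max; case/existsP: (forallP colD j) => i Di; exists i.
  by case: (D i j) Di.
have [u hu] : exists u, is_max (fun j : 'I_n => Some (- g j)) u.
  by apply: exists_is_max; exists (Ordinal n_gt0).
by exists r, g, u; split=> //; exact: max_resE hr hg hu.
Qed.

Definition tight_post (R : realType) (s s' : store) : Prop :=
  exists L U : int, [/\ max_res (Rmx R A) (Rmx R B) = (U%:~R)%:E,
    max_res (Rmx R B) (Rmx R A) = ((- L)%:~R)%:E,
    same_but setup_arrays s s' & initialised s' L U].

Lemma runs_TightSetup (R : realType) s T : (0 < n)%N ->
  no_infty_row A -> no_infty_row B -> no_infty_col A -> no_infty_col B ->
  holds_input A B s ->
  (setup_time + 2 * (n * (m * (n * 5 + 8) + 8)) + 8 <= T)%N ->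
  runs o (Setup TightBounds) s T (tight_post R s).
Proof.
move=> n_gt0 rowA rowB colA colB hin hT.
set TR := (n * (m * (n * 5 + 8) + 8))%N in hT.
apply: (runs_Setup (Tb := (2 * TR + 8)%N) hin); first lia.
move=> s1 M1 T' h1 hk h26 M1_gt0 bA bB hmin hT'.
have in1 : holds_input A B s1 by apply: (holds_input_same _ h1).
have [r [g [u [hr hg hu eAB]]]] := max_res_data R n_gt0 rowA colB.
have [r' [g' [u' [hr' hg' hu' eBA]]]] := max_res_data R n_gt0 rowB colA.
apply: (@runs_seq _ _ _ _ (2 * TR + 8)); first lia.
apply: (@runs_seq _ _ _ _ (TR + 3)); first lia.
have [sA1 sB1] := stored_input in1; have [d1 d2] := input_dims in1.
apply: (@runs_Res o m n B A 3 4 1 2 M1 _ _ _ _ s1 sB1 sA1 bB bA rowB colA d1 d2 h26 r' hr' g' u')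
  => //.
move=> s2 h2 e2.
apply: (@runs_seq_upd _ _ _ _ _ _ 0 0 (- u')) => //; first lia.
  by rewrite /= e2 sub0r.
set s3 := upd _ 13 _ _ _.
have h3 : same_but [:: 13; 22; 23; 24; 39; 40; 41]%N s1 s3.
  apply: same_but_upd => //; apply: same_but_sub h2 => a.
  by rewrite [in X in _ -> X]in_cons => ->; rewrite orbT.
have in3 : holds_input A B s3 by apply: (holds_input_same _ h3).
apply: (@runs_seq _ _ _ _ (TR + 3)); first lia.
have [sA3 sB3] := stored_input in3; have [f1 f2] := input_dims in3.
have f26 : s3 26%N 0 0 = M1%:Z by rewrite h3.
apply: (@runs_Res o m n A B 1 2 3 4 M1 _ _ _ _ s3 sA3 sB3 bA bB rowA colB f1 f2 f26 r hr g u)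
  => //.
move=> s4 h4 e4.
apply: (@runs_upd _ _ _ _ _ _ 0 0 u) => //; first lia.
set s5 := upd _ 33 _ _ _.
have h5 : same_but [:: 33; 13; 22; 23; 24; 39; 40; 41]%N s1 s5.
  apply: same_but_upd => //; apply: same_but_trans (same_but_sub _ h3) (same_but_sub _ h4) => a.
    by rewrite [in X in _ -> X]in_cons => ->; rewrite orbT.
  by rewrite !(in_cons 33%N) !(in_cons 13%N) => ->; rewrite !orbT.
apply: (runs_InitFarey (L := - u') (U := u)) => //.
- by rewrite h5.
- by rewrite /s5 upd_other // h4 // /s3 upd_same.
- lia.
move=> s6 h6 hi; exists (- u'), u; split=> //; first by rewrite opprK.
apply: same_but_trans (same_but_sub _ h1) _.
  by move=> a; rewrite !inE => /or4P[] /eqP->.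
apply: same_but_trans (same_but_sub _ h5) (same_but_sub _ h6) => a; rewrite !inE.
  by move=> h; do ?[case/orP: h => [/eqP->//|h]]; rewrite (eqP h).
by move=> h; do ?[case/orP: h => [/eqP->//|h]]; rewrite (eqP h).
Qed.
End Setups.

(** * Deciding a test by value iteration *)

Section IntegerSolutions.
Variables (m n : nat) (A B : intmx m n).

Definition int_subsol (S : {set 'I_n}) (y : 'I_n -> int) : Prop :=
  forall i j c, j \in S -> A i j = Some c ->
    exists k d, [/\ k \in S, B i k = Some d & c + y j <= d + y k].

Lemma int_subsol_feasible (R : realType) (S : {set 'I_n}) y : (exists j, j \in S) ->
  int_subsol S y -> subeigenvalue A B (0 : R).
Proof.
move=> S0 h; exists S, (fun j => (y j)%:~R); split=> //.
apply/subeigenvalueP => i j c jS Ac; have [k [d [kS Bd le]]] := h i j c jS Ac.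
by exists k, d; split=> //; rewrite addr0 -!rmorphD ler_int.
Qed.

(** Rounding down preserves the inequalities, since the entries are integers. *)
Lemma feasible_int_subsol (R : realType) : subeigenvalue A B (0 : R) ->
  exists (S : {set 'I_n}) y, (exists j, j \in S) /\ int_subsol S y.
Proof.
move=> [S [x [S0 /subeigenvalueP h]]]; exists S, (fun j => Num.floor (x j)).
split=> // i j c jS Ac; have [k [d [kS Bd le]]] := h i j c jS Ac.
exists k, d; split=> //; have lej := floor_le (x j).
have : Num.floor (x j) + c - d <= Num.floor (x k).
  by rewrite floor_ge_int rmorphB rmorphD /=; lra.
by move: (Num.floor _) (Num.floor _) => u v; lia.
Qed.

(* A gap larger than [2 * W] between consecutive values of a solution cannot be
   bridged by a single move, so everything below it can be set to -oo. *)
Lemma int_subsol_spread (W : nat) (S : {set 'I_n}) y :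
  entries_bounded W A -> entries_bounded W B ->
  (exists j, j \in S) -> int_subsol S y ->
  exists (S' : {set 'I_n}) y', [/\ exists j, j \in S', int_subsol S' y' &
    forall j, j \in S' -> 0 <= y' j <= (n * (2 * W))%N%:Z].
Proof.
move=> bA bB [j0 j0S] h.
have [j1 [j1S j1max]] : exists j, j \in S /\ forall k, k \in S -> y k <= y j.
  case: (@arg_maxP _ _ _ j0 (fun j => j \in S) y j0S) => j jS jmax.
  by exists j; split=> // k; exact: jmax.
(* Coordinates within [k * (2 * W)] of the top. The levels increase from a nonempty one inside a set
   of size [n], so some level with [k < n] equals the next. A move loses at most [2 * W], hence
   cannot leave such a level. *)
pose level k := [set j in S | y j1 - (k * (2 * W))%N%:Z <= y j]%SET.
have levelS k : level k \subset level k.+1.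
  apply/fintype.subsetP => j; rewrite !inE => /andP[-> /=].
  by rewrite (mulSn k); move: (k * _)%N => u; lia.
have [k [kn stable]] : exists k, (k < n)%N /\ level k.+1 \subset level k.
  apply: contrapT => /forallNP no.
  have grow k : (k <= n)%N -> (k < #|level k|)%N.
    elim: k => [_|k IH lt].
      by apply/card_gt0P; exists j1; rewrite inE j1S mul0n subr0 lexx.
    apply: leq_ltn_trans (IH (ltnW lt)) _; apply: proper_card.
    rewrite properE levelS; apply/negP => sub; exact: (no k).
  have := grow n (leqnn n); rewrite ltnNge => /negP[].
  by apply: leq_trans (max_card _) _; rewrite card_ord.
exists (level k), (fun j => y j - y j1 + (n * (2 * W))%N%:Z).
have inlevel j : j \in level k ->
    [/\ j \in S, y j <= y j1 & y j1 - (k * (2 * W))%N%:Z <= y j].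
  by rewrite inE => /andP[jS ->]; split=> //; exact: j1max.
split.
- by exists j1; rewrite inE j1S /= lerBlDr lerDl.
- move=> i j c /[dup] jl /inlevel[jS _ gej] Ac.
  have [l [d [lS Bd le]]] := h i j c jS Ac; exists l, d; split=> //; last by lia.
  apply: (fintype.subsetP stable); rewrite inE lS /=.
  have := bounded_entry bA Ac; have := bounded_entry bB Bd.
  by move: gej; rewrite (mulSn k); move: (k * _)%N => u; lia.
- move=> j /inlevel[_ le1 le2].
  have : (k * (2 * W) <= n * (2 * W))%N by rewrite leq_mul2r (ltnW kn) orbT.
  by move: le2; move: (k * _)%N (n * _)%N => u v; lia.
Qed.

(* A vector [x] encodes the element of R_max^n with [x j] = -oo iff [x j < 0]. *)
Definition relaxed (x : 'I_n -> int) (i : 'I_m) (j : 'I_n) : Prop :=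
  forall c, A i j = Some c -> 0 <= x j ->
    exists k d, [/\ B i k = Some d, 0 <= x k & c + x j <= d + x k].

(** Invariant of a descent from the constant vector [T] towards the greatest solution with values
    between 0 and [T]. *)
Definition dominates (T : int) (x : 'I_n -> int) : Prop :=
  (forall j, -1 <= x j <= T) /\
  forall S y, int_subsol S y -> (forall j, j \in S -> 0 <= y j <= T) ->
    forall j, j \in S -> y j <= x j.

(** A solution [y] touching [x] at [j] has a move from there, and the same move would serve [x],
    which is at least [y] at its target. So [y j < x j], and [x j] can be lowered by 1. *)
Lemma dominates_relax T x i j : dominates T x -> 0 <= x j -> ~ relaxed x i j ->
  dominates T (fun k => if k == j then x j - 1 else x k).
Proof.
move=> [bx hx] xj nr; split=> [k|S y hS hy k kS].
  by case: eqP => _; [have := bx j; lia|exact: bx].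
case: eqP => [kj|_]; last exact: hx hS hy _ kS.
have := hx S y hS hy k kS; rewrite kj le_eqVlt => /orP[/eqP yx|]; last by lia.
case: nr => c Ac _; have [l [d [lS Bd le]]] := hS i k c kS (etrans (congr1 _ kj) Ac).
exists l, d; split=> //; have := hx S y hS hy l lS; have := hy l lS; first lia.
by move: le; rewrite kj yx; lia.
Qed.

(** The nonnegative coordinates of a relaxed [x] form a solution. Conversely a solution may be taken
    with spread at most [n * (2 * W)], and then it lies below [x]. *)
Lemma relaxed_feasible (R : realType) (W : nat) x :
  entries_bounded W A -> entries_bounded W B ->
  dominates (n * (2 * W))%N%:Z x -> (forall i j, relaxed x i j) ->
  (exists j, 0 <= x j) <-> subeigenvalue A B (0 : R).
Proof.
move=> bA bB [_ hx] hr; split.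
  case=> j xj; apply: (@int_subsol_feasible R [set k | 0 <= x k]%SET x).
    by exists j; rewrite inE.
  move=> i k c; rewrite inE => xk Ac.
  by have [l [d [Bd xl le]]] := hr i k c Ac xk; exists l, d; rewrite inE.
move/feasible_int_subsol => [S [y [S0 hS]]].
have [S' [y' [[j jS'] hS' hy']]] := int_subsol_spread bA bB S0 hS.
exists j; have /andP[y0 _] := hy' j jS'.
exact: le_trans y0 (hx S' y' hS' hy' j jS').
Qed.

(** The shift by 1 lets the value -1, which encodes -oo, count as 0. *)
Definition measure (x : 'I_n -> int) : nat := (\sum_j `|(x j + 1)%R|)%N.

Lemma measure_relax T x j : dominates T x -> 0 <= x j ->
  (measure (fun k => if k == j then x j - 1 else x k)%R < measure x)%N.
Proof.
move=> [bx _] xj; rewrite /measure (bigD1 j) //= [ltnRHS](bigD1 j) //= eqxx.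
rewrite (eq_bigr (fun k => `|(x k + 1)%R|%N)); last by move=> k /negbTE ->.
by rewrite ltn_add2r; lia.
Qed.

Lemma measure_le (T : nat) x : dominates T%:Z x -> (measure x <= n * T.+1)%N.
Proof.
move=> [bx _]; rewrite /measure -[n in leqRHS]card_ord -sum_nat_const.
by apply: leq_sum => j _; have := bx j; lia.
Qed.
End IntegerSolutions.

Definition Xat (k : nat) : aexp := Get 34 (V k) (Cst 0).

Definition qrows : aexp := Add nrows nrows.

(** In a query, unlike in the input, absent entries may have nonzero values; hence the flags are
    tested. *)
Definition EntryBound : cmd :=
  Seq (Assign 37 (Cst 0))
  (For 22 qrows (For 23 ncols
    (Seq (If (Cst 1) (At 7) (Seq (Raise 37 (At 8)) (Raise 37 (Defs.Sub (Cst 0) (At 8)))) Skip)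
         (If (Cst 1) (At 9) (Seq (Raise 37 (At 10)) (Raise 37 (Defs.Sub (Cst 0) (At 10)))) Skip)))).

Definition InitX : cmd :=
  Seq (MulAdd (Cst 0) ncols (Add (V 37) (V 37)))
      (For 38 ncols (Set_ 34 (V 38) (Cst 0) (V 25))).

Definition CheckMove : cmd :=
  If (Cst 1) (Get 9 (V 22) (V 38))
    (If (Cst 0) (Xat 38)
       (If (Add (At 8) (Xat 23)) (Add (Get 10 (V 22) (V 38)) (Xat 38)) (Assign 36 (Cst 1)) Skip)
       Skip)
    Skip.

Definition Relax : cmd :=
  If (Cst 1) (At 7)
    (If (Cst 0) (Xat 23)
       (Seq (Assign 36 (Cst 0))
       (Seq (For 38 ncols CheckMove)
            (If (V 36) (Cst 0)
               (Seq (Set_ 34 (V 23) (Cst 0) (Defs.Sub (Xat 23) (Cst 1))) (Assign 35 (Cst 1)))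
               Skip)))
       Skip)
    Skip.

Definition Verdict : cmd :=
  Seq (Assign 11 (Cst (- 1)))
      (For 38 ncols (If (Cst 0) (Xat 38) (Assign 11 (Cst 0)) Skip)).

(** Replaces an oracle call: only the sign of cell 11 is read afterwards. Passes over the matrix are
    repeated until one leaves [x] unchanged. *)
Definition Solver : cmd :=
  Seq EntryBound (Seq InitX
  (Seq (Assign 35 (Cst 1))
  (Seq (While (Cst 1) (V 35)
         (Seq (Assign 35 (Cst 0)) (For 22 qrows (For 23 ncols Relax))))
       Verdict))).

Section Solving.
Variables (o : oracle) (m n : nat) (A B : intmx m n) (W0 : nat).
Hypotheses (bA : entries_bounded W0 A) (bB : entries_bounded W0 B).
Variable s0 : store.
Hypotheses (hm : s0 0%N 0 0 + s0 0%N 0 0 = m%:Z) (hn : s0 0%N 0 1 = n%:Z).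
Hypotheses (sA : stored s0 7 8 A) (sB : stored s0 9 10 B).

Let frame s := same_but test_arrays s0 s.

Lemma solver_dims s : frame s -> aeval s qrows = m%:Z /\ aeval s ncols = n%:Z.
Proof. by move=> h; rewrite /= !h. Qed.

Lemma solver_A s (i : 'I_m) (j : 'I_n) : frame s ->
  s 7%N (i : nat)%:Z (j : nat)%:Z = (A i j != None : nat)%:Z /\
  forall z, A i j = Some z -> s 8%N (i : nat)%:Z (j : nat)%:Z = z.
Proof. by move=> h; rewrite !h. Qed.

Lemma solver_B s (i : 'I_m) (j : 'I_n) : frame s ->
  s 9%N (i : nat)%:Z (j : nat)%:Z = (B i j != None : nat)%:Z /\
  forall z, B i j = Some z -> s 10%N (i : nat)%:Z (j : nat)%:Z = z.
Proof. by move=> h; rewrite !h. Qed.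

Lemma runs_RaiseEntry f v (C : intmx m n) (i : 'I_m) (j : 'I_n) s T (Q : store -> Prop) :
  f != 37%N -> v != 37%N ->
  aeval s (At f) = (C i j != None : nat)%:Z ->
  (forall z, C i j = Some z -> aeval s (At v) = z) -> (5 <= T)%N ->
  (forall s', same_but [:: 37]%N s s' ->
     s' 37%N 0 0 = (if C i j is Some z then Num.max (s 37%N 0 0) `|z|%N%:Z else s 37%N 0 0) ->
     Q s') ->
  runs o (If (Cst 1) (At f) (Seq (Raise 37 (At v)) (Raise 37 (Defs.Sub (Cst 0) (At v)))) Skip)
    s T Q.
Proof.
move=> f37 v37 hf hv hT hQ; apply: runs_if; rewrite ?hf; first lia.
  case Cij: (C i j) => [z|] //= _.
  apply: (@runs_seq _ _ _ _ 2); first lia.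
  apply: runs_Raise => // s1 h1 e1.
  have vE : aeval s1 (At v) = z by rewrite -(hv _ Cij) /= !h1 // inE.
  apply: runs_Raise => [|s2 h2 e2]; first lia.
  apply: hQ; first exact: same_but_trans h1 h2.
  have -> : s2 37%N 0 0 = Num.max (Num.max (s 37%N 0 0) z) (- z).
    have e3 : aeval s1 (Defs.Sub (Cst 0) (At v)) = - z by rewrite -vE -sub0r.
    by rewrite e2 e1 (hv _ Cij) e3.
  rewrite Cij.
  by move: (s 37%N 0 0) => u; clear; lia.
case Cij: (C i j) => [z|] //= _.
apply: runs_skip; first lia.
by apply: hQ => //; rewrite Cij.
Qed.

Lemma runs_EntryBound T (Q : store -> Prop) : (m * (n * 14 + 4) + 3 <= T)%N ->
  (forall s (W : nat), frame s -> s 37%N 0 0 = W%:Z -> (W <= W0)%N ->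
     entries_bounded W A -> entries_bounded W B -> Q s) ->
  runs o EntryBound s0 T Q.
Proof.
move=> hT hQ; apply: (@runs_seq_upd _ _ _ _ _ _ 0 0 0) => //; first lia.
pose F s := frame s /\ 0 <= s 37%N 0 0 <= W0%:Z.
pose P (i : 'I_m) (j : 'I_n) (s : store) :=
  (`|odflt 0%R (A i j)|%N%:Z <= s 37%N 0 0) && (`|odflt 0%R (B i j)|%N%:Z <= s 37%N 0 0).
apply: (@runs_for2 _ _ _ P F _ _ _ _ _ _ _ 10) => //.
- by move=> s x [h1 h2]; split; (split; [apply: same_but_upd|rewrite upd_other]).
- by move=> s [/solver_dims].
- move=> i j s [h1 h2] hi hj.
  have [a1 a2] := solver_A i j h1; have [b1 b2] := solver_B i j h1.
  apply: (@runs_seq _ _ _ _ 5) => //.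
  apply: (@runs_RaiseEntry 7 8 A i j); rewrite //= ?hi ?hj //.
  move=> s1 g1 e1; have [b1' b2'] : s1 9%N = s 9%N /\ s1 10%N = s 10%N by rewrite !g1.
  have [hi1 hj1] : s1 22%N 0 0 = i%:Z /\ s1 23%N 0 0 = j%:Z by rewrite !g1.
  apply: (@runs_RaiseEntry 9 10 B i j); rewrite //= ?hi1 ?hj1 ?b1' ?b2' //.
  move=> s2 g2 e2.
  have e : s2 37%N 0 0 = Num.max (s 37%N 0 0)
      (maxn `|odflt 0%R (A i j)| `|odflt 0%R (B i j)|)%N%:Z.
    rewrite e2 e1; case/andP: h2; move: (s 37%N 0 0) => u.
    by case: (A i j) => [a|]; case: (B i j) => [b|] /=; clear; lia.
  have k2 : same_but [:: 37]%N s s2 by apply: same_but_trans g1 g2.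
  have mono : s 37%N 0 0 <= s2 37%N 0 0 by rewrite e le_max lexx.
  split; rewrite ?k2 //.
  + split; first by apply: same_but_trans h1 _; apply: same_but_sub k2 => ?; rewrite inE => /eqP->.
    rewrite e; case/andP: h2 => u0 uW; rewrite le_max u0 /= ge_max uW lez_nat geq_max.
    by case Aij: (A i j) => [a|] /=; case Bij: (B i j) => [b|] /=;
      rewrite ?(bounded_entry bA Aij) ?(bounded_entry bB Bij).
  + by rewrite /P e !le_max !lez_nat !leq_max !leqnn !orbT.
  + by move=> i' j' _ /andP[p1 p2]; rewrite /P !(le_trans _ mono).
- split; first by apply: same_but_upd.
  by rewrite upd_same lexx.
- lia.
move=> s [h1 /andP[u0 uW]] hP.
case e: (s 37%N 0 0) u0 uW => [W|] // _ uW; apply: (hQ s W) => //.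
  apply/forallP => i; apply/forallP => j; have := hP i j; rewrite /P e.
  by case: (A i j) => [a|] //= /andP[].
apply/forallP => i; apply/forallP => j; have := hP i j; rewrite /P e.
by case: (B i j) => [a|] //= /andP[].
Qed.

Definition xvec (s : store) : 'I_n -> int := fun j => s 34%N (j : nat)%:Z 0.

Lemma xvec_same l s s' : 34%N \notin l -> same_but l s s' -> xvec s' = xvec s.
Proof. by move=> nl h; rewrite /xvec h. Qed.

Lemma runs_InitX s (W : nat) T (Q : store -> Prop) : frame s -> s 37%N 0 0 = W%:Z ->
  (n * 6 + 5 <= T)%N ->
  (forall s', frame s' -> (forall j, xvec s' j = (n * (2 * W))%N%:Z) -> Q s') ->
  runs o InitX s T Q.
Proof.
move=> hs hW hT hQ; have [_ d2] := solver_dims hs.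
apply: (@runs_seq _ _ _ _ (n * 3 + 3)); first lia.
apply: (@runs_MulAdd _ _ _ _ _ n) => //; first lia.
move=> s1 h1; rewrite /= hW => e1.
have f1 : frame s1.
  by apply: same_but_trans hs _; apply: same_but_sub h1 => ?; rewrite !inE => /orP[] /eqP->.
apply: (@runs_for _ (fun k s' => [/\ frame s', s' 25%N 0 0 = (n * (2 * W))%N%:Z &
   forall j : 'I_n, (j < k)%N -> xvec s' j = (n * (2 * W))%N%:Z]) _ _ _ _ _ n 1).
- move=> k s' x [g1 g2 g3]; split; first exact: same_but_upd.
    by rewrite upd_other.
  by move=> j /g3; rewrite /xvec upd_other.
- by move=> k s' [g1 _ _] _; case: (solver_dims g1).
- move=> k s' lt [g1 g2 g3] h38.
  apply: (@runs_upd _ _ _ _ _ _ k%:Z 0 (n * (2 * W))%N%:Z) => //.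
  split; first by rewrite upd_other.
  split; [exact: same_but_upd|by rewrite upd_other|].
  move=> j; rewrite ltnS leq_eqVlt /xvec /upd /= => /orP[/eqP->|lt']; first by rewrite eqxx.
  by rewrite eqxx andbT eqz_nat ltn_eqF //; exact: g3.
- by split=> //; rewrite e1; lia.
- lia.
by move=> s' [g1 _ g3]; apply: hQ => // j; apply: g3.
Qed.

Lemma runs_Relax (i : 'I_m) (j : 'I_n) s T (Q : store -> Prop) : frame s ->
  s 22%N 0 0 = (i : nat)%:Z -> s 23%N 0 0 = (j : nat)%:Z -> (n * 6 + 10 <= T)%N ->
  (forall s', frame s' -> s' 22%N 0 0 = (i : nat)%:Z -> s' 23%N 0 0 = (j : nat)%:Z ->
     (s' 35%N 0 0 = s 35%N 0 0 /\ xvec s' = xvec s /\ relaxed A B (xvec s) i j) \/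
     [/\ s' 35%N 0 0 = 1, 0 <= xvec s j, ~ relaxed A B (xvec s) i j &
       xvec s' = (fun k => if k == j then xvec s j - 1 else xvec s k)] -> Q s') ->
  runs o Relax s T Q.
Proof.
move=> hs hi hj hT hQ; have [a1 a2] := solver_A i j hs.
apply: runs_if; rewrite /= ?hi ?hj ?a1; first lia; last first.
  case Aij: (A i j) => [z|] //= _; apply: runs_skip; first lia.
  by apply: hQ => //; left; split=> //; split=> // c; rewrite Aij.
case Aij: (A i j) => [c|] //= _.
have {}a2 := a2 _ Aij.
apply: runs_if; rewrite /= ?hj -/(xvec s j); first lia; last first.
  move=> xj; apply: runs_skip; first lia.
  by apply: hQ => //; left; split=> //; split=> // c' _; rewrite leNgt xj.
move=> xj; apply: (@runs_seq_upd _ _ _ _ _ _ 0 0 0) => //; first lia.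
set s1 := upd _ 36 _ _ _.
apply: (@runs_seq _ _ _ _ (n * 6 + 2)); first lia.
pose good_move (k : 'I_n) := exists d, [/\ B i k = Some d, 0 <= xvec s k &
  c + xvec s j <= d + xvec s k].
apply: (@runs_for _ (fun l s' => same_but [:: 36; 38]%N s s' /\
   ((s' 36%N 0 0 = 0 /\ forall k : 'I_n, (k < l)%N -> ~ good_move k) \/
    (s' 36%N 0 0 = 1 /\ exists k, good_move k))) _ _ _ _ _ n 4).
- by move=> l s' x [h1 h2]; split; [exact: same_but_upd|rewrite !upd_other].
- by move=> l s' [h1 _] _; rewrite /= h1 //; case: (solver_dims hs).
- move=> l s' lt [h1 h2] h38; pose k := Ordinal lt.
  have [b1 b2] := solver_B i k hs.
  have nogood : ~ good_move k -> s' 38%N 0 0 = l%:Z /\ (same_but [:: 36; 38]%N s s' /\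
      ((s' 36%N 0 0 = 0 /\ forall k : 'I_n, (k < l.+1)%N -> ~ good_move k) \/
       (s' 36%N 0 0 = 1 /\ exists k, good_move k))).
    move=> ng; split=> //; split=> //; case: h2 => [[e36 h2]|]; last by right.
    left; split=> // k'; rewrite ltnS leq_eqVlt => /orP[/eqP e|]; last exact: h2.
    by have -> : k' = k by apply: val_inj; rewrite /= e.
  apply: runs_if; rewrite /= ?h38 ?(h1 9%N) ?(h1 22%N) // hi b1; last first.
    case Bik: (B i k) => [d|] //= _; apply: runs_skip => //; apply: nogood.
    by case=> d []; rewrite Bik.
  case Bik: (B i k) => [d|] //= _; have {}b2 := b2 _ Bik.
  apply: runs_if; rewrite /= ?h38 ?(h1 34%N) // -[s 34%N l%:Z 0]/(xvec s k); last first.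
    move=> lt0; apply: runs_skip => //; apply: nogood.
    by case=> d' [_]; rewrite leNgt lt0.
  move=> xk; apply: runs_if => //=; rewrite h38 !h1 // hi hj a2 b2
    -[s 34%N l%:Z 0]/(xvec s k) -[s 34%N j%:Z 0]/(xvec s j).
    move=> le; apply: (@runs_upd _ _ _ _ _ _ 0 0 1) => //.
    split; first by rewrite upd_other.
    split; first exact: same_but_upd.
    by right; rewrite upd_same; split=> //; exists k, d.
  move=> gt; apply: runs_skip => //; apply: nogood.
  by case=> d' []; rewrite Bik => -[<-] _; rewrite leNgt gt.
- by split; [apply: same_but_upd|left; rewrite /s1 upd_same].
- lia.
move=> s2 [h2 alt].
have f2 : frame s2.
  by apply: same_but_trans hs _; apply: same_but_sub h2 => ?; rewrite !inE => /orP[] /eqP->.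
have x2 : xvec s2 = xvec s by apply: xvec_same h2.
apply: runs_if => [|/=|/=]; first lia; case: alt => -[-> alt] // _.
  have nr : ~ relaxed A B (xvec s) i j.
    by move=> /(_ c Aij xj) [k [d [Bd xk le]]]; apply: (alt k) => //; exists d.
  apply: (@runs_seq_upd _ _ _ _ _ _ j%:Z 0 (xvec s j - 1)) => //; first lia.
    by rewrite /= h2 // hj.
    by rewrite /= (h2 23%N) // hj -x2.
  apply: (@runs_upd _ _ _ _ _ _ 0 0 1) => //; first lia.
  apply: hQ.
  + by do 2 apply: same_but_upd => //.
  + by rewrite !upd_other // h2.
  + by rewrite !upd_other // h2.
  right; rewrite upd_same; split=> //.
  apply/funext => k; rewrite /xvec upd_other // /upd /= eqxx andbT eqz_nat.
  rewrite -[(k : nat) == j]/(k == j); case: eqP => // _.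
  by rewrite -/(xvec s2 k) x2.
apply: runs_skip; first lia.
apply: hQ => //; rewrite ?h2 //; left; split=> //; split=> //.
move=> c' Ac' _; case: alt => k [d [Bd xk le]].
by exists k, d; split=> //; move: Ac'; rewrite Aij => -[<-].
Qed.

Definition pass_time : nat := (m * (n * (n * 6 + 12) + 4) + 4)%N.

Definition solver_time (W : nat) : nat :=
  (m * (n * 14 + 4) + (n * 6 + 5) + ((n * (n * (2 * W)).+1).+1 * pass_time.+1 + 1) +
   (n * 4 + 3) + 4)%N.

Lemma runs_Solver (R : realType) T : (solver_time W0 <= T)%N ->
  runs o Solver s0 T (fun s' => frame s' /\
    (0 <= s' 11%N 0 0 <-> subeigenvalue A B (0 : R))).
Proof.
rewrite /solver_time => hT.
apply: (@runs_seq _ _ _ _ (m * (n * 14 + 4) + 3)); first lia.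
apply: runs_EntryBound => // s1 W f1 e1 WW0 bA' bB'.
have {}hT : ((n * 6 + 5) + ((n * (n * (2 * W)).+1).+1 * pass_time.+1 + 1) +
   (n * 4 + 3) + 1 <= T - (m * (n * 14 + 4) + 3))%N.
  have : ((n * (n * (2 * W)).+1).+1 * pass_time.+1 <=
          (n * (n * (2 * W0)).+1).+1 * pass_time.+1)%N.
    by rewrite leq_mul2r ltnS leq_mul2l ltnS !leq_mul2l WW0 !orbT.
  move: hT; move: (_ * pass_time.+1)%N (_ * pass_time.+1)%N (m * _)%N (n * 6)%N (n * 4)%N.
  by clear; lia.
move: (T - _)%N hT => {}T hT.
(* Every pass but the last lowers the sum of the [x j + 1], which starts at [n * (Tm + 1)] at
   most. *)
set G := (n * (n * (2 * W)).+1).+1 in hT; set Tm := (n * (2 * W))%N in G hT.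
apply: (@runs_seq _ _ _ _ (n * 6 + 5)); first by clear -hT; lia.
apply: (runs_InitX f1 e1) => // s2 f2 x2.
apply: runs_seq_set; first by clear -hT; lia.
set s3 := upd _ 35 _ _ _.
have f3 : frame s3 by apply: same_but_upd.
have x3 : xvec s3 = xvec s2 by [].
have dom3 : dominates A B Tm%:Z (xvec s3).
  rewrite x3; split=> [j|S y _ hy j jS]; rewrite x2; first by clear; lia.
  by case/andP: (hy j jS).
apply: (@runs_seq _ _ _ _ (G * pass_time.+1 + 1)); first by clear -hT; lia.
pose I k s := [/\ frame s, dominates A B Tm%:Z (xvec s) &
  (s 35%N 0 0 = 1 /\ (measure (xvec s) < k)%N) \/
  (s 35%N 0 0 = 0 /\ forall i j, relaxed A B (xvec s) i j)].
apply: (@runs_while _ I _ _ _ G _ _ pass_time).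
- move=> k s [fs ds alt] /=; case: alt => [[_ mk]|[-> _]] // _.
  apply: (@runs_seq_upd _ _ _ _ _ _ 0 0 0) => //; first by rewrite /pass_time addn4.
  set s4 := upd _ 35 _ _ _.
  pose F s' := frame s' /\ [/\ dominates A B Tm%:Z (xvec s'),
    s' 35%N 0 0 = 0 \/ s' 35%N 0 0 = 1,
    s' 35%N 0 0 = 0 -> xvec s' = xvec s &
    s' 35%N 0 0 = 1 -> (measure (xvec s') < measure (xvec s))%N].
  (* A pair checked earlier in the pass is known to be relaxed only as long as [x] has not changed;
     after a change another pass checks everything again. *)
  pose P i j s' := s' 35%N 0 0 = 1 \/ relaxed A B (xvec s') i j.
  apply: (@runs_for2 _ _ _ P F _ _ _ _ _ _ _ (n * 6 + 10)) => //.
  + by move=> s' x [h1 h2]; split; (split; first exact: same_but_upd).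
  + by move=> s' [/solver_dims].
  + move=> i j s' [h1 [d1 alt x0 x1]] hi hj.
    apply: (runs_Relax h1 hi hj) => // s5 f5 hi5 hj5 [[e35 [xe rel]]|[e35 xj nr xe]].
      split=> //.
      * by split=> //; rewrite xe e35.
      * by right; rewrite xe.
      * by move=> i' j' _; rewrite /P xe e35.
    have dom5 : dominates A B Tm%:Z (xvec s5) by rewrite xe; exact: dominates_relax nr.
    have lt5 : (measure (xvec s5) < measure (xvec s'))%N.
      by rewrite xe; apply: measure_relax d1 xj.
    split=> //.
    * split=> //; split=> //; [by right|by rewrite e35|].
      move=> _; case: alt => [/x0 <- //|/x1]; exact: ltn_trans.
    * by left.
    * by move=> i' j' _ _; left.
  + split; first by apply: same_but_upd.
    by split=> //; left.
  + by rewrite /pass_time; clear; lia.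
  move=> s' [h1 [d1 [e35|e35] x0 x1]] hP.
    exists 0%N; first by case: k mk.
    split=> //; right; split=> // i j; case: (hP i j) => //.
    by rewrite e35.
  by exists (measure (xvec s)) => //; split=> //; left; split=> //; exact: x1.
- split=> //; left; split; first by rewrite /s3 upd_same.
  by rewrite ltnS; apply: measure_le dom3.
- by rewrite addn1.
move=> k s [fs ds alt] /=; case: alt => [[-> _]|[_ rel]] // _.
have [_ d2] := solver_dims fs.
apply: (@runs_seq_upd _ _ _ _ _ _ 0 0 (- 1)) => //; first by clear -hT; lia.
apply: (@runs_for _ (fun l s' => same_but [:: 11; 38]%N s s' /\
   ((s' 11%N 0 0 = -1 /\ forall k : 'I_n, (k < l)%N -> xvec s k < 0) \/
    (s' 11%N 0 0 = 0 /\ exists k, 0 <= xvec s k))) _ _ _ _ _ n 2).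
- by move=> l s' x [h1 h2]; split; [exact: same_but_upd|rewrite !upd_other].
- by move=> l s' [h1 _] _; rewrite -d2 /= h1.
- move=> l s' lt [h1 h2] h38; pose j := Ordinal lt.
  apply: runs_if => //=; rewrite h38 h1 // -[s 34%N l%:Z 0]/(xvec s j) => xj.
    apply: (@runs_upd _ _ _ _ _ _ 0 0 0) => //; split; first by rewrite upd_other.
    split; first exact: same_but_upd.
    by right; rewrite upd_same; split=> //; exists j.
  apply: runs_skip => //; split=> //; split=> //; case: h2 => [[e h2]|]; last by right.
  left; split=> // k'; rewrite ltnS leq_eqVlt => /orP[/eqP e'|]; last exact: h2.
  by have -> : k' = j by apply: val_inj; rewrite /= e'.
- by split; [apply: same_but_upd|left; rewrite upd_same].
- by clear -hT; lia.
move=> s' [h1 alt]; split.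
  by apply: same_but_trans fs _; apply: same_but_sub h1 => ?; rewrite !inE => /orP[] /eqP->.
apply: iff_trans (relaxed_feasible R bA' bB' ds rel).
case: alt => [[-> no]|[-> [j xj]]]; split=> //; last by exists j.
by case=> j xj; have := no j (ltn_ord j); rewrite ltNge xj.
Qed.
End Solving.

Lemma Solver_correct (R : realType) (o : oracle) (m n W : nat) :
  test_correct R o Solver false (solver_time m n W) (mpg_instance m n W).
Proof.
move=> m' n' A B s h t hm hn sA sB /and5P[/= /eqP em /eqP en _ bA bB].
subst m' n'.
apply: (traced_runs (@runs_Solver o m n A B W bA bB s hm hn sA sB R _ (leqnn _))).
by move=> s' t' [h1 h2] le; rewrite cats0.
Qed.

(** * The complete searches and their query counts *)

Definition Rays (Test : cmd) : cmd :=
  Seq (Probe Test (Defs.Sub (V 13) (Cst 1)) (Cst 1)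
         (Cst 0) (Cst 0) (Cst 1) (Cst 1) (V 13) (Cst 1))
      (Probe Test (Add (V 33) (Cst 1)) (Cst 1)
         (Cst 1) (V 33) (Cst 1) (Cst 0) (Cst 0) (Cst 1)).

Definition WideSearch (Test : cmd) : cmd :=
  Seq (Setup WideBounds) (Seq (Rays Test) (FareyLoop Test)).

Definition TightSearch (Test : cmd) : cmd :=
  Seq (Setup TightBounds) (FareyLoop Test).

Section Searches.
Variables (R : realType) (o : oracle) (m n : nat) (A B : intmx m n).
Hypotheses (m_gt0 : (0 < m)%N) (n_gt0 : (0 < n)%N).
Hypotheses (rowA : no_infty_row A) (rowB : no_infty_row B).
Hypothesis no_col : no_common_infty_col A B.
Variable M : nat.
Hypotheses (bA : entries_bounded M A) (bB : entries_bounded M B).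

Local Notation Sp := (spec (Rmx R A) (Rmx R B)).
Local Notation kappa := (minn (2 * m) n).

Lemma kappa_gt0 : (0 < kappa)%N.
Proof. by rewrite leq_min n_gt0 muln_gt0 m_gt0. Qed.

Lemma init_input : holds_input A B (init A B).
Proof. by []. Qed.

Lemma good_query_at (bound : nat) (p : int) (q : nat) :
  (q * M + `|p| <= bound)%N -> mpg_instance (2 * m) n bound (query_at A B p q).
Proof. by move=> hb; apply: (query_at_instance (M := M)). Qed.

Section Wide.
Variables (Test : cmd) (asks : bool) (TT : nat).
Hypothesis M_gt0 : (0 < M)%N.

Let bound := (2 * kappa * (M + 2 * M * kappa))%N.
Local Notation good := (mpg_instance (2 * m) n bound).
Hypothesis TestP : test_correct R o Test asks TT good.

Variable M1 : nat.
Hypotheses (bA1 : entries_bounded M1 A) (bB1 : entries_bounded M1 B).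
Hypothesis M1_le : (M1 <= M)%N.
Let N := (2 * M1 * kappa)%N.

Lemma wide_good_query (p : int) (q : nat) : (0 < q <= 2 * kappa)%N ->
  - N%:Z * q%:Z <= p -> p <= N%:Z * q%:Z -> good (query_at A B p q).
Proof.
move=> /andP[_ q2] hl hu; apply: good_query_at.
have hp : (`|p| <= q * (2 * M * kappa))%N.
  apply: (@leq_trans (q * N)%N).
    by move: hl hu; rewrite mulNr -PoszM mulnC; move: (_ * _)%N => u; clear; lia.
  by rewrite leq_mul2l leq_mul2r leq_mul2l M1_le !orbT.
apply: (@leq_trans (q * M + q * (2 * M * kappa))%N); first by rewrite leq_add2l.
by rewrite -mulnDr leq_mul2r q2 orbT.
Qed.

Lemma ray_good_query (p : int) : `|p|%N = N.+1 -> good (query_at A B p 1%N).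
Proof.
move=> hp; apply: good_query_at; rewrite hp mul1n /bound.
have le1 : (N <= 2 * M * kappa)%N by rewrite leq_mul2r leq_mul2l M1_le !orbT.
have k0 := kappa_gt0.
(* The test points lie at distance 1 outside the interval; [M >= 1] absorbs this extra 1. *)
apply: (@leq_trans (2 * (M + 2 * M * kappa))%N); first by move: le1 M_gt0; clear; lia.
by rewrite leq_mul2r leq_pmulr // orbT.
Qed.

(** Beyond [- N] and [N] membership is constant and extends to the end point, so one test just
    outside decides a closed ray. *)
Lemma traced_Rays s h t : holds_input A B s -> (exists k : nat, s 5%N 0 0 = k%:Z) ->
  initialised m n s (- N%:Z) N%:Z -> (forall l, ~ output R s l) -> all good h ->
  traced o (Rays Test) s h t (fun s' h' t' =>
    [/\ [/\ same_but probe_arrays s s', exists k : nat, s' 5%N 0 0 = k%:Z & all good h'],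
        covered R A B N%:Z s' (- N%:Z) 1, size h' = (size h + 2 * asks)%N &
        (t' <= t + 2 * probe_time m n TT 1)%N]).
Proof.
move=> hin [k hk] [_ s13 s33 _] out0 hgood.
have hq1 : good (query_at A B (- N%:Z - 1) 1%N) by apply: ray_good_query; lia.
have hq2 : good (query_at A B (N%:Z + 1) 1%N) by apply: ray_good_query; lia.
apply: traced_seq.
apply: (traced_conseq (traced_Probe TestP h t (k := k) (q := 1%N) (p := - N%:Z - 1)
  hin hk _ _ _ _ hq1)) => //; first by rewrite /= s13.
move=> s1 h1 t1 [[eq1 [k1 hk1]] out1 -> le1].
have hin1 : holds_input A B s1 by apply: (holds_input_same _ eq1).
apply: (traced_conseq (traced_Probe TestP _ _ (k := k1) (q := 1%N) (p := N%:Z + 1)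
  hin1 hk1 _ _ _ _ hq2)) => //; first by rewrite /= eq1 // s33.
move=> s2 h2 t2 [[eq2 hk2] out2 -> le2].
move: out2; rewrite /= eq1 // s33 => out2.
move: out1; rewrite /= s13 => out1.
have NR : (N%:R : R) = (2 * M1 * kappa)%:R by [].
have outE l : output R s2 l <->
    (Sp (- N%:R - 1) /\ l <= - N%:R) \/ (Sp (N%:R + 1) /\ N%:R <= l).
  rewrite out2 out1 /in_row !divr1 !rmorphD !rmorphN /= -!pmulrn.
  split=> [[[/out0//|[h3 [_ h4]]]|[h3 [h4 _]]]|[[h3 h4]|[h3 h4]]].
  - by left; split=> //; apply: h4.
  - by right; split=> //; apply: h4.
  - by left; right.
  - by right.
split=> //.
- split=> //; first exact: same_but_trans eq1 eq2.
  by rewrite !all_cat hgood !all_nseq hq1 hq2 !orbT.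
- split.
  + move=> l /outE[[h3 h4]|[h3 h4]].
      by apply: (spec_ray_le no_col bA1 bB1 _ _ h3); rewrite -NR //; lra.
    by apply: (spec_ray_ge no_col bA1 bB1 _ _ h3); rewrite -NR //; lra.
  + move=> l hl; rewrite mulr1 rmorphN /= -pmulrn => lt; apply/outE; left.
    split; last exact: ltW.
    by apply: (spec_ray_le no_col bA1 bB1 _ _ hl); rewrite -NR //; lra.
  + move=> l hl; rewrite -pmulrn => lt; apply/outE; right.
    split; last exact: ltW.
    by apply: (spec_ray_ge no_col bA1 bB1 _ _ hl); rewrite -NR //; lra.
- by rewrite !size_cat !size_nseq mul2n -addnn addnA.
- by move: le1 le2; move: (probe_time _ _ _ _) => u; clear; lia.
Qed.
End Wide.

Definition wide_setup_time (TT : nat) : nat :=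
  (setup_time m n + 3 * kappa + 5 + 2 * probe_time m n TT 1 + 1)%N.

Lemma traced_WideSearch Test asks TT : (0 < M)%N ->
  test_correct R o Test asks TT
    (mpg_instance (2 * m) n (2 * kappa * (M + 2 * M * kappa))) ->
  traced o (WideSearch Test) (init A B) [::] 0 (fun s' h' t' =>
    [/\ forall l, output R s' l <-> Sp l,
        all (mpg_instance (2 * m) n (2 * kappa * (M + 2 * M * kappa))) h',
        (size h' <= asks * (M * (12 * kappa ^ 3)))%N &
        exists2 it, (it * asks <= size h')%N & (it <= M * (5 * kappa ^ 3))%N /\
          (t' <= wide_setup_time TT + it * loop_time m n TT)%N]).
Proof.
move=> M_gt0 TestP; apply: traced_seq.
apply: (traced_runs (runs_WideSetup o init_input (leqnn _))).
move=> s1 t1 [M1 [M1_gt0 bA1 bB1 hmin [eq1 ini1]]] le1.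
have M1_le : (M1 <= M)%N by apply: hmin.
have hin1 : holds_input A B s1 by apply: (holds_input_same _ eq1).
have out1 l : ~ output R s1 l.
  by case=> k []; rewrite /= eq1.
apply: traced_seq.
have hs5 : exists k : nat, s1 5%N 0 0 = k%:Z by exists 0%N; rewrite eq1.
apply: (traced_conseq (traced_Rays M_gt0 TestP bA1 bB1 M1_le (h := [::]) t1 hin1 hs5 ini1
  out1 isT)).
move=> s2 h2 t2 [[eq2 hk2 good2] cov2 sz2 le2].
have hin2 : holds_input A B s2 by apply: (holds_input_same _ eq2).
case: ini1 => ini_k _ _ [[r1 r2 r3] [r4 r5 r6]].
set N := (2 * M1 * kappa)%N in r1 r3 r4 r6 cov2.
have k0 := kappa_gt0.
have hreg : registers s2 (- N%:Z) 1 (N%:Z - - N%:Z) (- N%:Z * kappa%:Z + 1) kappa%:Z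
    (N%:Z * kappa%:Z - (- N%:Z * kappa%:Z + 1)).
  by rewrite /registers !eq2.
apply: (traced_conseq (@traced_FareyLoop R o m n A B Test asks TT _ TestP no_col M bA bB
  (- N%:Z) N%:Z (wide_good_query M1_le) (4 * M1 * kappa ^ 3).+1 _ _ t2 k0 hin2 hk2 _ hreg _ cov2 good2)).
- by rewrite eq2.
- have e : (4 * M1 * kappa ^ 3 = (N + N) * kappa ^ 2)%N.
    by rewrite /N (expnS _ 2) addnn -mul2n; move: (kappa ^ 2)%N => u; clear; lia.
  by rewrite opprK -PoszD -PoszM -e; clear; lia.
have kM : (1 <= M * kappa ^ 3)%N by rewrite muln_gt0 M_gt0 expn_gt0 k0.
have M1k : (M1 * kappa ^ 3 <= M * kappa ^ 3)%N by rewrite leq_mul2r M1_le orbT.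
move=> s3 h3 t3 [out3 good3 [it itle [itk tle]] szle]; split=> //.
(* Two queries for the rays and at most two for each of [4 * M1 * kappa ^ 3 + 1] points. As
   [M * kappa ^ 3 >= 1], the additive 4 turns the constant 8 into 12. *)
- apply: (@leq_trans (asks * (2 + 2 * (4 * M1 * kappa ^ 3).+1))%N).
    rewrite add0n in sz2; case: szle => [->|]; rewrite sz2.
      by rewrite mulnC leq_mul2l leq_addr orbT.
    by move: (4 * M1 * _)%N (nat_of_bool asks) => u a; clear; lia.
  rewrite leq_mul2l; apply/orP; right.
  by move: kM M1k; rewrite -!mulnA !(mulnCA M 12); move: (M * _)%N (M1 * _)%N => u v; clear; lia.
- exists it; first by apply: leq_trans itle; rewrite leq_addl.
  split.
    apply: leq_trans itk _; move: kM M1k; rewrite -!mulnA (mulnCA M 5).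
    by move: (M * _)%N (M1 * _)%N => u v; clear; lia.
  apply: leq_trans tle _; rewrite /wide_setup_time.
  move: le1 le2; move: (it * _)%N (probe_time _ _ _ _) (setup_time _ _) => u v w.
  by clear; lia.
Qed.

Definition tight_setup_time : nat :=
  (setup_time m n + 2 * (n * (m * (n * 5 + 8) + 8)) + 9)%N.

Lemma spec_in_tight (L U : int) l :
  max_res (Rmx R A) (Rmx R B) = (U%:~R)%:E ->
  max_res (Rmx R B) (Rmx R A) = ((- L)%:~R)%:E -> Sp l -> L%:~R <= l <= U%:~R.
Proof.
move=> hU hL hl; have := spec_le_max_res hl; rewrite hU lee_fin => ->.
have := spec_le_max_res (spec_swap hl); rewrite hL lee_fin rmorphN /=.
by rewrite lerN2 => ->.
Qed.

Lemma max_res_bounded (C D : intmx m n) (u : int) :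
  no_infty_row C -> no_infty_col D -> entries_bounded M C -> entries_bounded M D ->
  max_res (Rmx R C) (Rmx R D) = (u%:~R)%:E -> (`|u| <= 2 * M)%N.
Proof.
move=> rC cD bC bD; have [r [g [u' [hr hg [_ [j [<-]]] ->]]]] := max_res_data R n_gt0 rC cD.
case=> /eqP; rewrite eqr_int => /eqP <-.
have [_ [i]] := hg j; case Di: (D i j) => [d|] //= [<-].
by have := bounded_entry bD Di; have := row_max_bounded bC hr i; clear; lia.
Qed.

Lemma traced_TightSearch Test asks TT : no_infty_col A -> no_infty_col B ->
  test_correct R o Test asks TT (mpg_instance (2 * m) n (6 * M * kappa)) ->
  traced o (TightSearch Test) (init A B) [::] 0 (fun s' h' t' =>
    [/\ forall l, output R s' l <-> Sp l,
        all (mpg_instance (2 * m) n (6 * M * kappa)) h',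
        exists X : int,
          (max_res (Rmx R A) (Rmx R B) + max_res (Rmx R B) (Rmx R A))%E = (X%:~R)%:E /\
          if 0 <= X then (size h' <= 2 * (`|X| * kappa ^ 2) + 1)%N else nilp h' &
        exists2 it, (it * asks <= size h')%N &
          (t' <= tight_setup_time + it * loop_time m n TT)%N]).
Proof.
move=> colA colB TestP; apply: traced_seq.
apply: (traced_runs (runs_TightSetup o R n_gt0 rowA rowB colA colB init_input (leqnn _))).
move=> s1 t1 [L [U [hU hL eq1 [ini_k _ _ hreg]]]] le1.
have hin1 : holds_input A B s1 by apply: (holds_input_same _ eq1).
have out1 l : ~ output R s1 l.
  by case=> k []; rewrite /= eq1.
have bU := max_res_bounded rowA colB bA bB hU.
have bL := max_res_bounded rowB colA bB bA hL.
have k0 := kappa_gt0.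
have goodq (p : int) (q : nat) : (0 < q <= 2 * kappa)%N ->
    L * q%:Z <= p -> p <= U * q%:Z -> mpg_instance (2 * m) n (6 * M * kappa) (query_at A B p q).
  move=> /andP[_ q2] hl hu; apply: good_query_at.
  have h1 : U * q%:Z <= (2 * M)%N%:Z * q%:Z by rewrite ler_wpM2r //; move: bU; clear; lia.
  have h2 : - (2 * M)%N%:Z * q%:Z <= L * q%:Z by rewrite ler_wpM2r //; move: bL; clear; lia.
  (* Both ends are at most [2 * M] in modulus, so [|p| <= 2 * M * q]; together with [q * M] this
     gives [3 * M * q], and [q <= 2 * kappa]. *)
  apply: (@leq_trans (3 * M * q)%N).
    move: h1 h2 hl hu; rewrite mulNr -PoszM (mulnC q) -!mulnA.
    by move: (U * _) (L * _) (M * q)%N => u v w; clear; lia.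
  by apply: (@leq_trans (3 * M * (2 * kappa))%N); [rewrite leq_mul2l q2 orbT|clear; lia].
(* If [U < L] the spectrum is empty and the loop is never entered, so no query is made. *)
pose X := U - L; pose k1 := if 0 <= X then (`|X| * kappa ^ 2).+1 else 0%N.
have cov1 : covered R A B U s1 L 1.
  split=> [l /out1 //|l hl|l hl] lt;
    case/andP: (spec_in_tight hU hL hl) => h1 h2.
    by move: lt; rewrite mulr1 ltNge h1.
  by move: lt; rewrite ltNge h2.
apply: (traced_conseq (@traced_FareyLoop R o m n A B Test asks TT _ TestP no_col M bA bB
  L U goodq k1 s1 [::] t1 k0 hin1 _ ini_k hreg _ cov1 isT)).
- by exists 0%N; rewrite eq1.
- rewrite -/X /k1; case: ifP => [X0|/negbT].
    have -> : X = `|X|%N%:Z by move: X0; clear; lia.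
    by rewrite absz_nat -PoszM; clear; lia.
  rewrite -ltNge => X0; apply: (@le_trans _ _ (- 1 * (kappa ^ 2)%N%:Z)).
    by rewrite ler_pM2r ?ltz_nat ?expn_gt0 ?k0 //; move: X0; clear; lia.
  by rewrite mulN1r sub0r lerN2 lez_nat expn_gt0 k0.
move=> s3 h3 t3 [out3 good3 [it itle [_ tle]] szle]; split=> //.
- exists X; split; first by rewrite hU hL -EFinD -rmorphD.
  move: szle; rewrite /k1 add0n; case: ifP => X0.
    case=> [->//|]; move: (_ * kappa ^ 2)%N => u.
    by case: (asks); clear; lia.
  by case=> [->//|]; rewrite muln0 mul0n leqn0 addn_eq0 => /andP[].
- exists it; first exact: leq_trans itle.
  apply: leq_trans tle _; rewrite /tight_setup_time; move: le1.
  by move: (it * _)%N (setup_time _ _) => u w; move: (n * _)%N => v; clear; lia.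
Qed.
End Searches.

(** * Polynomial time bounds *)

Definition poly_bounded (f : nat -> nat) : Prop :=
  exists C K, forall E, (0 < E)%N -> (f E <= C * E ^ K)%N.

Lemma poly_bounded_const c : poly_bounded (fun=> c).
Proof. by exists c, 0%N => E _; rewrite expn0 muln1. Qed.

Lemma poly_bounded_id : poly_bounded id.
Proof. by exists 1%N, 1%N => E _; rewrite expn1 mul1n. Qed.

Lemma poly_bounded_min : poly_bounded (fun E => minn (2 * E) E).
Proof. by exists 1%N, 1%N => E _; rewrite expn1 mul1n geq_minr. Qed.

Lemma poly_bounded_add f g :
  poly_bounded f -> poly_bounded g -> poly_bounded (fun E => f E + g E)%N.
Proof.
move=> [C [K hf]] [C' [K' hg]]; exists (C + C')%N, (K + K')%N => E E0.
rewrite mulnDl; apply: leq_add.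
  apply: leq_trans (hf E E0) _; rewrite leq_mul2l; apply/orP; right.
  by rewrite leq_pexp2l // leq_addr.
apply: leq_trans (hg E E0) _; rewrite leq_mul2l; apply/orP; right.
by rewrite leq_pexp2l // leq_addl.
Qed.

Lemma poly_bounded_mul f g :
  poly_bounded f -> poly_bounded g -> poly_bounded (fun E => f E * g E)%N.
Proof.
move=> [C [K hf]] [C' [K' hg]]; exists (C * C')%N, (K + K')%N => E E0.
by rewrite expnD mulnACA leq_mul ?hf ?hg.
Qed.

Lemma poly_bounded_succ f : poly_bounded f -> poly_bounded (fun E => (f E).+1).
Proof.
move=> hf; have [C [K h]] := poly_bounded_add hf (poly_bounded_const 1).
by exists C, K => E /h; rewrite addn1.
Qed.

Ltac poly_bound := repeat first
  [ exact: poly_bounded_const | exact: poly_bounded_id | exact: poly_bounded_min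
  | apply: poly_bounded_add | apply: poly_bounded_mul | apply: poly_bounded_succ ].

Ltac monotone := repeat first
  [ exact: leqnn | assumption | apply: leq_add | apply: leq_mul | rewrite ltnS ].

Lemma minn_mono m n E : (m <= E)%N -> (n <= E)%N ->
  (minn (2 * m) n <= minn (2 * E) E)%N.
Proof. by move=> mE nE; rewrite leq_min !geq_min nE leq_mul2l mE !orbT. Qed.

Definition wide_total (m n TT : nat) : nat :=
  (wide_setup_time m n TT + loop_time m n TT)%N.

Definition tight_total (m n : nat) : nat :=
  (tight_setup_time m n + loop_time m n 1)%N.

Definition free_query_bound (m n M : nat) : nat :=
  (2 * minn (2 * m) n * (M + 2 * M * minn (2 * m) n))%N.

Definition free_total (m n M : nat) : nat :=
  (wide_setup_time m n (solver_time (2 * m) n (free_query_bound m n M)) +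
   M * (5 * (minn (2 * m) n * minn (2 * m) n * minn (2 * m) n)) *
   loop_time m n (solver_time (2 * m) n (free_query_bound m n M)))%N.

(** All sizes are replaced by a common bound [E], later [m * n] or [m * n * M.+1], which reduces the
    time bounds to polynomials in one variable. *)
Lemma wide_total_mono m n E : (m <= E)%N -> (n <= E)%N ->
  (wide_total m n 1 <= wide_total E E 1)%N.
Proof.
move=> mE nE; have kE := minn_mono mE nE.
rewrite /wide_total /wide_setup_time /loop_time /probe_time /setup_time.
by monotone.
Qed.

Lemma tight_total_mono m n E : (m <= E)%N -> (n <= E)%N ->
  (tight_total m n <= tight_total E E)%N.
Proof.
move=> mE nE; have kE := minn_mono mE nE.
rewrite /tight_total /tight_setup_time /loop_time /probe_time /setup_time.
by monotone.
Qed.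

Lemma free_total_mono m n M E : (m <= E)%N -> (n <= E)%N -> (M <= E)%N ->
  (free_total m n M <= free_total E E E)%N.
Proof.
move=> mE nE ME; have kE := minn_mono mE nE.
rewrite /free_total /wide_setup_time /loop_time /probe_time /setup_time.
rewrite /solver_time /pass_time /free_query_bound.
by monotone.
Qed.

Lemma wide_total_poly : poly_bounded (fun E => wide_total E E 1).
Proof.
rewrite /wide_total /wide_setup_time /loop_time /probe_time /setup_time.
by poly_bound.
Qed.

Lemma tight_total_poly : poly_bounded (fun E => tight_total E E).
Proof.
rewrite /tight_total /tight_setup_time /loop_time /probe_time /setup_time.
by poly_bound.
Qed.

Lemma free_total_poly : poly_bounded (fun E => free_total E E E).
Proof.
rewrite /free_total /wide_setup_time /loop_time /probe_time /setup_time.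
rewrite /solver_time /pass_time /free_query_bound.
by poly_bound.
Qed.

Lemma mpg_instance_playable m n b q : mpg_instance m n b q -> playable q.
Proof. by case/and5P. Qed.

(** With [c] the number of queries, the setup is charged to the additional unit in [c.+1] and each
    turn of the loop to a query of its own. *)
Lemma per_query_time (S L it t c C K D : nat) :
  (t <= S + it * L)%N -> (it <= c)%N -> (S + L <= C * D ^ K)%N ->
  (t <= C * c.+1 * D ^ K)%N.
Proof.
move=> ht hit hC; apply: leq_trans ht _; rewrite mulnAC.
apply: (@leq_trans ((S + L) * c.+1)); last by rewrite leq_mul2r hC orbT.
rewrite mulnDl leq_add ?leq_pmulr // mulnC leq_mul2l; apply/orP; right.
exact: leqW.
Qed.

(* C and K are absolute constants. In part 1 and part 2, t counts the steps made
   outside the oracle: polynomially many in m and n per call. *)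
Theorem theorem8 (R : realType) :
  exists (C K : nat) (P1 P2 P0 : cmd),
  forall (m n M : nat) (A B : intmx m n),
    (0 < m)%N -> (0 < n)%N ->
    no_infty_row A -> no_infty_row B -> no_common_infty_col A B ->
    entries_bounded M A -> entries_bounded M B ->
    let kappa := minn (2 * m) n in
    let S := spec (Rmx R A) (Rmx R B) in
    (* 1 *)
    [/\ (0 < M)%N ->
        forall (o : oracle) (MPG : nat -> nat -> nat -> nat),
          mpg_oracle R o -> time_bounded o MPG ->
          exists (s : store) (t : nat) (qs : seq query),
            let bound := (2 * kappa * (M + 2 * M * kappa))%N in
            [/\ exec o P1 (init A B) s t qs /\ output R s = S,
                (size qs <= M * (C * kappa ^ 3))%N,
                all (mpg_instance (2 * m) n bound) qs,
                all (fun q => time o q <= MPG (2 * m) n bound)%N qs &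
                (t <= C * (size qs).+1 * (m * n) ^ K)%N],
        (* 1, in particular: no call to the oracle *)
        forall o : oracle,
          exists (s : store) (t : nat),
            [/\ exec o P0 (init A B) s t [::], output R s = S &
                (t <= C * (m * n * M.+1) ^ K)%N] &
        (* 2 *)
        no_infty_col A -> no_infty_col B ->
        forall (o : oracle) (MPG : nat -> nat -> nat -> nat),
          mpg_oracle R o -> time_bounded o MPG ->
          exists (s : store) (t : nat) (qs : seq query),
            let X := (max_res (Rmx R A) (Rmx R B)
                      + max_res (Rmx R B) (Rmx R A))%E in
            let bound := (6 * M * kappa)%N in
            [/\ exec o P2 (init A B) s t qs /\ output R s = S,
                [/\ (0 < X)%E ->
                      ((size qs)%:R%:E <= X * (C * kappa ^ 2)%:R%:E)%E,
                    X = 0%E -> (size qs <= 1)%N &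
                    (X < 0)%E -> size qs = 0%N],
                all (mpg_instance (2 * m) n bound) qs,
                all (fun q => time o q <= MPG (2 * m) n bound)%N qs &
                (t <= C * (size qs).+1 * (m * n) ^ K)%N]].
Proof.
have [C1 [K1 h1]] := wide_total_poly.
have [C2 [K2 h2]] := tight_total_poly.
have [C3 [K3 h3]] := free_total_poly.
(* The summand 12 is the constant in the number of calls of part 1. *)
pose C := (C1 + C2 + C3 + 12)%N; pose K := (K1 + K2 + K3)%N.
have absorb C' K' D x : (C' <= C)%N -> (K' <= K)%N -> (0 < D)%N ->
    (x <= C' * D ^ K' -> x <= C * D ^ K)%N.
  move=> hC hK D0 hx; apply: leq_trans hx _; apply: leq_mul => //.
  by rewrite leq_pexp2l.
exists C, K, (WideSearch AskOracle), (TightSearch AskOracle), (WideSearch Solver).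
move=> m n M A B m0 n0 rowA rowB no_col bA bB kappa S.
have mD : (m <= m * n)%N by rewrite leq_pmulr.
have nD : (n <= m * n)%N by rewrite leq_pmull.
have D0 : (0 < m * n)%N by rewrite muln_gt0 m0.
have k0 : (0 < kappa)%N by exact: kappa_gt0.
have outE s : (forall l, output R s l <-> S l) -> output R s = S.
  by move=> h; apply/predeqP.
split.
- move=> M0 o MPG ho htime.
  have TestP := AskOracle_correct ho
    (@mpg_instance_playable (2 * m) n (2 * kappa * (M + 2 * M * kappa))).
  have [s [t [qs [E [out good sz [it itle [_ tle]]]]]]] :=
    traced_WideSearch m0 n0 rowA rowB no_col bA bB M0 TestP.
  exists s, t, qs; split=> //.
  + by split=> //; exact: outE.
  + apply: leq_trans sz _; rewrite mul1n leq_mul2l leq_mul2r.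
    by rewrite [(12 <= C)%N]leq_addl !orbT.
  + by apply: sub_all good => q; exact: htime.
  + apply: (per_query_time tle); first by rewrite muln1 in itle.
    apply: (absorb C1 K1) => //; [by rewrite /C -!addnA leq_addr|by rewrite /K -addnA leq_addr|].
    by apply: leq_trans (h1 _ D0); apply: wide_total_mono.
- move=> o.
  (* The search needs a positive bound on the entries, while [M = 0] is allowed here. *)
  have bA' : entries_bounded M.+1 A.
    apply/forallP => i; apply/forallP => j; case Aij: (A i j) => [z|] //.
    exact: leqW (bounded_entry bA Aij).
  have bB' : entries_bounded M.+1 B.
    apply/forallP => i; apply/forallP => j; case Bij: (B i j) => [z|] //.
    exact: leqW (bounded_entry bB Bij).
  have TestP := @Solver_correct R o (2 * m)%N n (2 * kappa * (M.+1 + 2 * M.+1 * kappa))%N.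
  have [s [t [qs [E [out _ sz [it _ [itle tle]]]]]]] :=
    traced_WideSearch m0 n0 rowA rowB no_col bA' bB' (ltn0Sn M) TestP.
  have {sz} qs0 : qs = [::] by apply: size0nil; apply/eqP; rewrite -leqn0.
  exists s, t; split; [by rewrite -qs0|exact: outE|].
  have E0 : (0 < m * n * M.+1)%N by rewrite muln_gt0 D0.
  apply: (absorb C3 K3) => //.
  + by rewrite /C -addnA addnC -!addnA leq_addr.
  + by rewrite /K leq_addl.
  apply: leq_trans (h3 _ E0); apply: leq_trans tle _.
  have MD : (m * n <= m * n * M.+1)%N by rewrite leq_pmulr.
  apply: leq_trans (free_total_mono (leq_trans mD MD) (leq_trans nD MD) (leq_pmull _ D0)).
  rewrite /free_total -/kappa leq_add2l leq_mul2r; apply/orP; right.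
  have -> : (kappa * kappa * kappa = kappa ^ 3)%N by rewrite !expnS expn0 muln1 mulnA.
  exact: itle.
move=> colA colB o MPG ho htime.
have TestP := AskOracle_correct ho
  (@mpg_instance_playable (2 * m) n (6 * M * kappa)).
have [s [t [qs [E [out good [x [xE sz]] [it itle tle]]]]]] :=
  traced_TightSearch m0 n0 rowA rowB no_col bA bB colA colB TestP.
exists s, t, qs; rewrite xE; split=> //.
- by split=> //; exact: outE.
- split.
  + rewrite lte_fin ltr0z => x0; move: sz; rewrite ltW // => sz.
    rewrite -EFinM lee_fin.
    have -> : (x%:~R : R) = `|x|%N%:R by rewrite natr_absz gtr0_norm.
    rewrite -natrM ler_nat; apply: leq_trans sz _.
    have u1 : (0 < `|x| * kappa ^ 2)%N by rewrite muln_gt0 expn_gt0 k0 absz_gt0 gt_eqF.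
    (* The count [2 u + 1] is at most [3 u], because [u >= 1] when the sum of the residual maxima is
       positive. *)
    have C3' : (3 <= C)%N by rewrite /C !addnS.
    rewrite -/kappa (mulnCA _ C (kappa ^ 2)%N).
    move: (`|x| * kappa ^ 2)%N u1 => u u1; apply: (@leq_trans (3 * u)%N).
      by move: u1; clear; lia.
    by rewrite leq_mul2r C3' orbT.
  + case=> /eqP; rewrite intr_eq0 => /eqP x0; move: sz; rewrite x0 /= mul0n muln0.
    exact.
  + rewrite lte_fin ltrz0 => x0; move: sz; rewrite leNgt x0 /=.
    by move/nilP => ->.
- by apply: sub_all good => q; exact: htime.
- apply: (per_query_time tle); first by rewrite muln1 in itle.
  apply: (absorb C2 K2) => //.
  + by rewrite /C -!addnA addnCA leq_addr.
  + by rewrite /K addnAC leq_addl.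
  by apply: leq_trans (h2 _ D0); apply: tight_total_mono.
Qed.
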